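(* Let $A$ and $B$ be representation-directed algebras, let $P$ be a left abutment of $A$ and $I$ a right abutment of $B$, both of the same height $h$, and let $\Lambda$ be the gluing of $A$ and $B$ along $P$ and $I$, with projections $\phi:\Lambda\to A$ and $\psi:\Lambda\to B$. Put $(\operatorname{mod}A)_\ast=\phi_\ast(\operatorname{mod}A)$ and $(\operatorname{mod}B)_\ast=\psi_\ast(\operatorname{mod}B)$, viewed as subcategories of $\operatorname{mod}\Lambda$. Then $\operatorname{mod}\Lambda$ is the gluing of the subcategories $(\operatorname{mod}B)_\ast$ and $(\operatorname{mod}A)_\ast$.
   Context: $K$ is an algebraically closed field; algebras are basic finite-dimensional unital associative $K$-algebras; modules are finite-dimensional right modules; $D=\operatorname{Hom}_K(-,K)$; paths are composed left to right. Subcategories are full and closed under isomorphisms, direct sums and summands. An algebra is representation-directed if there is no sequence of nonzero nonisomorphisms $M_0\to\cdots\to M_t$ ($t\ge1$) between indecomposable modules with $M_0\cong M_t$. $\phi_\ast,\psi_\ast$ denote restriction of scalars. Gluing of subcategories. Let $\mathcal{A}\subseteq\operatorname{mod}\Lambda$ be a subcategory. A morphism $g:M\to N$ in $\mathcal{A}$ is right almost split in $\mathcal{A}$ if $g$ is not a retraction and any non-retraction $V\to N$ with $V\in\mathcal{A}$ factors through $g$; left almost split is dual. A short exact sequence $0\to L\xrightarrow{f}M\xrightarrow{g}N\to0$ in $\mathcal{A}$ is almost split in $\mathcal{A}$ if $L$ is indecomposable and $g$ is right almost split (equivalently $N$ is indecomposable and $f$ is left almost split). $X\in\mathcal{A}$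 is $\mathcal{A}$-projective if $\operatorname{Ext}^i_\Lambda(X,\mathcal{A})=0$ for all $i>0$ and $\mathcal{A}$-injective if $\operatorname{Ext}^i_\Lambda(\mathcal{A},X)=0$ for all $i>0$. $\mathcal{A}$ has almost split sequences if every non-$\mathcal{A}$-projective indecomposable $N\in\mathcal{A}$ is the end term, and every non-$\mathcal{A}$-injective indecomposable $L\in\mathcal{A}$ is the starting term, of an almost split sequence in $\mathcal{A}$. For subcategories $\mathcal{A},\mathcal{B}\subseteq\mathcal{L}$ of $\operatorname{mod}\Lambda$, $\mathcal{L}$ is the gluing of $\mathcal{B}$ and $\mathcal{A}$ (in this order) if: (i) $\mathcal{L}=\operatorname{add}\{\mathcal{A},\mathcal{B}\}$, i.e. every object of $\mathcal{L}$ is a direct sum of objects of $\mathcal{A}$ and $\mathcal{B}$ and all such sums are in $\mathcal{L}$; (ii) $\mathcal{A}$ and $\mathcal{B}$ have almost split sequences; (iii) if $M\in\mathcal{A}\setminus\mathcal{B}$ is indecomposable then $\operatorname{Hom}_\Lambda(M,\mathcal{B})=0$; (iv) every morphism $g:N\to M$ with $N\in\mathcal{B}$, $M\in\mathcal{A}$ factors as $g=g_1\circ g_2$ with $g_2:N\to X$, $g_1:X\to M$ for some $X\in\mathcal{A}\cap\mathcal{B}$. Abutments. A left abutment of $A$ is a uniserial projective module $P$ such that every submodule of $P$ is projective and, for every indecomposable projective $P'$ not isomorphic to a submodule of $P$, every morphism $U\to P'$ with $U\subseteq P$ factors through the inclusion $U\subseteq P$. A realization of $P$ is $(e_i,f_i)_{i=1}^h$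 with $e_1,\dots,e_h$ primitive orthogonal idempotents such that the composition series of $P$ is $0\xrightarrow{f_h=0}e_hA\xrightarrow{f_{h-1}}\cdots\xrightarrow{f_1}e_1A\cong P$, $f_i\in\operatorname{Hom}_A(e_{i+1}A,e_iA)=e_iAe_{i+1}$; $h$ is the height. An indecomposable injective $B$-module $I$ is a right abutment if $D(I)$ is a left abutment over $B^{\mathrm{op}}$; it has a realization $(\epsilon_i,g_{i-1})_{i=1}^h$: a chain of quotient maps $I\cong D(B\epsilon_h)\xrightarrow{g_{h-1}}\cdots\xrightarrow{g_1}D(B\epsilon_1)\xrightarrow{g_0=0}0$ dual to the composition series of $D(I)$, with $g_i$ regarded as an element of $\epsilon_iB\epsilon_{i+1}\cong\operatorname{Hom}_B(D(B\epsilon_{i+1}),D(B\epsilon_i))$; $h$ is its height. Gluing of algebras. $KA_h$ is the path algebra of $1\xrightarrow{\alpha_1}2\to\cdots\xrightarrow{\alpha_{h-1}}h$ with vertex idempotents $t_i$. For fixed realizations, the footing $f_P:A\to KA_h$ is the unique algebra homomorphism with $1-\sum_ie_i\mapsto0$, $e_i\mapsto t_i$, $f_i\mapsto\alpha_i$, and $g_I:B\to KA_h$ is the unique algebra homomorphism with $1-\sum_i\epsilon_i\mapsto0$, $\epsilon_i\mapsto t_i$, $g_i\mapsto\alpha_i$ ($1\le i\le h-1$). The gluing of $A$ and $B$ along $P$ and $I$ is $\Lambda=\{(a,b)\in A\times B\mid f_P(a)=g_I(b)\}$ with the natural projections $\phi,\psi$. *)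

(* Defs.v *)
From HB Require Import structures.
From mathcomp Require Export all_boot all_order all_algebra all_field.
Set Implicit Arguments.
Unset Strict Implicit.
Unset Printing Implicit Defensive.
Import GRing.Theory.
Local Open Scope ring_scope.

Reserved Notation "v <* a" (at level 40, left associativity).

Record rmod (K : fieldType) (A : algType K) := RMod {
  rmod_sort :> vectType K;
  ract : rmod_sort -> A -> rmod_sort;
  ract_linearl : forall a : A, linear (ract^~ a);
  ract_linearr : forall v : rmod_sort, linear (ract v);
  ractv1 : forall v, ract v 1 = v;
  ractA : forall v a b, ract (ract v a) b = ract v (a * b)
}.
Arguments ract {K A r} v a.
Notation "v <* a" := (ract v a) : ring_scope.

Section Modules.
Variables (K : fieldType) (A : algType K).
Implicit Types (L M N V X Y : rmod A).

Record rhom M N := RHom {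
  rhom_lfun :> 'Hom(M, N);
  rhomP : forall v a, rhom_lfun (v <* a) = rhom_lfun v <* a
}.

Definition riso M N : Prop := exists f : rhom M N, bijective f.
Definition rnull M : Prop := forall v : M, v = 0.

Definition ractr (M : rmod A) (a : A) : M -> M := fun v => v <* a.
HB.instance Definition _ M a :=
  GRing.isLinear.Build K M M _ (@ractr M a) (ract_linearl a).

Section Zero.
Definition zero_act (v : 'rV[K]_0) (a : A) : 'rV[K]_0 := v.
Lemma zero_linearl a : linear (zero_act^~ a). Proof. by []. Qed.
Lemma zero_linearr v : linear (zero_act v).
Proof. by move=> k a b; apply/rowP; case. Qed.
Lemma zero_1 v : zero_act v 1 = v. Proof. by []. Qed.
Lemma zero_A v a b : zero_act (zero_act v a) b = zero_act v (a * b).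
Proof. by []. Qed.
Definition rmod0 : rmod A :=
  @RMod K A 'rV[K]_0 zero_act zero_linearl zero_linearr zero_1 zero_A.
End Zero.

Section DirectSum.
Variables M N : rmod A.
Definition dsum_act (v : M * N) (a : A) : M * N := (v.1 <* a, v.2 <* a).
Lemma dsum_linearl a : linear (dsum_act^~ a).
Proof. by move=> k u v; rewrite /dsum_act /= !ract_linearl. Qed.
Lemma dsum_linearr v : linear (dsum_act v).
Proof. by move=> k a b; rewrite /dsum_act /= !ract_linearr. Qed.
Lemma dsum_1 v : dsum_act v 1 = v.
Proof. by case: v => u v; rewrite /dsum_act /= !ractv1. Qed.
Lemma dsum_A v a b : dsum_act (dsum_act v a) b = dsum_act v (a * b).
Proof. by rewrite /dsum_act /= !ractA. Qed.
Definition dsum : rmod A :=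
  @RMod K A (M * N)%type dsum_act dsum_linearl dsum_linearr dsum_1 dsum_A.
End DirectSum.

Definition dsums (s : seq (rmod A)) : rmod A := foldr dsum rmod0 s.

Definition indecomposable M : Prop :=
  ~ rnull M /\ forall X Y, riso M (dsum X Y) -> rnull X \/ rnull Y.

Record submodule M := Submodule {
  sub_vspace :> {vspace M};
  sub_stable : forall v a, v \in sub_vspace -> v <* a \in sub_vspace
}.

Section SubMod.
Variables (M : rmod A) (U : submodule M).
Definition sub_act (v : subvs_of U) (a : A) : subvs_of U :=
  Subvs (sub_stable a (subvsP v)).
Lemma sub_linearl a : linear (sub_act^~ a).
Proof. by move=> k u v; apply: val_inj; rewrite /= ract_linearl. Qed.
Lemma sub_linearr v : linear (sub_act v).
Proof. by move=> k a b; apply: val_inj; rewrite /= ract_linearr. Qed.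
Lemma sub_1 v : sub_act v 1 = v.
Proof. by apply: val_inj; rewrite /= ractv1. Qed.
Lemma sub_A v a b : sub_act (sub_act v a) b = sub_act v (a * b).
Proof. by apply: val_inj; rewrite /= ractA. Qed.
Definition sub_rmod : rmod A :=
  @RMod K A (subvs_of U) sub_act sub_linearl sub_linearr sub_1 sub_A.
Lemma sub_incl_hom (v : sub_rmod) a :
  linfun (vsval : sub_rmod -> M) (v <* a) = linfun (vsval : sub_rmod -> M) v <* a.
Proof. by rewrite !lfunE. Qed.
Definition sub_incl : rhom sub_rmod M := RHom sub_incl_hom.
End SubMod.

Definition uniserial M : Prop :=
  ~ rnull M /\ forall U V : submodule M, (U <= V)%VS || (V <= U)%VS.

(* V / U is a simple module *)
Definition simple_factor M (U V : submodule M) : Prop :=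
  [/\ (U <= V)%VS, ~~ (V <= U)%VS &
      forall W : submodule M, (U <= W)%VS -> (W <= V)%VS ->
        (W <= U)%VS \/ (V <= W)%VS].

Definition exact_at L M N (f : rhom L M) (g : rhom M N) : Prop :=
  forall v : M, g v = 0 <-> exists u : L, f u = v.

Definition surj M N (f : rhom M N) : Prop := forall y : N, exists x : M, f x = y.

Definition short_exact L M N (f : rhom L M) (g : rhom M N) : Prop :=
  [/\ injective f, exact_at f g & surj g].

Definition projective X : Prop :=
  forall M N (p : rhom M N) (u : rhom X N), surj p ->
    exists v : rhom X M, u =1 p \o v.

Definition injective_mod X : Prop :=
  forall M N (j : rhom M N) (u : rhom M X), injective j ->
    exists v : rhom N X, u =1 v \o j.

Record proj_resolution X := ProjResolution {
  res_obj : nat -> rmod A;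
  res_d : forall i, rhom (res_obj i.+1) (res_obj i);
  res_aug : rhom (res_obj 0) X;
  res_proj : forall i, projective (res_obj i);
  res_surj : surj res_aug;
  res_exact0 : exact_at (res_d 0) res_aug;
  res_exactS : forall i, exact_at (res_d i.+1) (res_d i)
}.

Section Ext.
Variables (X Y : rmod A) (P : proj_resolution X).

Definition cocycle i (f : rhom (res_obj P i) Y) : Prop :=
  forall x, f (res_d P i x) = 0.

Definition coboundary i : rhom (res_obj P i) Y -> Prop :=
  match i with
  | 0 => fun f => forall x, f x = 0
  | j.+1 => fun f => exists g : rhom (res_obj P j) Y, f =1 g \o res_d P j
  end.
End Ext.

(* Ext^i(X, Y) = 0, where Ext^i(X, Y) is the i-th cohomology of Hom(P, Y) for
   a projective resolution P of X (all choices of P give the same groups). *)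
Definition Ext_vanishes i X Y : Prop :=
  forall (P : proj_resolution X) (f : rhom (res_obj P i) Y),
    cocycle f -> coboundary f.

Definition subcat := rmod A -> Prop.
Implicit Types (C D E : subcat).

Definition is_subcategory C : Prop :=
  [/\ forall M N, riso M N -> C M -> C N,
      C rmod0,
      forall M N, C M -> C N -> C (dsum M N) &
      forall M N, C (dsum M N) -> C M /\ C N].

Definition retraction M N (g : rhom M N) : Prop :=
  exists s : rhom N M, cancel s g.

Definition right_almost_split C M N (g : rhom M N) : Prop :=
  ~ retraction g /\
  forall V (v : rhom V N), C V -> ~ retraction v ->
    exists w : rhom V M, v =1 g \o w.

Definition almost_split_sequence C L M N (f : rhom L M) (g : rhom M N) : Prop :=
  [/\ [/\ C L, C M & C N], short_exact f g, indecomposable L &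
      right_almost_split C g].

Definition rel_projective C X : Prop :=
  C X /\ forall i Y, (0 < i)%N -> C Y -> Ext_vanishes i X Y.
Definition rel_injective C X : Prop :=
  C X /\ forall i Y, (0 < i)%N -> C Y -> Ext_vanishes i Y X.

Definition has_almost_split_sequences C : Prop :=
  (forall N, C N -> indecomposable N -> ~ rel_projective C N ->
     exists L M (f : rhom L M) (g : rhom M N), almost_split_sequence C f g) /\
  (forall L, C L -> indecomposable L -> ~ rel_injective C L ->
     exists M N (f : rhom L M) (g : rhom M N), almost_split_sequence C f g).

(* [E] is the gluing of [D] and [C], in this order. *)
Record is_gluing E D C : Prop := IsGluing {
  gluing_subcat : [/\ is_subcategory E, is_subcategory D & is_subcategory C];
  gluing_sub : (forall M, D M -> E M) /\ (forall M, C M -> E M);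
  gluing_add : forall M, E M <->
    exists s : seq (rmod A),
      (forall i, (i < size s)%N -> C (nth rmod0 s i) \/ D (nth rmod0 s i)) /\
      riso M (dsums s);
  gluing_ass : has_almost_split_sequences C /\ has_almost_split_sequences D;
  gluing_hom0 : forall M N (f : rhom M N),
    C M -> ~ D M -> indecomposable M -> D N -> forall x, f x = 0;
  gluing_factor : forall N M (g : rhom N M), D N -> C M ->
    exists X (g2 : rhom N X) (g1 : rhom X M), [/\ C X, D X & g =1 g1 \o g2]
}.

(* Modules are indexed by [nat] only for convenience: just M 0, ..., M t and
   f 0, ..., f t.-1 are constrained. *)
Definition representation_directed : Prop :=
  ~ exists (t : nat) (M : nat -> rmod A) (f : forall i, rhom (M i) (M i.+1)),
      [/\ (0 < t)%N,
          forall i, (i <= t)%N -> indecomposable (M i),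
          forall i, (i < t)%N -> (exists x, f i x != 0) /\ ~ bijective (f i) &
          riso (M 0) (M t)].

Definition idempotent (e : A) : Prop := e * e = e.
Definition primitive_idempotent (e : A) : Prop :=
  [/\ idempotent e, e != 0 &
      forall e1 e2, idempotent e1 -> idempotent e2 -> e1 * e2 = 0 ->
        e2 * e1 = 0 -> e = e1 + e2 -> e1 = 0 \/ e2 = 0].

End Modules.

Arguments representation_directed {K} A.

Section Restriction.
Variables (K : fieldType) (A B : algType K) (phi : {lrmorphism A -> B}).

Section Restr.
Variable M : rmod B.
Definition restr_act (v : M) (a : A) : M := v <* phi a.
Lemma restr_linearl a : linear (restr_act^~ a).
Proof. by move=> k u v; rewrite /restr_act ract_linearl. Qed.
Lemma restr_linearr v : linear (restr_act v).
Proof. by move=> k a b; rewrite /restr_act linearP ract_linearr. Qed.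
Lemma restr_1 v : restr_act v 1 = v.
Proof. by rewrite /restr_act rmorph1 ractv1. Qed.
Lemma restr_A v a b : restr_act (restr_act v a) b = restr_act v (a * b).
Proof. by rewrite /restr_act ractA rmorphM. Qed.
Definition restr : rmod A :=
  @RMod K A M restr_act restr_linearl restr_linearr restr_1 restr_A.
End Restr.

(* closure under isomorphism of the image of restriction of scalars *)
Definition restricted_modules : subcat A :=
  fun M => exists N : rmod B, riso M (restr N).
End Restriction.

Section Opposite.
Variables (K : fieldType) (A : falgType K).
HB.instance Definition _ := Vector.copy A^c A.
Lemma opp_scalerAl k (u v : A^c) : k *: (u * v) = (k *: u : A^c) * v.
Proof. exact: (@scalerAr K A k v u). Qed.
Lemma opp_scalerAr k (u v : A^c) : k *: (u * v) = u * (k *: v : A^c).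
Proof. exact: (@scalerAl K A k v u). Qed.
HB.instance Definition _ := GRing.Lmodule_isLalgebra.Build K A^c opp_scalerAl.
HB.instance Definition _ := GRing.Lalgebra_isAlgebra.Build K A^c opp_scalerAr.
HB.instance Definition _ := GRing.UnitAlgebra.on A^c.
End Opposite.

Section Dual.
Variables (K : fieldType) (A : falgType K) (M : rmod A).
Definition dual_act (f : 'Hom(M, K^o)) (a : A^c) : 'Hom(M, K^o) :=
  (f \o linfun (@ractr K A M a))%VF.
Lemma dual_actE f a v : dual_act f a v = f (v <* (a : A)).
Proof. by rewrite comp_lfunE lfunE. Qed.
Lemma dual_linearl a : linear (dual_act^~ a).
Proof.
move=> k f g; apply/lfunP=> v.
by rewrite dual_actE [in RHS]add_lfunE [in RHS]scale_lfunE !dual_actE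
  add_lfunE scale_lfunE.
Qed.
Lemma dual_linearr f : linear (dual_act f).
Proof.
move=> k a b; apply/lfunP=> v.
rewrite dual_actE [in RHS]add_lfunE [in RHS]scale_lfunE !dual_actE.
have -> : v <* (k *: (a : A) + (b : A)) = k *: (v <* (a : A)) + v <* (b : A).
  exact: ract_linearr.
exact: linearP.
Qed.
Lemma dual_1 f : dual_act f 1 = f.
Proof. by apply/lfunP=> v; rewrite dual_actE ractv1. Qed.
Lemma dual_A f a b : dual_act (dual_act f a) b = dual_act f (a * b).
Proof. by apply/lfunP=> v; rewrite !dual_actE ractA. Qed.
Definition rdual : rmod A^c :=
  @RMod K A^c 'Hom(M, K^o) dual_act dual_linearl dual_linearr dual_1 dual_A.
End Dual.

Section FinDimAlgebra.
Variables (K : fieldType) (A : falgType K).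

Section Regular.
Definition reg_act (x a : A) : A := x * a.
Lemma reg_linearl a : linear (reg_act^~ a).
Proof. by move=> k x y; rewrite /reg_act mulrDl scalerAl. Qed.
Lemma reg_linearr x : linear (reg_act x).
Proof. by move=> k a b; rewrite /reg_act mulrDr scalerAr. Qed.
Lemma reg_1 x : reg_act x 1 = x. Proof. exact: mulr1. Qed.
Lemma reg_A x a b : reg_act (reg_act x a) b = reg_act x (a * b).
Proof. by rewrite /reg_act mulrA. Qed.
Definition regular_rmod : rmod A :=
  @RMod K A A reg_act reg_linearl reg_linearr reg_1 reg_A.
End Regular.

Lemma right_ideal_stable (u : A) (v : regular_rmod) (a : A) :
  v \in limg (amull u) -> v <* a \in limg (amull u).
Proof.
case/memv_imgP=> x _ ->.
have -> : (amull u x : regular_rmod) <* a = amull u (x * a).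
  by rewrite /= /reg_act !lfunE /= mulrA.
exact/memv_img/memvf.
Qed.
Definition right_ideal (u : A) : submodule regular_rmod :=
  Submodule (@right_ideal_stable u).

Definition eA (e : A) : rmod A := sub_rmod (right_ideal e).

Definition basic : Prop :=
  exists (n : nat) (e : 'I_n -> A),
    [/\ forall i, primitive_idempotent (e i),
        forall i j, i != j -> e i * e j = 0,
        \sum_i e i = 1 &
        forall i j, i != j -> ~ riso (eA (e i)) (eA (e j))].

Definition left_abutment (P : rmod A) : Prop :=
  [/\ uniserial P, projective P,
      forall U : submodule P, projective (sub_rmod U) &
      forall P' : rmod A, indecomposable P' -> projective P' ->
        ~ (exists U : submodule P, riso P' (sub_rmod U)) ->
        forall (U : submodule P) (g : rhom (sub_rmod U) P'),
          exists g' : rhom P P', g =1 g' \o sub_incl U].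

(* The chain 0 -> e_h A -> ... -> e_1 A, with maps x |-> f_i x, is a composition
   series of e_1 A (isomorphic to P): each map is injective with simple
   cokernel.  Since f_i e_(i+1) = f_i, the image of e_(i+1) A in e_i A is
   f_i A; the values of e and f at the remaining indices are irrelevant. *)
Record left_realization (P : rmod A) (h : nat) (e f : nat -> A) : Prop :=
    LeftRealization {
  lr_height : (0 < h)%N;
  lr_prim : forall i, (1 <= i <= h)%N -> primitive_idempotent (e i);
  lr_orth : forall i j, (1 <= i <= h)%N -> (1 <= j <= h)%N -> i != j ->
    e i * e j = 0;
  lr_iso : riso (eA (e 1%N)) P;
  lr_arrow : forall i, (1 <= i < h)%N -> e i * f i * e i.+1 = f i;
  lr_last : f h = 0;
  lr_inj : forall i, (1 <= i < h)%N ->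
    forall x, x \in right_ideal (e i.+1) -> f i * x = 0 -> x = 0;
  lr_simple : forall i, (1 <= i <= h)%N ->
    simple_factor (right_ideal (f i)) (right_ideal (e i))
}.
End FinDimAlgebra.

Section RightAbutment.
Variables (K : fieldType) (B : falgType K).

Definition right_abutment (I : rmod B) : Prop :=
  [/\ indecomposable I, injective_mod I & left_abutment (rdual I)].

(* eps i is used for 1 <= i <= h and g i for 0 <= i < h.  The composition series
   0 -> B eps_1 -> ... -> B eps_h of D(I) over the opposite algebra, with maps
   x |-> x g_i, is numbered in the direction opposite to [left_realization]. *)
Definition right_realization (I : rmod B) (h : nat) (eps g : nat -> B) : Prop :=
  left_realization (rdual I) h
    (fun i => eps (h.+1 - i)%N : B^c) (fun i => g (h - i)%N : B^c).
End RightAbutment.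

(* The vertices 1, ..., h are the elements 0, ..., h.-1 of 'I_h; there is exactly
   one path from i to j if i <= j, and none otherwise. *)
Definition kapath (h : nat) := {p : 'I_h * 'I_h | (p.1 <= p.2)%N}.
Definition psrc h (p : kapath h) : 'I_h := (val p).1.
Definition ptgt h (p : kapath h) : 'I_h := (val p).2.

Definition KA (K : fieldType) (h : nat) := {ffun kapath h -> K^o}.

Section PathAlgebra.
Variables (K : fieldType) (h : nat).
HB.instance Definition _ := Vector.copy (KA K h) {ffun kapath h -> K^o}.
Implicit Types x y z : KA K h.

(* the path q followed by the path r is the path p *)
Definition is_concat (q r p : kapath h) : bool :=
  [&& ptgt q == psrc r, psrc p == psrc q & ptgt p == ptgt r].

Definition KA_mul x y : KA K h :=
  [ffun p => \sum_q \sum_(r | is_concat q r p) x q * y r].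
Definition KA_one : KA K h := [ffun p => (psrc p == ptgt p)%:R].

Let mx x : 'M[K]_h :=
  \matrix_(i, j) \sum_(p | (psrc p == i) && (ptgt p == j)) x p.

Let kapathP (p q : kapath h) :
  psrc p = psrc q -> ptgt p = ptgt q -> p = q.
Proof.
by case: p q => [[i j] ij] [[i' j'] ij']; rewrite /psrc /ptgt /= => ei ej;
  apply: val_inj; rewrite /= ei ej.
Qed.

Let mxE_path x p : mx x (psrc p) (ptgt p) = x p.
Proof. by rewrite mxE (big_pred1 p). Qed.

Let mx_inj : injective mx.
Proof. by move=> x y xy; apply/ffunP=> p; rewrite -!mxE_path xy. Qed.

Let concat_ex (q r : kapath h) : ptgt q = psrc r ->
  exists p, is_concat q r p.
Proof.
move=> qr; have le : (psrc q <= ptgt r)%N.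
  by apply: leq_trans (valP q) _; rewrite -/(ptgt q) qr; apply: valP r.
exists (exist _ (psrc q, ptgt r) le : kapath h).
by rewrite /is_concat qr /psrc /ptgt /= !eqxx.
Qed.

Let mx_mul x y : mx (KA_mul x y) = mx x *m mx y.
Proof.
apply/matrixP=> i j; rewrite !mxE.
under eq_bigr do rewrite ffunE.
rewrite exchange_big /=.
under eq_bigr do rewrite (exchange_big_dep xpredT) //=.
transitivity (\sum_(k < h) \sum_(q | (psrc q == i) && (ptgt q == k))
    \sum_(r | (psrc r == k) && (ptgt r == j)) x q * y r : K); last first.
  apply: eq_bigr => k _; rewrite !mxE big_distrl /=.
  by apply: eq_bigr => q _; rewrite big_distrr.
rewrite [RHS](exchange_big_dep xpredT) //=; apply: eq_bigr => q _.
rewrite [RHS](exchange_big_dep xpredT) //=; apply: eq_bigr => r _.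
have [/andP[/andP[/eqP qi /eqP rj] /eqP qr]|bad] :=
    boolP ((psrc q == i) && (ptgt r == j) && (ptgt q == psrc r)).
  have [p pP] := concat_ex qr.
  rewrite (big_pred1 p); last first.
    move=> p'; apply/idP/eqP => [|->].
      move=> /andP[_ /and3P[_ /eqP s /eqP t]].
      by case/and3P: pP => _ /eqP s' /eqP t'; apply: kapathP; congruence.
    case/and3P: (pP) => _ /eqP s' /eqP t'.
    by rewrite s' t' qi rj !eqxx.
  rewrite (big_pred1 (ptgt q)) // => k.
  by rewrite /= qi rj -qr !eqxx andbT /= [in RHS]eq_sym andbb.
rewrite !big_pred0 // => [k|p]; apply/negP.
  move=> /andP[/andP[/eqP qi /eqP qk] /andP[/eqP rk /eqP rj]].
  by case/negP: bad; rewrite qi rj qk rk !eqxx.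
move=> /andP[/andP[/eqP s /eqP t] /and3P[/eqP a /eqP b /eqP c]].
by case/negP: bad; rewrite -b -c s t a !eqxx.
Qed.

Let mx_one : mx KA_one = 1%:M.
Proof.
apply/matrixP=> i j; rewrite !mxE; have [<-|ij] := eqVneq i j.
  rewrite (big_pred1 (exist _ (i, i) (leqnn i) : kapath h)) ?ffunE ?eqxx //.
rewrite big1 // => p /andP[/eqP si /eqP tj]; rewrite ffunE si tj.
by rewrite (negPf ij).
Qed.

Let mx_linear : linear mx.
Proof.
move=> k x y; apply/matrixP=> i j; rewrite !mxE mulr_sumr -big_split /=.
by apply: eq_bigr => p _; rewrite !ffunE.
Qed.

Let mxD x y : mx (x + y) = mx x + mx y.
Proof. by have := mx_linear 1 x y; rewrite !scale1r. Qed.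
Let mxZ k x : mx (k *: x) = k *: mx x.
Proof.
have m0 : mx 0 = 0 by apply: (addrI (mx 0)); rewrite -mxD !addr0.
by have := mx_linear k x 0; rewrite m0 !addr0.
Qed.

Lemma KA_mulA : associative KA_mul.
Proof. by move=> x y z; apply: mx_inj; rewrite !mx_mul mulmxA. Qed.
Lemma KA_mul1 : left_id KA_one KA_mul.
Proof. by move=> x; apply: mx_inj; rewrite mx_mul mx_one mul1mx. Qed.
Lemma KA_mulr1 : right_id KA_one KA_mul.
Proof. by move=> x; apply: mx_inj; rewrite mx_mul mx_one mulmx1. Qed.
Lemma KA_mulDl : left_distributive KA_mul +%R.
Proof. by move=> x y z; apply: mx_inj; rewrite !(mx_mul, mxD) mulmxDl. Qed.
Lemma KA_mulDr : right_distributive KA_mul +%R.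
Proof. by move=> x y z; apply: mx_inj; rewrite !(mx_mul, mxD) mulmxDr. Qed.
Lemma KA_scalerAl k x y : k *: KA_mul x y = KA_mul (k *: x) y.
Proof. by apply: mx_inj; rewrite !(mx_mul, mxZ) scalemxAl. Qed.
Lemma KA_scalerAr k x y : k *: KA_mul x y = KA_mul x (k *: y).
Proof. by apply: mx_inj; rewrite !(mx_mul, mxZ) scalemxAr. Qed.
End PathAlgebra.

Section PathAlgebraInstances.
Variables (K : fieldType) (h : nat).
Lemma KA_one_neq0 : KA_one K h.+1 != 0.
Proof.
apply/eqP=> /ffunP/(_ (exist _ (ord0, ord0) (leqnn 0))).
by rewrite !ffunE eqxx; apply/eqP/oner_neq0.
Qed.
HB.instance Definition _ := GRing.Zmodule_isNzRing.Build (KA K h.+1)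
  (@KA_mulA K h.+1) (@KA_mul1 K h.+1) (@KA_mulr1 K h.+1) (@KA_mulDl K h.+1)
  (@KA_mulDr K h.+1) KA_one_neq0.
HB.instance Definition _ := GRing.Lmodule_isLalgebra.Build K (KA K h.+1)
  (@KA_scalerAl K h.+1).
HB.instance Definition _ := GRing.Lalgebra_isAlgebra.Build K (KA K h.+1)
  (@KA_scalerAr K h.+1).
HB.instance Definition _ := Algebra_isFalgebra.Build K (KA K h.+1).
End PathAlgebraInstances.

(* the path from the vertex i to the vertex j, where 1 <= i <= j <= h *)
Definition kpath (K : fieldType) (h i j : nat) : KA K h :=
  [ffun p => (((psrc p).+1 == i) && ((ptgt p).+1 == j))%:R].

(* e_i is sent to the vertex idempotent t_i, and f_i to the arrow alpha_i. *)
Definition is_footing (K : fieldType) (A : falgType K) (h : nat)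
    (e f : nat -> A) (F : A -> KA K h) : Prop :=
  [/\ F (1 - \sum_(1 <= i < h.+1) e i) = 0,
      forall i, (1 <= i <= h)%N -> F (e i) = kpath K h i i &
      forall i, (1 <= i < h)%N -> F (f i) = kpath K h i i.+1].

Section Glue.
Variables (K : fieldType) (A B C : falgType K).
Variables (f : {lrmorphism A -> C}) (g : {lrmorphism B -> C}).

Definition glue_pred : {pred A * B} := fun ab => f ab.1 == g ab.2.

Lemma glue_subalg : GRing.subalg_closed glue_pred.
Proof.
split=> [|k u v|u v]; rewrite !unfold_in /glue_pred.
- by rewrite /= !rmorph1.
- by move=> /eqP fu /eqP fv; rewrite /= !linearP; apply/eqP; congr (_ *: _ + _).
- by move=> /eqP fu /eqP fv; rewrite /= !rmorphM; apply/eqP; congr (_ * _).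
Qed.
HB.instance Definition _ :=
  GRing.isSubalgClosed.Build K (A * B)%type glue_pred glue_subalg.

Record glue := Glue { glue_val :> A * B; _ : glue_val \in glue_pred }.
HB.instance Definition _ := [isSub for glue_val].
HB.instance Definition _ := [Choice of glue by <:].
HB.instance Definition _ := [SubChoice_isSubAlgebra of glue by <:].

Let d (ab : A * B) : C := f ab.1 - g ab.2.
Let d_linear : linear d.
Proof.
move=> k u v; rewrite /d /=.
have -> : f (k *: u.1 + v.1) = k *: f u.1 + f v.1 by exact: linearP.
have -> : g (k *: u.2 + v.2) = k *: g u.2 + g v.2 by exact: linearP.
by rewrite opprD addrACA -scalerBr.
Qed.
HB.instance Definition _ := GRing.isLinear.Build K (A * B)%type C _ d d_linear.

Let glueE (ab : A * B) : (ab \in lker (linfun d)) = (ab \in glue_pred).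
Proof. by rewrite memv_ker lfunE /= subr_eq0. Qed.

Lemma glue_vect_axiom : Vector.axiom (\dim (lker (linfun d))) glue.
Proof.
have [r r_lin r_bij] := subvs_vect_iso (lker (linfun d)).
pose to (x : glue) : subvs_of (lker (linfun d)) :=
  Subvs (etrans (glueE (val x)) (valP x)).
pose from (x : subvs_of (lker (linfun d))) : glue :=
  Glue (etrans (esym (glueE (val x))) (valP x)).
exists (r \o to).
  by move=> k u v; rewrite /= -r_lin; congr (r _); apply: val_inj.
have [r' rK r'K] := r_bij; exists (from \o r') => x /=; last by rewrite -[RHS]r'K; congr (r _); apply: val_inj.
by apply: val_inj; rewrite /= rK.
Qed.
HB.instance Definition _ := Lmodule_hasFinDim.Build K glue glue_vect_axiom.
HB.instance Definition _ := Algebra_isFalgebra.Build K glue.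

Definition glue_fst (x : glue) : A := (val x).1.
Definition glue_snd (x : glue) : B := (val x).2.
Lemma glue_fst_linear : linear glue_fst. Proof. by []. Qed.
Lemma glue_snd_linear : linear glue_snd. Proof. by []. Qed.
Lemma glue_fst_monoid : monoid_morphism glue_fst. Proof. by []. Qed.
Lemma glue_snd_monoid : monoid_morphism glue_snd. Proof. by []. Qed.
HB.instance Definition _ :=
  GRing.isLinear.Build K glue A _ glue_fst glue_fst_linear.
HB.instance Definition _ :=
  GRing.isLinear.Build K glue B _ glue_snd glue_snd_linear.
HB.instance Definition _ :=
  GRing.isMonoidMorphism.Build glue A glue_fst glue_fst_monoid.
HB.instance Definition _ :=
  GRing.isMonoidMorphism.Build glue B glue_snd glue_snd_monoid.
End Glue.
Arguments glue_fst {K A B C} f g x.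
Arguments glue_snd {K A B C} f g x.

(* Main.v *)
Require Import Defs.
From HB Require Import structures.
From mathcomp Require Import all_boot all_order all_algebra all_field.
From mathcomp Require Import zify.
From Stdlib Require Import Classical.
Set Implicit Arguments.
Unset Strict Implicit.
Unset Printing Implicit Defensive.
Import GRing.Theory.
Local Open Scope ring_scope.

(** Write Lambda for the gluing, E = (1 - sum of the e_i, 0), E' = (0, 1 - sum of the
    eps_i), t_i = (e_i, eps_i) and s_i = (f_i, g_i) in Lambda.  In terms of quivers, Lambda
    is a part of A, followed by the chain 1 -> ... -> h+1 (entered from A only at
    its first vertex), followed by a part of B, all paths through both outer parts
    being zero.

    Structure of the algebras.  The algebra A is basic and representation-directed,
    hence A modulo its radical is a product of copies of K: the nonzero
    endomorphisms of an indecomposable module are invertible, so u A u = K u for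
    the primitive idempotents u of a complete system, and u a v b u = 0 when
    v <> u ([basic_split]).  So the simple factors of e_1 A are one-dimensional,
    e_i A is spanned by the subpaths of the chain starting at i, and the footing is
    injective on e_i A ([footing_inj_left]); dually for B ([footing_inj_right]).
    It follows that ker phi = Lambda E', ker psi = E Lambda,
    E' Lambda = E' Lambda E' and Lambda E = E Lambda E.  Thus a Lambda-module M comes
    from A if and only if M E' = 0, and from B if and only if M E = 0.  The extension
    property of the abutment P says that a path from the outer part of A into the
    chain passes through its first vertex ([abutment_factor]).

    Decomposition.  For a Lambda-module M, the submodule X = M E Lambda is killed by E'.
    Along the chain X is generated at the first vertex, hence X is pure in the chain
    M t_1 -> ... -> M t_(h+1): an element of X in the image of s_i is the image of
    an element of X.  A descending induction along the chain therefore produces a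
    complement Y of X that is a submodule, and Y E = 0 ([splitting]).  So every
    Lambda-module is the sum of a module from A and one from B.  An indecomposable module
    from A that does not come from B equals M E Lambda, and every map to a module from B
    kills M E.  Finally, a map from a module from B to one from A factors through
    its image, which comes from both.

    Almost split sequences over A.  Let N be the cokernel of a matrix T with entries
    in A, and tau the dual of the cokernel of the transpose of T acting on left
    modules, that is D Tr N up to injective summands.  For an exact sequence
    0 -> X -> M -> V -> 0, all maps N -> V lift to M if and only if X^J meets M^I T
    in X^I T only, if and only if all maps X -> tau extend to M ([lifts_pure],
    [extends_pure]).  Given N indecomposable and not projective, this yields a
    nonsplit sequence with end N and start an indecomposable summand of tau; over a
    representation-directed algebra, where every composite N -> V -> N is zero
    unless V -> N is a retraction, every such sequence is almost split.  The
    sequences with a given start are obtained in the same way from a copresentation.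

    Relative projectives.  It remains to see that modules projective or injective
    over A or B are so relative to the subcategory, for the Ext groups of Lambda.  On the
    side of A, the functor M |-> M / M E' is exact, takes projectives to
    A-projectives and is the identity on modules from A, so Ext groups between
    modules from A may be computed over A.  On the side of B, the exact functor
    M |-> (elements of M killed by E) shows that B-projective modules are
    Lambda-projective, so that modules from B have resolutions by modules from B.  Both
    facts are used one syzygy at a time ([Ext_vanish_shift]). *)

(** * Modules, homomorphisms and direct sums *)

Section Action.
Variables (K : fieldType) (A : algType K).
Implicit Types (M N : rmod A) (a b : A).

Lemma ractDl M (u v : M) a : (u + v) <* a = u <* a + v <* a.
Proof. by have := ract_linearl a 1 u v; rewrite !scale1r. Qed.
Lemma ractDr M (u : M) a b : u <* (a + b) = u <* a + u <* b.
Proof. by have := ract_linearr u 1 a b; rewrite !scale1r. Qed.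
Lemma ract0l M a : (0 : M) <* a = 0.
Proof. by apply: (addrI ((0 : M) <* a)); rewrite -ractDl !addr0. Qed.
Lemma ract0r M (u : M) : u <* 0 = 0.
Proof. by apply: (addrI (u <* 0)); rewrite -ractDr !addr0. Qed.
Lemma ractZl M (u : M) k a : (k *: u) <* a = k *: (u <* a).
Proof. by have := ract_linearl a k u 0; rewrite ract0l !addr0. Qed.
Lemma ractZr M (u : M) k a : u <* (k *: a) = k *: (u <* a).
Proof. by have := ract_linearr u k a 0; rewrite ract0r !addr0. Qed.
Lemma ractNl M (u : M) a : (- u) <* a = - (u <* a).
Proof. by rewrite -scaleN1r ractZl scaleN1r. Qed.
Lemma ractNr M (u : M) a : u <* (- a) = - (u <* a).
Proof. by rewrite -scaleN1r ractZr scaleN1r. Qed.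
Lemma ractBl M (u v : M) a : (u - v) <* a = u <* a - v <* a.
Proof. by rewrite ractDl ractNl. Qed.
Lemma ractBr M (u : M) a b : u <* (a - b) = u <* a - u <* b.
Proof. by rewrite ractDr ractNr. Qed.
Lemma ract_suml M (I : Type) (r : seq I) (Q : pred I) (F : I -> M) a :
  (\sum_(i <- r | Q i) F i) <* a = \sum_(i <- r | Q i) (F i <* a).
Proof.
by apply: (big_morph (fun x : M => x <* a)); [move=> x y; exact: ractDl | exact: ract0l].
Qed.
Lemma ract_sumr M (I : Type) (r : seq I) (Q : pred I) (u : M) (F : I -> A) :
  u <* (\sum_(i <- r | Q i) F i) = \sum_(i <- r | Q i) (u <* F i).
Proof.
by apply: (big_morph (fun x => u <* x)); [move=> x y; exact: ractDr | exact: ract0r].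
Qed.
End Action.

Section Hom.
Variables (K : fieldType) (A : algType K).
Implicit Types (L M N V W X Y Z : rmod A).

Definition linear_map_of (U V : vectType K) (f : U -> V) (H : linear f) : {linear U -> V} :=
  HB.pack f (GRing.isLinear.Build K U V _ f H).

Lemma rhom_ex M N (f : M -> N) :
  linear f -> (forall v a, f (v <* a) = f v <* a) -> exists g : rhom M N, g =1 f.
Proof.
move=> lf cf; pose F := linear_map_of lf.
have HF v a : linfun F (v <* a) = linfun F v <* a by rewrite !lfunE /= cf.
by exists (RHom HF) => x; exact: (lfunE F x).
Qed.

Lemma rid_hom M v a : (\1%VF : 'Hom(M, M)) (v <* a) = (\1%VF : 'Hom(M, M)) v <* a.
Proof. by rewrite !id_lfunE. Qed.
Definition rid M : rhom M M := RHom (@rid_hom M).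
Lemma ridE M x : rid M x = x. Proof. exact: id_lfunE. Qed.
Arguments rid : simpl never.

Lemma rcomp_hom L M N (g : rhom M N) (f : rhom L M) v a :
  (g \o f)%VF (v <* a) = (g \o f)%VF v <* a.
Proof. by rewrite !comp_lfunE !rhomP. Qed.
Definition rcomp L M N (g : rhom M N) (f : rhom L M) : rhom L N :=
  RHom (rcomp_hom g f).
Lemma rcompE L M N (g : rhom M N) (f : rhom L M) x : rcomp g f x = g (f x).
Proof. exact: comp_lfunE. Qed.
Arguments rcomp : simpl never.

Lemma radd_hom M N (g f : rhom M N) v a :
  ((g : 'Hom(M, N)) + f) (v <* a) = ((g : 'Hom(M, N)) + f) v <* a.
Proof. by rewrite !add_lfunE !rhomP ractDl. Qed.
Definition radd M N (g f : rhom M N) : rhom M N := RHom (radd_hom g f).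
Lemma raddE M N (g f : rhom M N) x : radd g f x = g x + f x.
Proof. exact: add_lfunE. Qed.
Arguments radd : simpl never.

Lemma ropp_hom M N (f : rhom M N) v a :
  (- (f : 'Hom(M, N))) (v <* a) = (- (f : 'Hom(M, N))) v <* a.
Proof. by rewrite !opp_lfunE !rhomP ractNl. Qed.
Definition ropp M N (f : rhom M N) : rhom M N := RHom (ropp_hom f).
Lemma roppE M N (f : rhom M N) x : ropp f x = - f x.
Proof. exact: opp_lfunE. Qed.
Arguments ropp : simpl never.

Lemma rzero_hom M N v a : (0 : 'Hom(M, N)) (v <* a) = (0 : 'Hom(M, N)) v <* a.
Proof. by rewrite !zero_lfunE ract0l. Qed.
Definition rzero M N : rhom M N := RHom (@rzero_hom M N).
Lemma rzeroE M N x : rzero M N x = 0. Proof. exact: zero_lfunE. Qed.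
Arguments rzero : simpl never.

Lemma rhom_sum M N (f : rhom M N) (I : finType) (y : I -> M) (a : I -> A) :
  f (\sum_i y i <* a i) = \sum_i f (y i) <* a i.
Proof. by rewrite linear_sum; apply: eq_bigr => i _; exact: rhomP. Qed.

Lemma pair_linear M (X Y : rmod A) (f : rhom M X) (g : rhom M Y) :
  linear (fun v => (f v, g v) : dsum X Y).
Proof. by move=> k u v; rewrite /= !linearP. Qed.
Lemma rpair_hom M X Y (f : rhom M X) (g : rhom M Y) v a :
  linfun (linear_map_of (pair_linear f g)) (v <* a)
  = linfun (linear_map_of (pair_linear f g)) v <* a.
Proof. by rewrite !lfunE /= !rhomP. Qed.
Definition rpair M X Y (f : rhom M X) (g : rhom M Y) : rhom M (dsum X Y) :=
  RHom (rpair_hom f g).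
Lemma rpairE M X Y (f : rhom M X) (g : rhom M Y) v : rpair f g v = (f v, g v).
Proof. exact: (lfunE (linear_map_of (pair_linear f g))). Qed.
Arguments rpair : simpl never.

Lemma fst_linear X Y : linear (fun v : dsum X Y => v.1). Proof. by []. Qed.
Lemma snd_linear X Y : linear (fun v : dsum X Y => v.2). Proof. by []. Qed.
Lemma rfst_hom X Y v a : linfun (linear_map_of (@fst_linear X Y)) (v <* a) =
  linfun (linear_map_of (@fst_linear X Y)) v <* a.
Proof. by rewrite !lfunE. Qed.
Lemma rsnd_hom X Y v a : linfun (linear_map_of (@snd_linear X Y)) (v <* a) =
  linfun (linear_map_of (@snd_linear X Y)) v <* a.
Proof. by rewrite !lfunE. Qed.
Definition rfst X Y : rhom (dsum X Y) X := RHom (@rfst_hom X Y).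
Definition rsnd X Y : rhom (dsum X Y) Y := RHom (@rsnd_hom X Y).
Lemma rfstE X Y v : rfst X Y v = v.1.
Proof. exact: (lfunE (linear_map_of (@fst_linear X Y))). Qed.
Lemma rsndE X Y v : rsnd X Y v = v.2.
Proof. exact: (lfunE (linear_map_of (@snd_linear X Y))). Qed.
Arguments rfst : simpl never.
Arguments rsnd : simpl never.
Definition rcopair X Y N (f : rhom X N) (g : rhom Y N) : rhom (dsum X Y) N :=
  radd (rcomp f (rfst X Y)) (rcomp g (rsnd X Y)).
Lemma rcopairE X Y N (f : rhom X N) (g : rhom Y N) v :
  rcopair f g v = f v.1 + g v.2.
Proof. by rewrite raddE !rcompE rfstE rsndE. Qed.
Arguments rcopair : simpl never.

Lemma fcompE (S T U : Type) (f : T -> U) (g : S -> T) x : (f \o g) x = f (g x).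
Proof. by []. Qed.

Lemma rker_stable M N (f : rhom M N) v a : v \in lker f -> v <* a \in lker f.
Proof. by rewrite !memv_ker rhomP => /eqP ->; rewrite ract0l. Qed.
Definition rker M N (f : rhom M N) : submodule M := Submodule (@rker_stable M N f).
Lemma rkerE M N (f : rhom M N) v : (v \in (rker f : {vspace M})) = (f v == 0).
Proof. exact: memv_ker. Qed.

Lemma rimg_stable M N (f : rhom M N) v a : v \in limg f -> v <* a \in limg f.
Proof. by case/memv_imgP=> u _ ->; rewrite -rhomP memv_img ?memvf. Qed.
Definition rimg M N (f : rhom M N) : submodule N := Submodule (@rimg_stable M N f).
Lemma rimgP M N (f : rhom M N) v :
  reflect (exists u, f u = v) (v \in (rimg f : {vspace N})).
Proof.
apply: (iffP memv_imgP) => [[u _ ->]|[u <-]]; first by exists u.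
by exists u; rewrite ?memvf.
Qed.

Lemma sub_inclE M (U : submodule M) (x : sub_rmod U) : sub_incl U x = val x.
Proof. by rewrite /= lfunE. Qed.
Arguments sub_incl : simpl never.
Lemma sub_incl_inj M (U : submodule M) : injective (sub_incl U).
Proof. by move=> x y; rewrite !sub_inclE => /val_inj. Qed.
Lemma sub_incl_mem M (U : submodule M) (x : sub_rmod U) :
  sub_incl U x \in (U : {vspace M}).
Proof. by rewrite sub_inclE; exact: subvsP. Qed.
Lemma sub_incl_ex M (U : submodule M) (v : M) : v \in (U : {vspace M}) ->
  exists x : sub_rmod U, sub_incl U x = v.
Proof. by move=> vU; exists (Subvs vU); rewrite sub_inclE. Qed.

(** The pseudo-inverse of the linear map f provides the factorization; it
    commutes with the action because f is injective. *)
Lemma factor_mono X M N (f : rhom M N) (u : rhom X N) : injective f ->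
  (forall x, exists y, f y = u x) -> exists w : rhom X M, u =1 f \o w.
Proof.
move=> fI H; have k0 : lker f == 0%VS by apply/lker0P.
have fV x : f ((f^-1)%VF (u x)) = u x.
  by have [y <-] := H x; rewrite (lker0_lfunK k0).
have lf : linear (fun x => (f^-1)%VF (u x)) by move=> k x y; rewrite !linearP.
have cf v a : (f^-1)%VF (u (v <* a)) = (f^-1)%VF (u v) <* a.
  by apply: fI; rewrite fV [RHS]rhomP fV rhomP.
have [w wE] := rhom_ex lf cf; by exists w => x; rewrite /= wE fV.
Qed.

Lemma factor_epi X M N (g : rhom M N) (u : rhom M X) : surj g ->
  (forall x, g x = 0 -> u x = 0) -> exists w : rhom N X, u =1 w \o g.
Proof.
move=> gS H.
have gV y : g ((g^-1)%VF y) = y.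
  by apply: limg_lfunVK; apply/(rimgP g).
have uE x y : g x = g y -> u x = u y.
  move=> e; have /eqP : u (x - y) = 0 by apply: H; rewrite linearB /= e subrr.
  by rewrite linearB subr_eq0 => /eqP.
have lf : linear (fun y => u ((g^-1)%VF y)) by move=> k x y; rewrite !linearP.
have cf v a : u ((g^-1)%VF (v <* a)) = u ((g^-1)%VF v) <* a.
  by rewrite -rhomP; apply: uE; rewrite [RHS]rhomP !gV.
have [w wE] := rhom_ex lf cf.
by exists w => x; rewrite /= wE; apply: uE; rewrite gV.
Qed.

Section Quotient.
Variables (M : rmod A) (U : submodule M).
Let Q := subvs_of (U^C)%VS.
Lemma projC_mem v : v - projv U v \in (U^C)%VS. Proof. exact: memv_projC. Qed.
(** The quotient M / U is carried by a complement of U in M, on which A acts as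
    it does on M, followed by the projection. *)
Definition quo_fun (v : M) : Q := Subvs (projC_mem v).
Lemma quo_linear : linear quo_fun.
Proof.
by move=> k u v; apply: val_inj; rewrite /= linearP opprD addrACA scalerBr.
Qed.
Lemma quo_eq0 v : (quo_fun v == 0) = (v \in (U : {vspace M})).
Proof.
apply/eqP/idP => [/(congr1 val) /= /eqP|vU].
  by rewrite subr_eq0 => /eqP ->; exact: memv_proj.
by apply: val_inj; rewrite /= projv_id // subrr.
Qed.
Lemma quo_valK (x : Q) : quo_fun (val x) = x.
Proof.
apply: val_inj; rewrite /=; apply/eqP; rewrite subr_eq addrC -subr_eq subrr eq_sym.
by apply/eqP; apply/eqP; rewrite -memv_ker lker_proj; exact: subvsP.
Qed.
Lemma quo_sub u v : (quo_fun u == quo_fun v) = (u - v \in (U : {vspace M})).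
Proof.
by rewrite -quo_eq0 addrC -scaleN1r quo_linear scaleN1r addrC subr_eq0.
Qed.
Definition quo_act (x : Q) (a : A) : Q := quo_fun (val x <* a).
Lemma quo_linearl a : linear (quo_act^~ a).
Proof. by move=> k u v; rewrite /quo_act -quo_linear -ract_linearl. Qed.
Lemma quo_linearr v : linear (quo_act v).
Proof. by move=> k a b; rewrite /quo_act -quo_linear -ract_linearr. Qed.
Lemma quo_1 v : quo_act v 1 = v. Proof. by rewrite /quo_act ractv1 quo_valK. Qed.
Lemma quo_fun_act v a : quo_act (quo_fun v) a = quo_fun (v <* a).
Proof.
apply/eqP; rewrite /quo_act quo_sub -ractBl; apply: sub_stable.
by rewrite -quo_sub quo_valK.
Qed.
Lemma quo_A v a b : quo_act (quo_act v a) b = quo_act v (a * b).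
Proof. by rewrite {2}/quo_act quo_fun_act ractA. Qed.
Definition quo : rmod A := RMod quo_linearl quo_linearr quo_1 quo_A.
Lemma quo_proj_hom v a : linfun (linear_map_of quo_linear) (v <* a) =
  (linfun (linear_map_of quo_linear) v : quo) <* a.
Proof. by rewrite !lfunE /= quo_fun_act. Qed.
Definition quo_proj : rhom M quo :=
  @RHom K A M quo (linfun (linear_map_of quo_linear)) quo_proj_hom.
Lemma quo_projE v : quo_proj v = quo_fun v.
Proof. exact: (lfunE (linear_map_of quo_linear)). Qed.
Arguments quo_proj : simpl never.
Lemma quo_proj_surj : surj quo_proj.
Proof. by move=> y; exists (val y); rewrite quo_projE quo_valK. Qed.
Lemma quo_proj_eq0 v : quo_proj v = 0 <-> v \in (U : {vspace M}).
Proof. by rewrite quo_projE -quo_eq0; split=> /eqP. Qed.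
End Quotient.

Definition rretract X M : Prop :=
  exists (i : rhom X M) (p : rhom M X), forall x, p (i x) = x.

Lemma riso_sym M N : riso M N -> riso N M.
Proof.
case=> f fB; have [f' fK f'K] := fB; have fI := can_inj fK.
have [|w wE] := @factor_mono _ _ _ f (rid N) fI; first by move=> x; exists (f' x); rewrite ridE f'K.
have wE' x : f (w x) = x by rewrite -[LHS]wE ridE.
by exists w; exists f => x; [rewrite wE' | apply: fI; rewrite wE'].
Qed.

Lemma riso_trans L M N : riso L M -> riso M N -> riso L N.
Proof.
case=> f fB [g gB]; exists (rcomp g f).
by apply: (eq_bij (bij_comp gB fB)) => x /=; rewrite rcompE.
Qed.

Lemma riso_refl M : riso M M.
Proof. by exists (rid M); exists (rid M) => x; rewrite !ridE. Qed.

Lemma risoP M N : riso M N <->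
  exists (f : rhom M N) (g : rhom N M), cancel f g /\ cancel g f.
Proof.
split=> [[f fB]|[f [g [fK gK]]]]; last by exists f; exists g.
have [f' fK f'K] := fB; have fI := can_inj fK.
have H x : exists y, f y = rid N x by exists (f' x); rewrite ridE f'K.
have [w wE] := factor_mono fI H.
have wE' x : f (w x) = x by rewrite -[LHS]wE ridE.
by exists f, w; split=> // x; apply: fI; rewrite wE'.
Qed.

Lemma inj_surj_bij M N (f : rhom M N) : injective f -> surj f -> bijective f.
Proof.
move=> fI fS; have k0 : lker f == 0%VS by apply/lker0P.
exists (f^-1)%VF; first exact: lker0_lfunK.
by move=> y; apply: limg_lfunVK; apply/(rimgP f).
Qed.

(** The complement is the kernel of p, with projection 1 - i p. *)
Lemma retract_dsum X M (i : rhom X M) (p : rhom M X) :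
  (forall x, p (i x) = x) -> riso M (dsum X (sub_rmod (rker p))).
Proof.
move=> pi.
pose q := radd (rid M) (ropp (rcomp i p)).
have qE x : q x = x - i (p x) by rewrite raddE roppE ridE rcompE.
have H x : exists y, sub_incl (rker p) y = q x.
  by apply: sub_incl_ex; rewrite rkerE qE linearB /= pi subrr.
have [w wE] := factor_mono (@sub_incl_inj _ _) H.
apply/risoP; exists (rpair p w), (rcopair i (sub_incl (rker p))); split=> x.
  by rewrite rpairE rcopairE /= -[sub_incl _ (w x)]wE qE addrC subrK.
case: x => x y; rewrite rcopairE rpairE /=.
have py : p (sub_incl _ y) = 0.
  by apply/eqP; rewrite -rkerE; exact: sub_incl_mem.
have e1 : p (i x + sub_incl (rker p) y) = x by rewrite linearD /= pi py addr0.
rewrite e1; congr (_, _); apply: (@sub_incl_inj _ (rker p)).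
by rewrite -[LHS]wE qE e1 addrC addKr.
Qed.

Lemma rnull_riso M N : riso M N -> rnull M -> rnull N.
Proof.
by case=> f [g fK gK] M0 v; rewrite -[v]gK (M0 (g v)) linear0.
Qed.

Lemma indec_riso M N : riso M N -> indecomposable M -> indecomposable N.
Proof.
move=> MN [M0 MI]; split=> [N0|X Y NXY].
  by apply: M0; apply: rnull_riso (riso_sym MN) N0.
by apply: MI; apply: riso_trans NXY.
Qed.

Lemma rretract_trans X Y Z : rretract X Y -> rretract Y Z -> rretract X Z.
Proof.
case=> i [p pi] [j [q qj]]; exists (rcomp j i), (rcomp p q) => x.
by rewrite !rcompE qj pi.
Qed.

Lemma rretract_riso X Y : riso X Y -> rretract X Y.
Proof. by case/risoP=> f [g [fK _]]; exists f, g. Qed.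

Lemma rretract_fst X Y : rretract X (dsum X Y).
Proof. by exists (rpair (rid X) (rzero X Y)), (rfst X Y) => x; rewrite rfstE rpairE ridE. Qed.
Lemma rretract_snd X Y : rretract Y (dsum X Y).
Proof. by exists (rpair (rzero Y X) (rid Y)), (rsnd X Y) => x; rewrite rsndE rpairE ridE. Qed.

Lemma indec_retract X M (i : rhom X M) (p : rhom M X) :
  (forall x, p (i x) = x) -> indecomposable M -> ~ rnull X -> riso X M /\ bijective p.
Proof.
move=> pi [_ MI] X0.
have [//|k0] := MI _ _ (retract_dsum pi).
have pI : injective p.
  move=> x y e; apply/eqP; rewrite -subr_eq0; apply/eqP.
  have: x - y \in (rker p : {vspace M}) by rewrite rkerE linearB /= e subrr.
  by case/sub_incl_ex=> z <-; rewrite (k0 z) linear0.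
have pB : bijective p by exists i => // x; apply: pI; rewrite pi.
by split=> //; apply: riso_sym; exists p.
Qed.

Lemma riso_dsum X X' Y Y' : riso X X' -> riso Y Y' -> riso (dsum X Y) (dsum X' Y').
Proof.
move=> /risoP[f [f' [fK f'K]]] /risoP[g [g' [gK g'K]]]; apply/risoP.
exists (rpair (rcomp f (rfst X Y)) (rcomp g (rsnd X Y))).
exists (rpair (rcomp f' (rfst X' Y')) (rcomp g' (rsnd X' Y'))).
by split=> -[x y]; rewrite !(rpairE, rcompE, rfstE, rsndE) /= ?fK ?gK ?f'K ?g'K.
Qed.

Lemma dim_riso M N : riso M N -> \dim {:M} = \dim {:N}.
Proof.
case=> f [g fK gK]; have k0 : lker f == 0%VS by apply/lker0P; exact: can_inj fK.
rewrite -(@limg_dim_eq _ _ _ f {:M}); last by rewrite (eqP k0) capv0.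
congr (\dim _); apply/vspaceP => x; rewrite memvf; apply/(rimgP f).
by exists (g x).
Qed.

Lemma dim_dsum X Y : \dim {:dsum X Y} = (\dim {:X} + \dim {:Y})%N.
Proof. by rewrite !dimvf. Qed.

Lemma rnull_dim X : ~ rnull X -> (0 < \dim {:X})%N.
Proof.
move=> X0; rewrite lt0n dimv_eq0; apply/negP=> /eqP f0; apply: X0 => v.
by have := memvf v; rewrite f0 memv0 => /eqP.
Qed.

(** By induction on the dimension every module is a direct sum of indecomposable
    ones; stating this as an induction principle avoids handling families of
    summands. *)
Lemma indec_ind (Q : rmod A -> Prop) M :
  (forall X Y, riso X Y -> Q X -> Q Y) ->
  (forall X, rnull X -> Q X) ->
  (forall X Y, Q X -> Q Y -> Q (dsum X Y)) ->
  (forall X, rretract X M -> indecomposable X -> Q X) -> Q M.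
Proof.
move=> Qi Q0 Qs.
have [n] := ubnP (\dim {:M}); elim: n M => // n IH M /ltnSE leM QI.
have [M0|M0] := classic (rnull M); first exact: Q0.
have [MI|MI] := classic (indecomposable M).
  by apply: QI MI; exact: rretract_riso (riso_refl M).
have [//|{}MI] := not_and_or _ _ MI.
have [X {}MI] := not_all_ex_not _ _ MI; have [Y {}MI] := not_all_ex_not _ _ MI.
have [MXY XY] := imply_to_and _ _ MI.
have [X0 Y0] := not_or_and _ _ XY.
have dM : \dim {:M} = (\dim {:X} + \dim {:Y})%N by rewrite (dim_riso MXY) dim_dsum.
have [X1 Y1] := (rnull_dim X0, rnull_dim Y0).
have YXM := rretract_riso (riso_sym MXY).
apply: Qi (riso_sym MXY) _; apply: Qs; apply: IH => [|Z ZX ZI].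
- by rewrite (leq_trans _ leM) // dM -addn1 leq_add2l.
- by apply: QI ZI; apply: rretract_trans ZX (rretract_trans (rretract_fst X Y) YXM).
- by rewrite (leq_trans _ leM) // dM -add1n leq_add2r.
- by apply: QI ZI; apply: rretract_trans ZX (rretract_trans (rretract_snd X Y) YXM).
Qed.
End Hom.
Arguments rid {K A} M : simpl never.
Arguments rcomp : simpl never.
Arguments radd : simpl never.
Arguments ropp : simpl never.
Arguments rpair : simpl never.
Arguments rfst : simpl never.
Arguments rsnd : simpl never.
Arguments rcopair : simpl never.
Arguments sub_incl : simpl never.
Arguments quo_proj : simpl never.
Arguments rzero {K A} M N : simpl never.

(** * Exact sequences, pushouts and pullbacks *)

Section Exact.
Variables (K : fieldType) (A : algType K).
Implicit Types (L M N V X Y E : rmod A).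

Lemma exact_comp0 L M N (f : rhom L M) (g : rhom M N) x :
  short_exact f g -> g (f x) = 0.
Proof. by case=> _ E _; apply/E; exists x. Qed.

Lemma injective_of_ker0 L M (f : rhom L M) : (forall x, f x = 0 -> x = 0) -> injective f.
Proof.
move=> H x y e; apply/eqP; rewrite -subr_eq0; apply/eqP/H.
by rewrite linearB /= e subrr.
Qed.

Lemma coker_exact L M (f : rhom L M) :
  injective f -> short_exact f (quo_proj (rimg f)).
Proof.
move=> fI; split=> //; last exact: quo_proj_surj.
by move=> v; split=> [/quo_proj_eq0 /rimgP|/rimgP /quo_proj_eq0].
Qed.

Lemma ker_exact M N (g : rhom M N) :
  surj g -> short_exact (sub_incl (rker g)) g.
Proof.
move=> gS; split=> //; first exact: sub_incl_inj.
move=> v; split=> [/eqP|[u <-]]; first by rewrite -rkerE => /sub_incl_ex.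
by apply/eqP; rewrite -rkerE; exact: sub_incl_mem.
Qed.

(** If r splits f, then 1 - f r vanishes on the image of f and so factors
    through g; the factor splits g. *)
Lemma section_retraction L M N (f : rhom L M) (g : rhom M N) (r : rhom M L) :
  short_exact f g -> (forall x, r (f x) = x) -> retraction g.
Proof.
move=> fg rf; have [_ fgE gS] := fg.
pose q := radd (rid M) (ropp (rcomp f r)).
have qE x : q x = x - f (r x) by rewrite raddE roppE ridE rcompE.
have H x : g x = 0 -> q x = 0 by move/fgE=> [u <-]; rewrite qE rf subrr.
have [s sE] := factor_epi gS H; exists s => y; have [x <-] := gS y.
rewrite -[s (g x)]/((s \o g) x) -sE qE linearB /= (exact_comp0 _ fg) subr0 //.
Qed.

Lemma retraction_section L M N (f : rhom L M) (g : rhom M N) :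
  short_exact f g -> retraction g -> exists r : rhom M L, forall x, r (f x) = x.
Proof.
move=> fg [s sE]; have [fI fgE gS] := fg.
pose q := radd (rid M) (ropp (rcomp s g)).
have qE x : q x = x - s (g x) by rewrite raddE roppE ridE rcompE.
have H x : exists y, f y = q x.
  by apply/fgE; rewrite qE linearB /= sE subrr.
have [r rE] := factor_mono fI H; exists r => x; apply: fI.
by rewrite -[f (r _)]/((f \o r) (f x)) -rE qE (exact_comp0 _ fg) linear0 subr0.
Qed.

Lemma pushout L L' M N (f : rhom L M) (g : rhom M N) (u : rhom L L') :
  short_exact f g -> exists E (f' : rhom L' E) (g' : rhom E N) (h : rhom M E),
    [/\ short_exact f' g', h \o f =1 f' \o u, g' \o h =1 g &
     forall X (a : rhom L' X) (b : rhom M X), a \o u =1 b \o f ->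
       exists c : rhom E X, c \o f' =1 a /\ c \o h =1 b].
Proof.
move=> fg; have [fI fgE gS] := fg.
(* E is the cokernel of the antidiagonal map L -> L' + M *)
pose d : rhom L (dsum L' M) := rpair (ropp u) f.
have dE x : d x = (- u x, f x) by rewrite rpairE roppE.
pose p := quo_proj (rimg d).
have pS : surj p by exact: quo_proj_surj.
have p0 v : p v = 0 <-> exists x, d x = v.
  by split=> [/quo_proj_eq0 /rimgP|/rimgP /quo_proj_eq0].
pose f' := rcomp p (rpair (rid L') (rzero L' M)).
pose h := rcomp p (rpair (rzero M L') (rid M)).
have f'E x : f' x = p (x, 0) by rewrite rcompE rpairE ridE rzeroE.
have hE x : h x = p (0, x) by rewrite rcompE rpairE ridE rzeroE.
have sumE x y : p (x, y) = f' x + h y.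
  by rewrite f'E hE -linearD; congr (p _); congr (_, _); rewrite /= ?addr0 ?add0r.
have kill X (c : rhom (dsum L' M) X) : (forall x, c (d x) = 0) ->
    exists c' : rhom (quo (rimg d)) X, c =1 c' \o p.
  by move=> H; apply: factor_epi => // v /p0[x <-].
have [|g' g'E] := kill _ (rcomp g (rsnd L' M)).
  by move=> x; rewrite rcompE rsndE dE (exact_comp0 _ fg).
have g'f x : g' (f' x) = 0.
  by rewrite f'E -[LHS]/((g' \o p) _) -g'E rcompE rsndE linear0.
have g'h x : g' (h x) = g x.
  by rewrite hE -[LHS]/((g' \o p) _) -g'E rcompE rsndE.
have hf x : h (f x) = f' (u x).
  apply/eqP; rewrite -subr_eq0 -linearN /= addrC -sumE; apply/eqP/p0.
  by exists x; rewrite dE.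
exists (quo (rimg d)), f', g', h; split=> //.
- split=> [||y]; last by have [x <-] := gS y; exists (h x).
    apply: injective_of_ker0 => x; rewrite f'E => /p0[z]; rewrite dE => -[<- fz].
    have -> : z = 0 by apply: fI; rewrite fz linear0.
    by rewrite linear0 oppr0.
  move=> v; split=> [|[x <-] //]; have [[x y] <-] := pS v.
  rewrite sumE linearD /= g'f g'h add0r => /fgE[z zy]; exists (x + u z).
  by rewrite linearD /= -hf zy.
- move=> X a b ab; have [|c cE] := kill _ (rcopair a b).
    by move=> x; rewrite rcopairE dE /= linearN /= [a (u x)]ab addNr.
  exists c; split=> x /=; first by rewrite f'E -[LHS]/((c \o p) _) -cE rcopairE linear0 addr0.
  by rewrite hE -[LHS]/((c \o p) _) -cE rcopairE linear0 add0r.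
Qed.

Lemma pullback L M N V (f : rhom L M) (g : rhom M N) (v : rhom V N) :
  short_exact f g -> exists E (f' : rhom L E) (g' : rhom E V) (h : rhom E M),
    [/\ short_exact f' g', h \o f' =1 f, g \o h =1 v \o g' &
     forall X (a : rhom X M) (b : rhom X V), g \o a =1 v \o b ->
       exists c : rhom X E, h \o c =1 a /\ g' \o c =1 b].
Proof.
move=> fg; have [fI fgE gS] := fg.
pose d : rhom (dsum M V) N := rcopair g (ropp v).
have dE x y : d (x, y) = g x - v y by rewrite rcopairE roppE.
pose i := sub_incl (rker d).
have iI : injective i := @sub_incl_inj _ _ _ (rker d).
have i0 x : d (i x) = 0 by apply/eqP; rewrite -rkerE; exact: sub_incl_mem.
have lift X (c : rhom X (dsum M V)) : (forall x, d (c x) = 0) ->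
    exists c' : rhom X (sub_rmod (rker d)), c =1 i \o c'.
  by move=> H; apply: factor_mono => // x; apply: sub_incl_ex; rewrite rkerE H.
pose g' := rcomp (rsnd M V) i; pose h := rcomp (rfst M V) i.
have g'E x : g' x = (i x).2 by rewrite rcompE rsndE.
have hE x : h x = (i x).1 by rewrite rcompE rfstE.
have gh x : g (h x) = v (g' x).
  have := i0 x; rewrite hE g'E; case: (i x) => a b.
  by rewrite dE => /eqP; rewrite subr_eq0 => /eqP.
have [|f' f'E] := lift _ (rpair f (rzero L V)).
  by move=> x; rewrite rpairE rzeroE dE (exact_comp0 _ fg) linear0 subr0.
have f'E' x : i (f' x) = (f x, 0) by rewrite -[LHS]f'E rpairE rzeroE.
exists (sub_rmod (rker d)), f', g', h; split=> //.
- split=> [||y].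
  + by apply: injective_of_ker0 => x e; apply: fI; have := f'E' x; rewrite e !linear0 => -[<-].
  + move=> x; split=> [e|[z <-]]; last by rewrite g'E f'E'.
    have /fgE[z zx] : g (h x) = 0 by rewrite gh e linear0.
    exists z; apply: iI; rewrite f'E' zx hE; case: (i x) (g'E x) => a b /= <-.
    by rewrite e.
  + have [x xy] := gS (v y); have : ((x, y) : dsum M V) \in (rker d : {vspace dsum M V}).
      by rewrite (rkerE d) dE xy subrr.
    by case/sub_incl_ex=> z zE; exists z; rewrite g'E /i zE.
- by move=> x /=; rewrite hE f'E'.
- move=> X a b ab; have [|c cE] := lift _ (rpair a b).
    by move=> x; rewrite rpairE dE [g (a x)]ab subrr.
  by exists c; split=> x /=; rewrite ?hE ?g'E -[i _]cE rpairE.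
Qed.

Definition extends_along L M X (f : rhom L M) : Prop :=
  forall w : rhom L X, exists w' : rhom M X, w =1 w' \o f.
Definition lifts_along M N X (g : rhom M N) : Prop :=
  forall v : rhom X N, exists v' : rhom X M, v =1 g \o v'.

Lemma extends_retract L M X Y (f : rhom L M) :
  rretract X Y -> extends_along Y f -> extends_along X f.
Proof.
case=> i [p pi] H w; have [w' wE] := H (rcomp i w).
exists (rcomp p w') => x; rewrite /= rcompE -[w' _]/((w' \o f) x) -wE rcompE.
by rewrite pi.
Qed.
Lemma lifts_retract M N X Y (g : rhom M N) :
  rretract X Y -> lifts_along Y g -> lifts_along X g.
Proof.
case=> i [p pi] H w; have [w' wE] := H (rcomp w p).
by exists (rcomp w' i) => x; rewrite /= rcompE -[LHS]/(w x) -{1}[x]pi -(rcompE w p) wE.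
Qed.

(** The extension problem into a direct sum is solved componentwise. *)
Lemma extends_indec L M Y (f : rhom L M) :
  (forall X, rretract X Y -> indecomposable X -> extends_along X f) ->
  extends_along Y f.
Proof.
apply: (indec_ind (Q := fun X => extends_along X f)) => [X Z XZ|X X0|X Z HX HZ].
- by apply: extends_retract; apply: rretract_riso; exact: riso_sym.
- by move=> w; exists (rzero M X) => x; rewrite (X0 (w x)) /= rzeroE.
- move=> w; have [a aE] := HX (rcomp (rfst X Z) w).
  have [b bE] := HZ (rcomp (rsnd X Z) w); exists (rpair a b) => x.
  rewrite /= rpairE -[a _]/((a \o f) x) -[b _]/((b \o f) x) -aE -bE !rcompE.
  by rewrite rfstE rsndE; case: (w x).
Qed.
(** The lifting problem out of a direct sum is solved componentwise. *)
Lemma lifts_indec M N Y (g : rhom M N) :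
  (forall X, rretract X Y -> indecomposable X -> lifts_along X g) ->
  lifts_along Y g.
Proof.
apply: (indec_ind (Q := fun X => lifts_along X g)) => [X Z XZ|X X0|X Z HX HZ].
- by apply: lifts_retract; apply: rretract_riso; exact: riso_sym.
- by move=> w; exists (rzero X M) => x; rewrite (X0 x) !linear0.
- move=> w; have [a aE] := HX (rcomp w (rpair (rid X) (rzero X Z))).
  have [b bE] := HZ (rcomp w (rpair (rzero Z X) (rid Z))).
  exists (rcopair a b) => -[x z]; rewrite /= rcopairE linearD /=.
  rewrite -[g (a _)]/((g \o a) x) -[g (b _)]/((g \o b) z) -aE -bE !rcompE.
  rewrite !rpairE !ridE !rzeroE -linearD; congr (w (_, _)) => /=.
    by rewrite addr0.
  by rewrite add0r.
Qed.
End Exact.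

Section LinAlg.
Variable K : fieldType.
Implicit Types (U V W : vectType K).

(** Applied to a map q from a sum of two spaces, this extends a functional from a
    subspace to the whole space while prescribing it on another subspace. *)
Lemma lfun_factor U V W (q : 'Hom(U, W)) (p : 'Hom(U, V)) :
  (forall u, q u = 0 -> p u = 0) -> exists r : 'Hom(W, V), forall u, r (q u) = p u.
Proof.
move=> H; exists (p \o q^-1)%VF => u; rewrite comp_lfunE.
apply/eqP; rewrite -subr_eq0 -linearB; apply/eqP/H.
rewrite linearB /=; apply/eqP; rewrite subr_eq0; apply/eqP.
by have /lfunP/(_ u) := inv_lfun_def q; rewrite !comp_lfunE.
Qed.

Lemma lfun_separate W (U : {vspace W}) w : w \notin U ->
  exists r : 'Hom(W, K^o), r w != 0 /\ forall u, u \in U -> r u = 0.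
Proof.
move=> wU; pose x := w - projv U w.
have x0 : x != 0 by apply: contraNneq wU => /eqP; rewrite subr_eq0 => /eqP ->; exact: memv_proj.
pose c := coord [tuple x] ord0.
have lc : linear (fun v => c (v - projv U v) : K^o).
  by move=> k u v; rewrite -[RHS]linearP; congr (c _); rewrite linearP opprD addrACA scalerBr.
exists (linfun (linear_map_of lc)); split=> [|u uU].
  rewrite (lfunE (linear_map_of lc)) /= -/x.
  have -> : c x = (x == [tuple x]`_0)%:R.
    by rewrite /= eqxx; rewrite /c -[X in coord _ _ X]/([tuple x]`_(@ord0 0)) coord_free ?seq1_free.
  by rewrite /= eqxx oner_neq0.
by rewrite (lfunE (linear_map_of lc)) /= projv_id // subrr /c linear0.
Qed.
End LinAlg.

(** * Presentations, copresentations and purity *)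

Section Presentation.
Variables (K : fieldType) (A : falgType K).
Implicit Types (L M N V X Y E : rmod A).

Section Free.
Variable I : finType.
Definition free_act (x : {ffun I -> A}) (a : A) : {ffun I -> A} :=
  [ffun i => x i * a].
Lemma free_linearl a : linear (free_act^~ a).
Proof. by move=> k x y; apply/ffunP=> i; rewrite !ffunE mulrDl scalerAl. Qed.
Lemma free_linearr x : linear (free_act x).
Proof. by move=> k a b; apply/ffunP=> i; rewrite !ffunE mulrDr scalerAr. Qed.
Lemma free_1 x : free_act x 1 = x.
Proof. by apply/ffunP=> i; rewrite !ffunE mulr1. Qed.
Lemma free_A x a b : free_act (free_act x a) b = free_act x (a * b).
Proof. by apply/ffunP=> i; rewrite !ffunE mulrA. Qed.
Definition free_rmod : rmod A :=
  @RMod K A {ffun I -> A} free_act free_linearl free_linearr free_1 free_A.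
Lemma free_actE (x : free_rmod) a i : (x <* a) i = x i * a.
Proof. by rewrite /= ffunE. Qed.

Definition fdelta (i : I) : free_rmod := [ffun j => (j == i)%:R].

Lemma fdelta_id i : fdelta i i = 1. Proof. by rewrite ffunE eqxx. Qed.
Lemma fdelta_neq i j : j != i -> fdelta i j = 0.
Proof. by move=> ij; rewrite ffunE (negPf ij). Qed.
Lemma fdelta_act Y (y : I -> Y) i : \sum_j y j <* fdelta i j = y i.
Proof.
rewrite (bigD1 i) //= big1 => [|j ij]; first by rewrite fdelta_id ractv1 addr0.
by rewrite fdelta_neq // ract0r.
Qed.
Lemma fdelta_eval Y (psi : I -> 'Hom(Y, K^o)) y i :
  \sum_j psi j (y <* fdelta i j) = psi i y.
Proof.
rewrite (bigD1 i) //= big1 => [|j ij]; first by rewrite fdelta_id ractv1 addr0.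
by rewrite fdelta_neq // ract0r linear0.
Qed.

Lemma free_sum (x : free_rmod) : x = \sum_i fdelta i <* x i.
Proof.
apply/ffunP=> j; rewrite sum_ffunE (bigD1 j) //= big1 => [|i ij].
  by rewrite ffunE addr0 ffunE eqxx mul1r.
by rewrite !ffunE eq_sym (negPf ij) mul0r.
Qed.

Lemma free_hom Y (y : I -> Y) :
  exists u : rhom free_rmod Y, forall a, u a = \sum_i y i <* a i.
Proof.
apply: rhom_ex => [k a b|a c]; last first.
  by rewrite ract_suml; apply: eq_bigr => i _; rewrite free_actE ractA.
rewrite scaler_sumr -big_split /=; apply: eq_bigr => i _.
by rewrite !ffunE ractDr ractZr.
Qed.

Lemma free_hom_delta Y (u : rhom free_rmod Y) a :
  u a = \sum_i u (fdelta i) <* a i.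
Proof. by rewrite [in LHS](free_sum a) rhom_sum. Qed.

Lemma free_projective : projective free_rmod.
Proof.
move=> M N p u pS.
have [v vE] := free_hom (fun i => ((p : 'Hom(M, N))^-1)%VF (u (fdelta i))).
exists v => x; rewrite /= vE rhom_sum free_hom_delta; apply: eq_bigr => i _.
by rewrite limg_lfunVK //; apply/(rimgP p).
Qed.

(** The dual D of the free left module on I, an injective right module. *)
Definition cofree_act (f : 'Hom({ffun I -> A}, K^o)) (a : A) :
    'Hom({ffun I -> A}, K^o) :=
  linfun (fun x : {ffun I -> A} => f [ffun i => a * x i]).
Lemma lscale_linear (a : A) : linear (fun x : {ffun I -> A} => [ffun i => a * x i] : {ffun I -> A}).
Proof. by move=> k x y; apply/ffunP=> i; rewrite !ffunE mulrDr scalerAr. Qed.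
Lemma cofree_actE f a x : cofree_act f a x = f [ffun i => a * x i].
Proof.
have l : linear (fun x : {ffun I -> A} => f [ffun i => a * x i] : K^o).
  by move=> k u v; rewrite lscale_linear linearP.
exact: (lfunE (linear_map_of l)).
Qed.
Lemma cofree_linearl a : linear (cofree_act^~ a).
Proof.
move=> k f g; apply/lfunP=> x.
by rewrite add_lfunE scale_lfunE !cofree_actE add_lfunE scale_lfunE.
Qed.
Lemma cofree_linearr f : linear (cofree_act f).
Proof.
move=> k a b; apply/lfunP=> x.
rewrite add_lfunE scale_lfunE !cofree_actE -linearP; congr (f _).
by apply/ffunP=> i; rewrite !ffunE mulrDl scalerAl.
Qed.
Lemma cofree_1 f : cofree_act f 1 = f.
Proof.
apply/lfunP=> x; rewrite cofree_actE; congr (f _); apply/ffunP=> i.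
by rewrite ffunE mul1r.
Qed.
Lemma cofree_A f a b : cofree_act (cofree_act f a) b = cofree_act f (a * b).
Proof.
apply/lfunP=> x; rewrite !cofree_actE; congr (f _); apply/ffunP=> i.
by rewrite !ffunE mulrA.
Qed.
Definition cofree_rmod : rmod A :=
  @RMod K A 'Hom({ffun I -> A}, K^o) cofree_act cofree_linearl cofree_linearr
    cofree_1 cofree_A.

Lemma cofree_hom Y (psi : I -> 'Hom(Y, K^o)) :
  exists u : rhom Y cofree_rmod,
    forall y (x : {ffun I -> A}), (u y : 'Hom(_, K^o)) x = \sum_i psi i (y <* x i).
Proof.
have l y : linear (fun x : {ffun I -> A} => \sum_i psi i (y <* x i) : K^o).
  move=> k u v; rewrite scaler_sumr -big_split /=; apply: eq_bigr => i _.
  by rewrite !ffunE ractDr ractZr linearP.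
pose F y : cofree_rmod := linfun (linear_map_of (l y)).
have FE y x : (F y : 'Hom(_, K^o)) x = \sum_i psi i (y <* x i).
  exact: (lfunE (linear_map_of (l y))).
have [||u uE] := @rhom_ex _ _ Y cofree_rmod F.
- move=> k y z; apply/lfunP=> x; rewrite add_lfunE scale_lfunE !FE.
  rewrite scaler_sumr -big_split /=; apply: eq_bigr => i _.
  by rewrite ractDl ractZl linearP.
- move=> y a; apply/lfunP=> x; rewrite cofree_actE !FE.
  by apply: eq_bigr => i _; rewrite ffunE ractA.
- by exists u => y x; rewrite uE FE.
Qed.

Lemma delta_mulE (x : {ffun I -> A}) :
  x = \sum_i [ffun j => x i * fdelta i j] :> {ffun I -> A}.
Proof.
apply/ffunP=> j; rewrite sum_ffunE (bigD1 j) //= big1 => [|i ij].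
  by rewrite !ffunE eqxx mulr1 addr0.
by rewrite !ffunE eq_sym (negPf ij) mulr0.
Qed.
End Free.

Section Matrix.
Variables (I J : finType) (T : I -> J -> A).

Definition killed Y (y : I -> Y) : Prop := forall j, \sum_i y i <* T i j = 0.

(** N is the cokernel of the map of free right modules A^J -> A^I with matrix T,
    expressed by its universal property: maps N -> Y are the families y in Y^I with
    y T = 0. *)
Definition presents N (nu : I -> N) : Prop :=
  [/\ killed nu,
      forall Y (y : I -> Y), killed y ->
        exists u : rhom N Y, forall i, u (nu i) = y i &
      forall Y (u u' : rhom N Y), (forall i, u (nu i) = u' (nu i)) -> u =1 u'].

(** L is the dual of the cokernel of the map of free left modules A^I -> A^J with
    matrix T, expressed by its universal property: maps Y -> L are the functionals on
    Y^J that vanish on Y^I T.  If T presents N, then L is D Tr N up to injective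
    summands. *)
Definition copresents L (mu : J -> 'Hom(L, K^o)) : Prop :=
  [/\ forall i l, \sum_j mu j (l <* T i j) = 0,
      forall Y (psi : J -> 'Hom(Y, K^o)),
        (forall i y, \sum_j psi j (y <* T i j) = 0) ->
        exists u : rhom Y L, forall j y, mu j (u y) = psi j y &
      forall l, (forall j a, mu j (l <* a) = 0) -> l = 0].

(** Inside M^J, the subspaces X^J and M^I T meet in X^I T only. *)
Definition pure_at X M (f : rhom X M) : Prop :=
  forall (y : I -> M) (x : J -> X), (forall j, \sum_i y i <* T i j = f (x j)) ->
    exists z : I -> X, forall j, \sum_i z i <* T i j = x j.

(** A map N -> V is a family v with v T = 0.  A family y over v has y T in X^J,
    and it can be corrected to a lift of the map exactly when y T lies in X^I T. *)
Lemma lifts_pure N nu X M V (f : rhom X M) (g : rhom M V) :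
  @presents N nu -> short_exact f g ->
  (lifts_along N g <-> pure_at f).
Proof.
move=> [nuK nuE nuU] fg; have [fI fgE gS] := fg; split.
  move=> H y x yx.
  have ky : killed (fun i => g (y i)).
    by move=> j; rewrite -[RHS](exact_comp0 (x j) fg) -yx rhom_sum.
  have [v vE] := nuE _ _ ky; have [v' v'E] := H v.
  have Hz i : exists z, f z = y i - v' (nu i).
    apply/fgE; rewrite linearB /= -[g (v' _)]/((g \o v') (nu i)) -v'E vE.
    by rewrite subrr.
  exists (fun i => (f^-1)%VF (y i - v' (nu i))) => j; apply: fI.
  rewrite -yx rhom_sum -[RHS]subr0.
  have e0 : v' (\sum_i nu i <* T i j) = 0 by rewrite nuK linear0.
  rewrite -[X in _ - X]e0 rhom_sum -sumrB; apply: eq_bigr => i _.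
  rewrite -ractBl; congr (_ <* _); apply: limg_lfunVK.
  by apply/(rimgP f).
move=> H v.
have Hy i : exists y, g y = v (nu i) by exact: gS.
pose y i := (g^-1)%VF (v (nu i)).
have yE i : g (y i) = v (nu i) by apply: limg_lfunVK; apply/(rimgP g).
have Hx j : exists x, f x = \sum_i y i <* T i j.
  apply/fgE; rewrite rhom_sum; transitivity (v (\sum_i nu i <* T i j)).
    by rewrite rhom_sum; apply: eq_bigr => i _; rewrite yE.
  by rewrite nuK linear0.
have [j|z zE] := H y (fun j => (f^-1)%VF (\sum_i y i <* T i j)).
  by rewrite limg_lfunVK //; apply/(rimgP f).
have [j|v' v'E] := nuE _ (fun i => y i - f (z i)).
  transitivity (\sum_i y i <* T i j - f (\sum_i z i <* T i j)).
    rewrite rhom_sum -sumrB; apply: eq_bigr => i _.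
    by rewrite ractBl.
  by rewrite zE limg_lfunVK ?subrr //; apply/(rimgP f).
exists v' => x; rewrite -[RHS]rcompE; move: x; apply: nuU => i.
by rewrite rcompE v'E linearB /= (exact_comp0 _ fg) subr0 yE.
Qed.

Lemma pairing_linear Y (psi : J -> 'Hom(Y, K^o)) :
  linear (fun x : {ffun J -> Y} => \sum_j psi j (x j) : K^o).
Proof.
move=> k u v; rewrite scaler_sumr -big_split; apply: eq_bigr => j _.
by rewrite !ffunE linearP.
Qed.

Lemma tcol_linear Y :
  linear (fun y : {ffun I -> Y} => [ffun j => \sum_i y i <* T i j] : {ffun J -> Y}).
Proof.
move=> k u v; apply/ffunP=> j; rewrite !ffunE scaler_sumr -big_split.
by apply: eq_bigr => i _; rewrite !ffunE ractDl ractZl.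
Qed.

Definition single Y (j : J) (y : Y) : {ffun J -> Y} :=
  [ffun j' => if j' == j then y else 0].
Lemma single_linear Y j : linear (@single Y j).
Proof.
move=> k u v; apply/ffunP=> j'; rewrite !ffunE.
by case: eqP => _ //; rewrite scaler0 addr0.
Qed.
Lemma single_sum Y (x : {ffun J -> Y}) : x = \sum_j single j (x j).
Proof.
apply/ffunP=> j; rewrite sum_ffunE (bigD1 j) //= big1 => [|i ij].
  by rewrite ffunE eqxx addr0.
by rewrite ffunE eq_sym (negPf ij).
Qed.
Lemma functional_split Y (r : 'Hom({ffun J -> Y}, K^o)) :
  exists psi : J -> 'Hom(Y, K^o), forall x, r x = \sum_j psi j (x j).
Proof.
exists (fun j => r \o linfun (linear_map_of (@single_linear Y j)))%VF => x.
rewrite {1}(single_sum x) linear_sum; apply: eq_bigr => j _.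
by rewrite comp_lfunE (lfunE (linear_map_of (@single_linear Y j))).
Qed.

(** A map X -> L is a functional on X^J killing X^I T.  It extends to a functional
    on M^J killing M^I T if and only if it kills the intersection of X^J and M^I T, and
    functionals separate points from subspaces.  With [lifts_pure], this gives the
    equality of the two defects of an exact sequence, the substance of the
    Auslander-Reiten formula. *)
Lemma extends_pure L mu X M V (f : rhom X M) (g : rhom M V) :
  @copresents L mu -> short_exact f g ->
  (extends_along L f <-> pure_at f).
Proof.
move=> [muK muE muU] [fI fgE gS]; split.
  move=> H y x yx; apply: NNPP => nz.
  pose W := limg (linfun (linear_map_of (tcol_linear (Y := X)))).
  have xW : finfun x \notin W.
    apply/negP => /memv_imgP[z _ zE]; apply: nz; exists z => j.
    move/ffunP/(_ j): zE; rewrite (lfunE (linear_map_of (@tcol_linear X))) /= !ffunE.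
    by [].
  have [r [rx rW]] := lfun_separate xW.
  have [psi psiE] := functional_split r.
  have [i z|w wE] := muE _ psi.
    transitivity (r [ffun j => z <* T i j]).
      by rewrite psiE; apply: eq_bigr => j _; rewrite ffunE.
    apply: rW; apply/memv_imgP; exists [ffun i' => if i' == i then z else 0].
      exact: memvf.
    rewrite (lfunE (linear_map_of (@tcol_linear X))) /=; apply/ffunP=> j; rewrite !ffunE.
    rewrite (bigD1 i) //= big1 => [|i' ii']; first by rewrite ffunE eqxx addr0.
    by rewrite ffunE (negPf ii') ract0l.
  have [w' w'E] := H w; case/eqP: rx; rewrite psiE.
  transitivity (\sum_j \sum_i mu j (w' (y i) <* T i j)).
    apply: eq_bigr => j _; rewrite -wE ffunE -linear_sum /=; congr (mu j _).
    by rewrite [w _]w'E /= -yx rhom_sum.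
  by rewrite exchange_big big1.
move=> H w.
have lf : linear (fun x : {ffun J -> X} => [ffun j => f (x j)] : {ffun J -> M}).
  by move=> k u v; apply/ffunP=> j; rewrite !ffunE linearP.
(* X^J + M^I -> M^J, with kernel the pairs (x, y) such that x = y T *)
pose q0 (v : {ffun J -> X} * {ffun I -> M}) : {ffun J -> M} :=
  [ffun j => f (v.1 j)] - [ffun j => \sum_i v.2 i <* T i j].
have lq : linear q0.
  move=> k u v; rewrite /q0 /= lf tcol_linear opprD addrACA scalerBr //.
pose psi := fun j => (mu j \o w)%VF.
have lp : linear (fun v : {ffun J -> X} * {ffun I -> M} => \sum_j psi j (v.1 j) : K^o).
  by move=> k u v; rewrite -pairing_linear.
have [|r rE] := @lfun_factor _ _ _ _ (linfun (linear_map_of lq)) (linfun (linear_map_of lp)).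
  case=> x y; rewrite (lfunE (linear_map_of lq)) (lfunE (linear_map_of lp)) /= => /eqP.
  rewrite subr_eq0 => /eqP/ffunP e.
  have [j|z zE] := H y x; first by have := e j; rewrite !ffunE.
  transitivity (\sum_j \sum_i mu j (w (z i) <* T i j)).
    by apply: eq_bigr => j _; rewrite comp_lfunE -zE rhom_sum linear_sum.
  by rewrite exchange_big big1.
have [Psi PsiE] := functional_split r.
have [i y|w' w'E] := muE _ Psi.
  pose d : {ffun I -> M} := [ffun i' => if i' == i then y else 0].
  have := rE (0, d); rewrite (lfunE (linear_map_of lq)) (lfunE (linear_map_of lp)) /=.
  rewrite [X in _ = X]big1 => [|j _]; last by rewrite ffunE linear0.
  rewrite PsiE => e; apply: oppr_inj; rewrite oppr0 -[RHS]e -sumrN.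
  apply: eq_bigr => j _; rewrite !ffunE linear0 sub0r linearN; congr (- Psi j _).
  rewrite (bigD1 i) //= big1 => [|i' ii']; first by rewrite ffunE eqxx addr0.
  by rewrite ffunE (negPf ii') ract0l.
exists w' => x; apply/eqP; rewrite -subr_eq0; apply/eqP; apply: muU => j a.
rewrite ractBl linearB /= -!rhomP w'E.
have := rE (single j (x <* a), 0); rewrite (lfunE (linear_map_of lq)) (lfunE (linear_map_of lp)) /=.
have sE (F : J -> K) : (forall j', j' != j -> F j' = 0) -> \sum_j F j = F j.
  by move=> F0; rewrite (bigD1 j) //= big1 ?addr0.
rewrite PsiE sE => [|j' jj']; last first.
  rewrite !ffunE (negPf jj') linear0 sub0r; apply/eqP.
  by rewrite linearN oppr_eq0 big1 ?linear0 // => i _; rewrite ffunE ract0l.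
rewrite sE => [|j' jj']; last by rewrite ffunE (negPf jj') linear0.
rewrite !ffunE eqxx comp_lfunE big1 => [|i _]; last by rewrite ffunE ract0l.
by rewrite subr0 => ->; rewrite subrr.
Qed.

Lemma presented : exists N nu, @presents N nu.
Proof.
have [u uE] := free_hom (fun j => [ffun i => T i j] : free_rmod I).
pose p := quo_proj (rimg u).
have pS : surj p by exact: quo_proj_surj.
pose nu i := p (fdelta i).
have nuE a : p a = \sum_i nu i <* a i by exact: free_hom_delta.
exists (quo (rimg u)), nu; split.
- move=> j; transitivity (p [ffun i => T i j]).
    by rewrite nuE; apply: eq_bigr => i _; rewrite ffunE.
  apply/quo_proj_eq0/rimgP; exists (fdelta j).
  by rewrite uE fdelta_act.
- move=> Y y ky; have [v vE] := free_hom y.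
  have [x|w wE] := @factor_epi _ _ _ _ _ p v pS.
    move=> /quo_proj_eq0/rimgP[a <-]; rewrite uE rhom_sum big1 // => j _.
    rewrite vE; under eq_bigr do rewrite ffunE.
    by rewrite ky ract0l.
  by exists w => i; rewrite -[LHS]wE vE fdelta_act.
- move=> Y v v' vv' x; have [a <-] := pS x; rewrite nuE !rhom_sum.
  by apply: eq_bigr => i _; rewrite vv'.
Qed.

Lemma copresented : exists L mu, @copresents L mu.
Proof.
pose S (r : cofree_rmod J) := forall i (x : A), (r : 'Hom(_, K^o)) [ffun j => x * T i j] = 0.
have lR i : linear (fun r : cofree_rmod J =>
    linfun (fun x : A => (r : 'Hom(_, K^o)) [ffun j => x * T i j]) : 'Hom(A, K^o)).
  have lx : linear (fun x : A => [ffun j => x * T i j] : {ffun J -> A}).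
    by move=> k x y; apply/ffunP=> j; rewrite !ffunE mulrDl scalerAl.
  have lr (r : 'Hom({ffun J -> A}, K^o)) : linear (fun x : A => r [ffun j => x * T i j] : K^o).
    by move=> k x y; rewrite lx linearP.
  move=> k r s; apply/lfunP=> x; rewrite add_lfunE scale_lfunE.
  rewrite (lfunE (linear_map_of (lr _))) (lfunE (linear_map_of (lr r))) (lfunE (linear_map_of (lr s))) /=.
  by rewrite add_lfunE scale_lfunE.
have lRE i (r : cofree_rmod J) x : linfun (fun x : A => (r : 'Hom(_, K^o)) [ffun j => x * T i j]) x
    = (r : 'Hom(_, K^o)) [ffun j => x * T i j].
  have lr : linear (fun x : A => (r : 'Hom({ffun J -> A}, K^o)) [ffun j => x * T i j] : K^o).
    move=> k a b; rewrite -linearP; congr (_ _).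
    by apply/ffunP=> j; rewrite !ffunE mulrDl scalerAl.
  exact: (lfunE (linear_map_of lr)).
pose U : {vspace cofree_rmod J} := (\bigcap_i lker (linfun (linear_map_of (lR i))))%VS.
have US r : r \in U <-> S r.
  split=> [rU i x|rS].
    have : r \in lker (linfun (linear_map_of (lR i))) by move: rU; apply/subvP; exact: bigcapv_inf.
    by rewrite memv_ker (lfunE (linear_map_of (lR i))) /= => /eqP/lfunP/(_ x); rewrite lRE zero_lfunE.
  apply/subv_bigcapP => i _; rewrite -memvE memv_ker (lfunE (linear_map_of (lR i))) /=.
  by apply/eqP/lfunP=> x; rewrite lRE rS zero_lfunE.
have Ust r a : r \in U -> r <* a \in U.
  move=> /US rS; apply/US => i x; rewrite cofree_actE -(rS i (a * x)).
  by congr (_ _); apply/ffunP=> j; rewrite !ffunE mulrA.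
pose L := sub_rmod (Submodule Ust).
have lev j : linear (fun l : L => (val l : 'Hom(_, K^o)) (fdelta j) : K^o).
  by move=> k u v; rewrite /= add_lfunE scale_lfunE.
pose mu j := linfun (linear_map_of (lev j)).
have muE j l : mu j l = (val l : 'Hom(_, K^o)) (fdelta j).
  exact: (lfunE (linear_map_of (lev j))).
exists L, mu; split.
- move=> i l; have /US/(_ i 1) := subvsP l; rewrite (delta_mulE [ffun _ => _]) linear_sum.
  move=> e; rewrite -[RHS]e; apply: eq_bigr => j _; rewrite muE /= cofree_actE; congr (_ _).
  by apply/ffunP=> j'; rewrite !ffunE mul1r.
- move=> Y psi psiK; have [u uE] := cofree_hom psi.
  have [y|w wE] := @factor_mono _ _ _ _ _ (sub_incl (Submodule Ust)) u (@sub_incl_inj _ _ _ _).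
    apply: sub_incl_ex => /=; apply/US => i x; rewrite uE -[RHS](psiK i (y <* x)).
    by apply: eq_bigr => j _; rewrite ffunE ractA.
  exists w => j y; rewrite muE -sub_inclE -[sub_incl _ (w y)]wE uE.
  exact: fdelta_eval.
- move=> l H; apply: val_inj; apply/lfunP=> x; rewrite [RHS]zero_lfunE (delta_mulE x) linear_sum big1 // => j _.
  by rewrite -(H j (x j)) muE /= cofree_actE.
Qed.
End Matrix.

Lemma free_cover N : exists (I : finType) (nu : I -> N) (p : rhom (free_rmod I) N),
  (forall a, p a = \sum_i nu i <* a i) /\ surj p.
Proof.
pose I : finType := 'I_(\dim {:N}).
pose nu (i : I) : N := (vbasis {:N})`_i.
have [p pE] := free_hom nu; exists I, nu, p; split=> // x.
exists [ffun i => (coord (vbasis {:N}) i x)%:A].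
rewrite pE [RHS](coord_vbasis (memvf x)); apply: eq_bigr => i _.
by rewrite ffunE ractZr ractv1.
Qed.

Lemma has_presentation N : exists (I J : finType) (T : I -> J -> A) nu, @presents I J T N nu.
Proof.
have [I [nu [p [pE pS]]]] := free_cover N.
pose J : finType := 'I_(\dim (rker p)).
pose T (i : I) (j : J) : A := ((vbasis (rker p))`_j : {ffun I -> A}) i.
exists I, J, T, nu; split.
- move=> j; rewrite -pE; apply/eqP; rewrite -rkerE.
  by apply: vbasis_mem; apply: mem_nth; rewrite size_tuple.
- move=> Y y ky; have [v vE] := free_hom y.
  have [x|w wE] := @factor_epi _ _ _ _ _ p v pS.
    move/eqP; rewrite -rkerE => /coord_vbasis ->; rewrite linear_sum big1 // => j _.
    by rewrite linearZ /= vE -[X in _ *: X]/(\sum_i y i <* T i j) ky scaler0.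
  exists w => i; transitivity (w (p (fdelta i))).
    by congr (w _); rewrite pE fdelta_act.
  by rewrite -[LHS]wE vE fdelta_act.
- move=> Y v v' vv' x; have [a <-] := pS x; rewrite pE !rhom_sum.
  by apply: eq_bigr => i _; rewrite vv'.
Qed.

(** Evaluation embeds L into the dual of A^J; the columns of the matrix span the
    common kernel in A^J of the functionals in the image, and a functional that
    vanishes on this kernel is in the image by finite-dimensional duality. *)
Lemma has_copresentation L : exists (I J : finType) (T : I -> J -> A) mu, @copresents I J T L mu.
Proof.
pose J : finType := 'I_(\dim {:L}).
pose b (k : J) : L := (vbasis {:L})`_k.
have lc (j : J) : linear (fun l : L => coord (vbasis {:L}) j l : K^o).
  by move=> k u v; rewrite linearP.
pose mu (j : J) : 'Hom(L, K^o) := linfun (linear_map_of (lc j)).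
have muE j l : mu j l = coord (vbasis {:L}) j l by exact: (lfunE (linear_map_of (lc j))).
have mu0 l : (forall j, mu j l = 0) -> l = 0.
  move=> H; rewrite [l](coord_vbasis (memvf l)) big1 // => j _.
  by rewrite -muE H scale0r.
have [io ioE] := cofree_hom mu.
have ioI : injective io.
  apply: injective_of_ker0 => l l0; apply: mu0 => j.
  by have := ioE l (fdelta j); rewrite l0 zero_lfunE fdelta_eval.
pose q0 (x : {ffun J -> A}) : {ffun J -> K^o} := [ffun k => (io (b k) : 'Hom(_, K^o)) x].
have lq : linear q0 by move=> c x y; apply/ffunP=> k; rewrite !ffunE linearP.
pose q := linfun (linear_map_of lq).
have qE x k : q x k = (io (b k) : 'Hom(_, K^o)) x.
  by rewrite /q (lfunE (linear_map_of lq)) /= ffunE.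
pose I : finType := 'I_(\dim (lker q)).
pose T (i : I) (j : J) : A := (vbasis (lker q))`_i j.
have TE i l : (io l : 'Hom(_, K^o)) [ffun j => T i j] = 0.
  rewrite (coord_vbasis (memvf l)) linear_sum sum_lfunE big1 // => k _.
  rewrite linearZ scale_lfunE /= -qE (_ : [ffun j => _] = (vbasis (lker q))`_i); last first.
    by apply/ffunP=> j; rewrite ffunE.
  have : (vbasis (lker q))`_i \in lker q.
    by apply: vbasis_mem; apply: mem_nth; rewrite size_tuple.
  by rewrite memv_ker => /eqP ->; rewrite ffunE scaler0.
exists I, J, T, mu; split.
- move=> i l; rewrite -[RHS](TE i l) ioE; apply: eq_bigr => j _.
  by rewrite ffunE.
- move=> Y psi psiK; have [u uE] := cofree_hom psi.
  have [y|w wE] := @factor_mono _ _ _ _ _ io u ioI.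
    have [x|r rE] := @lfun_factor _ _ _ _ q (u y).
      move/eqP; rewrite -memv_ker => /coord_vbasis ->; rewrite linear_sum big1 // => i _.
      rewrite linearZ /= uE; apply/eqP; rewrite scaler_eq0; apply/orP; right.
      by apply/eqP; rewrite -[RHS](psiK i y).
    (* the functional r on the dual of L is evaluation at this element *)
    exists (\sum_k r [ffun k' => (k' == k)%:R] *: b k).
    apply/lfunP=> x; rewrite -rE linear_sum sum_lfunE.
    have -> : q x = \sum_k q x k *: [ffun k' => (k' == k)%:R : K^o].
      apply/ffunP=> k; rewrite sum_ffunE (bigD1 k) //= big1 => [|k' kk'].
        by rewrite !ffunE eqxx addr0 /GRing.scale /= mulr1.
      by rewrite !ffunE eq_sym (negPf kk') scaler0.
    rewrite linear_sum; apply: eq_bigr => k _.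
    by rewrite !linearZ scale_lfunE /= -qE /GRing.scale /= mulrC.
  exists w => j y.
  have e := ioE (w y) (fdelta j); have e' := uE y (fdelta j).
  have uw : u y = io (w y) by rewrite [LHS]wE.
  by move: e'; rewrite uw e !fdelta_eval.
- by move=> l H; apply: mu0 => j; rewrite -(H j 1) ractv1.
Qed.
End Presentation.

(** * Almost split sequences over a representation-directed algebra *)

Section Directed.
Variables (K : fieldType) (A : algType K).
Hypothesis dirA : representation_directed A.

(** A nonzero nonisomorphism N -> N would be a cycle of length one. *)
Lemma directed_endo (N : rmod A) (u : rhom N N) :
  indecomposable N -> (exists x, u x != 0) -> bijective u.
Proof.
move=> NI nz; apply: NNPP => nb; apply: dirA.
by exists 1%N, (fun=> N), (fun=> u); split=> //; exact: riso_refl.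
Qed.

(** Otherwise v w is invertible, and w composed with its inverse splits v. *)
Lemma directed_endo0_right (N V : rmod A) (v : rhom V N) (w : rhom N V) :
  indecomposable N -> ~ retraction v -> forall x, v (w x) = 0.
Proof.
move=> NI vr x; apply/eqP; apply: contra_notT vr => nz.
have [|t tK t'K] := @directed_endo _ (rcomp v w) NI; first by exists x; rewrite rcompE.
have [|s sE] := @factor_mono _ _ _ _ _ (rcomp v w) (rid N) (can_inj tK).
  by move=> y; exists (t y); rewrite t'K ridE.
by exists (rcomp w s) => y; rewrite rcompE -(rcompE v w) -[LHS]sE ridE.
Qed.

Lemma directed_endo0_left (L V : rmod A) (u : rhom L V) (w : rhom V L) :
  indecomposable L -> ~ (exists r : rhom V L, forall x, r (u x) = x) ->
  forall x, w (u x) = 0.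
Proof.
move=> LI us x; apply/eqP; apply: contra_notT us => nz.
have [|t tK t'K] := @directed_endo _ (rcomp w u) LI; first by exists x; rewrite rcompE.
have [|s sE] := @factor_mono _ _ _ _ _ (rcomp w u) (rid L) (can_inj tK).
  by move=> y; exists (t y); rewrite t'K ridE.
exists (rcomp s w) => y; apply: (can_inj tK).
by rewrite (rcompE s w) -[LHS]sE ridE rcompE.
Qed.
End Directed.

Section AlmostSplit.
Variables (K : fieldType) (A : falgType K).
Hypothesis dirA : representation_directed A.
Implicit Types (L M N V X Y E : rmod A).
Let all : subcat A := fun=> True.

Lemma lifts_id_retraction M N (g : rhom M N) : lifts_along N g <-> retraction g.
Proof.
split=> [H|[s sE] v]; first by have [s sE] := H (rid N); exists s => y; rewrite -[LHS]sE ridE.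
by exists (rcomp s v) => x; rewrite fcompE rcompE sE.
Qed.

(** Pull the sequence back along v.  If the result does not split, its left map
    extends along f, giving an endomorphism h c of E that is the identity on L; the
    induced endomorphism of N factors through v, hence is zero, so h c retracts E onto
    L, which is impossible. *)
Lemma left_right_almost_split L E N (f : rhom L E) (g : rhom E N) :
  short_exact f g -> indecomposable N -> ~ retraction g ->
  (forall V (u : rhom L V), ~ (exists r : rhom V L, forall x, r (u x) = x) ->
     exists w : rhom E V, u =1 w \o f) ->
  right_almost_split all g.
Proof.
move=> fg NI gr H; split=> // V v _ vr.
have [F [f' [g' [h [f'g' hf gh huniv]]]]] := pullback v fg.
have [[r rf]|nr] := classic (exists r : rhom F L, forall x, r (f' x) = x).
  have [s sE] := section_retraction f'g' rf.
  exists (rcomp h s) => x; rewrite fcompE rcompE [g (h _)]gh /= sE //.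
have [c cE] := H _ _ nr.
have [|th thE] := @factor_epi _ _ _ _ _ g (rcomp g' c) (let: And3 _ _ gS := fg in gS).
  move=> x gx; have [_ fgE _] := fg; have [z <-] := (fgE x).1 gx.
  by rewrite rcompE -[c _]cE (exact_comp0 _ f'g').
have [fI fgE gS] := fg.
have z0 x : g (h (c x)) = 0.
  rewrite [g _]gh /= -(rcompE g' c) [rcomp g' c x]thE /=.
  exact: directed_endo0_right.
have [|r rE] := @factor_mono _ _ _ _ _ f (rcomp h c) fI.
  by move=> x; rewrite rcompE; apply/fgE.
case: gr; apply: (section_retraction fg (r := r)) => x; apply: fI.
by rewrite -[LHS]rE rcompE -[c _]cE; exact: hf.
Qed.

(** The kernel Z of a free cover of N has a map to tau that does not extend;
    some component Z -> L with L indecomposable does not extend either, and the sequence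
    is the pushout along it.  If v : V -> N does not lift, the pullback along v does not
    split, so by the defect formula some w : N -> V does not lift to it, although
    v w = 0 makes (0, w) a lift. *)
Lemma almost_split_ending_at N : indecomposable N -> ~ projective N ->
  exists L M (f : rhom L M) (g : rhom M N), almost_split_sequence all f g.
Proof.
move=> NI Np.
have [I [J [T [nu nuP]]]] := has_presentation N.
have [tau [mu muP]] := copresented T.
have [I' [nu' [p [_ pS]]]] := free_cover N.
have pex := ker_exact pS.
have nr : ~ retraction p.
  case=> s sE; apply: Np => M M' q u qS.
  have [v vE] := free_projective (rcomp u p) qS.
  by exists (rcomp v s) => x; rewrite fcompE (rcompE v s) -[q _]vE rcompE sE.
have nl : ~ extends_along tau (sub_incl (rker p)).
  by move/(extends_pure muP pex)/(lifts_pure nuP pex)/lifts_id_retraction.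
have [L HL] : exists L, [/\ rretract L tau, indecomposable L &
    ~ extends_along L (sub_incl (rker p))].
  apply: NNPP => H; apply: nl; apply: extends_indec => L Lt LI.
  by apply: NNPP => nL; apply: H; exists L.
have [Lt LI /not_all_ex_not[u uE]] := HL.
have [E [f [g [h [fg hf gh univ]]]]] := pushout u pex.
have gr : ~ retraction g.
  move=> /(retraction_section fg)[r rE]; apply: uE; exists (rcomp r h) => x.
  by rewrite fcompE rcompE [h _]hf fcompE rE.
exists L, E, f, g; split=> //; split=> // V v _ vr.
have [E' [f' [g' [h' [f'g' h'f' gh' univ']]]]] := pullback v fg.
apply: NNPP => nV.
have g'r : ~ retraction g'.
  by case=> s sE; apply: nV; exists (rcomp h' s) => x; rewrite fcompE rcompE [g _]gh' /= sE.
have : ~ extends_along tau f'.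
  move=> /(extends_retract Lt)/(_ (rid L))[r rE]; apply: g'r.
  by apply: (section_retraction f'g' (r := r)) => x; rewrite -[LHS]rE ridE.
apply; apply/(extends_pure muP f'g')/(lifts_pure nuP f'g') => w.
have vw0 x : g (rzero N E x) = v (w x).
  by rewrite rzeroE linear0 (directed_endo0_right dirA).
have [k [_ kE]] := univ' _ _ _ vw0.
by exists k => x; rewrite [RHS]kE.
Qed.

(** Dual to [almost_split_ending_at]: the matrix T is chosen to copresent L, and
    the module that it presents plays the part of the inverse translate.  The argument
    yields left almost split maps, whence the use of [left_right_almost_split]. *)
Lemma almost_split_starting_at L : indecomposable L -> ~ injective_mod L ->
  exists M N (f : rhom L M) (g : rhom M N), almost_split_sequence all f g.
Proof.
move=> LI Li.
have [I [J [T [mu muP]]]] := has_copresentation L.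
have [N' [nu nuP]] := presented T.
have [V [E0 [f0 [g0 [fg0 nr0]]]]] : exists V E (f : rhom L E) (g : rhom E V),
    short_exact f g /\ ~ retraction g.
  apply: NNPP => H; apply: Li => M W j u jI.
  have [E [f [g [h [fg hj _ _]]]]] := pushout u (coker_exact jI).
  have gr : retraction g by apply: NNPP => gr; apply: H; exists (quo (rimg j)), E, f, g.
  have [r rf] := retraction_section fg gr; exists (rcomp r h) => x.
  by rewrite fcompE rcompE [h _]hj fcompE rf.
have nl : ~ lifts_along N' g0.
  move=> /(lifts_pure nuP fg0)/(extends_pure muP fg0)/(_ (rid L))[r rE].
  apply: nr0; apply: (section_retraction fg0 (r := r)) => x.
  by rewrite -[LHS]rE ridE.
have [N [NN' NI nN]] : exists N, [/\ rretract N N', indecomposable N &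
    ~ lifts_along N g0].
  apply: NNPP => H; apply: nl; apply: lifts_indec => N Nt NI.
  by apply: NNPP => nL; apply: H; exists N.
have [v vE] := not_all_ex_not _ _ nN.
have [E [f [g [h [fg hf gh univ]]]]] := pullback v fg0.
have gr : ~ retraction g.
  by case=> s sE; apply: vE; exists (rcomp h s) => x; rewrite fcompE rcompE [g0 _]gh /= sE.
exists E, N, f, g; split=> //.
apply: (left_right_almost_split fg) => // V' u us.
have [E' [f' [g' [h' [f'g' h'f g'h' univ']]]]] := pushout u fg.
apply: NNPP => nV.
have : ~ lifts_along N' g'.
  move=> /(lifts_retract NN')/lifts_id_retraction/(retraction_section f'g')[r rE].
  by apply: nV; exists (rcomp r h') => x; rewrite fcompE rcompE [h' _]h'f fcompE rE.
apply; apply/(lifts_pure nuP f'g')/(extends_pure muP f'g') => w.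
have wu0 x : w (u x) = rzero E L (f x).
  by rewrite rzeroE (directed_endo0_left dirA).
have [k [kE _]] := univ' _ _ _ wu0.
by exists k => x; rewrite [RHS]kE.
Qed.
End AlmostSplit.

(** * Restriction along a surjective algebra morphism *)

Section Restriction.
Variables (K : fieldType) (R : algType K) (A : algType K) (phi : {lrmorphism R -> A}).

Lemma restrE (M : rmod A) (v : restr phi M) r : v <* r = (v : M) <* phi r.
Proof. by []. Qed.

Lemma restr_hom_subproof (M N : rmod A) (f : rhom M N) (v : restr phi M) r :
  (f : 'Hom(restr phi M, restr phi N)) (v <* r) = (f v : restr phi N) <* r.
Proof. exact: (rhomP f v (phi r)). Qed.
Definition restr_hom (M N : rmod A) (f : rhom M N) :
  rhom (restr phi M) (restr phi N) := @RHom K R (restr phi M) (restr phi N) f (restr_hom_subproof f).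
Lemma restr_homE (M N : rmod A) (f : rhom M N) x : restr_hom f x = f x.
Proof. by []. Qed.

Lemma restr_dsum (X Y : rmod A) :
  riso (restr phi (dsum X Y)) (dsum (restr phi X) (restr phi Y)).
Proof.
have [||f fE] := @rhom_ex K R (restr phi (dsum X Y)) (dsum (restr phi X) (restr phi Y)) (fun v => v) => //.
by exists f; exists id => x; rewrite fE.
Qed.

Lemma riso_restr (X Y : rmod A) : riso X Y -> riso (restr phi X) (restr phi Y).
Proof. by case=> f fB; exists (restr_hom f). Qed.
End Restriction.

Section Surjective.
Variables (K : fieldType) (R : falgType K) (A : falgType K) (phi : {lrmorphism R -> A}).
Hypothesis phiS : forall a, exists r, phi r = a.
Let C := restricted_modules phi.

Lemma unrestr_hom (M N : rmod A) (f : rhom (restr phi M) (restr phi N)) :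
  exists g : rhom M N, forall x, g x = f x.
Proof.
have H (v : M) a : (f : 'Hom(M, N)) (v <* a) = (f v : N) <* a.
  by have [r <-] := phiS a; exact: (rhomP f v r).
by exists (RHom H).
Qed.

Lemma unrestr_iso (M N : rmod A) : riso (restr phi M) (restr phi N) -> riso M N.
Proof.
by case=> f fB; have [g gE] := unrestr_hom f; exists g; apply: (eq_bij fB) => x; rewrite gE.
Qed.

Section Descend.
Variables (M : rmod R) (H : forall (v : M) r, phi r = 0 -> v <* r = 0).
Let s := (linfun phi)^-1%VF.
Let sK a : phi (s a) = a.
Proof.
have [r <-] := phiS a; have e x : linfun phi x = phi x by rewrite lfunE.
have /lfunP/(_ r) := inv_lfun_def (linfun phi); rewrite !comp_lfunE => H1.
by apply: etrans (etrans H1 (e r)); rewrite /s !e.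
Qed.
Let act_eq (v : M) r r' : phi r = phi r' -> v <* r = v <* r'.
Proof.
move=> e; apply/eqP; rewrite -subr_eq0 -ractBr; apply/eqP/H.
by rewrite raddfB /= e subrr.
Qed.
Definition descend_act (v : M) (a : A) : M := v <* s a.
Lemma descend_linearl a : linear (descend_act^~ a).
Proof. by move=> k u v; rewrite /descend_act ract_linearl. Qed.
Lemma descend_linearr v : linear (descend_act v).
Proof. by move=> k a b; rewrite /descend_act linearP ract_linearr. Qed.
Lemma descend_1 v : descend_act v 1 = v.
Proof.
rewrite -[RHS]ractv1 /descend_act; apply: act_eq.
by rewrite sK; symmetry; exact: rmorph1.
Qed.
Lemma descend_A v a b : descend_act (descend_act v a) b = descend_act v (a * b).
Proof. by rewrite /descend_act ractA; apply: act_eq; rewrite rmorphM /= !sK. Qed.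
(** The A-module structure on an R-module killed by ker phi, through a linear section
    of phi. *)
Definition descend : rmod A := RMod descend_linearl descend_linearr descend_1 descend_A.
Lemma descendP : riso M (restr phi descend).
Proof.
have [|v r|f fE] := @rhom_ex K R M (restr phi descend) (fun v => v) => //.
  by apply: act_eq; rewrite sK.
by exists f; exists id => x; rewrite fE.
Qed.
End Descend.

Lemma restrictedP (M : rmod R) :
  C M <-> forall (v : M) r, phi r = 0 -> v <* r = 0.
Proof.
split=> [[N /risoP[f [g [fK gK]]]] v r r0|H]; last first.
  by exists (descend H); exact: descendP.
by rewrite -[LHS]fK rhomP restrE r0 ract0r linear0.
Qed.

Lemma restricted_retract (X M : rmod R) : rretract X M -> C M -> C X.
Proof.
case=> i [p pi] /restrictedP CM; apply/restrictedP => v r r0.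
by rewrite -[v]pi -rhomP CM // linear0.
Qed.

Lemma restricted_subcategory : is_subcategory C.
Proof.
split.
- by move=> M N MN; apply: restricted_retract; apply/rretract_riso/riso_sym.
- by apply/restrictedP => v r _; apply/rowP; case.
- move=> M N /restrictedP CM /restrictedP CN; apply/restrictedP => -[v w] r r0.
  by rewrite /= /dsum_act /= CM // CN.
- move=> M N CMN; split; apply: restricted_retract CMN.
    exact: rretract_fst.
  exact: rretract_snd.
Qed.

Lemma indec_restr (N : rmod A) : indecomposable N <-> indecomposable (restr phi N).
Proof.
split=> -[N0 NI]; split=> // X Y NXY; last first.
  apply: (NI (restr phi X) (restr phi Y)); apply: riso_trans (restr_dsum phi X Y).
  exact: riso_restr.
have CN : C (restr phi N) by exists N; exact: riso_refl.
have [_ _ _ CS] := restricted_subcategory.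
have CXY : C (dsum X Y) by case: restricted_subcategory => CI _ _ _; exact: CI NXY CN.
have [[X0 XX0] [Y0 YY0]] := CS _ _ CXY.
have /NI : riso N (dsum X0 Y0).
  apply: unrestr_iso; apply: riso_trans NXY _.
  apply: riso_trans (riso_dsum XX0 YY0) _.
  exact/riso_sym/restr_dsum.
by case=> [H|H]; [left|right]; [apply: rnull_riso (riso_sym XX0) _ | apply: rnull_riso (riso_sym YY0) _].
Qed.

Lemma restr_almost_split (L M N : rmod A) (f : rhom L M) (g : rhom M N) :
  almost_split_sequence (fun=> True) f g ->
  almost_split_sequence C (restr_hom phi f) (restr_hom phi g).
Proof.
case=> _ [fI fgE gS] LI [gr gl]; split=> //.
- by split; [exists L | exists M | exists N]; exact: riso_refl.
- exact/indec_restr.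
split=> [[s sE]|V v [V0 /risoP[a [b [aK bK]]]] vr].
  have [s0 s0E] := unrestr_hom s; apply: gr; exists s0 => y.
  by rewrite s0E; exact: sE.
have [v0 v0E] := unrestr_hom (rcomp v b).
have [||w wE] := gl V0 v0 => //.
  case=> s sE; apply: vr; exists (rcomp b (restr_hom phi s)) => y.
  by rewrite rcompE -(rcompE v b) -v0E restr_homE sE.
exists (rcomp (restr_hom phi w) a) => x.
by rewrite fcompE rcompE !restr_homE -[g _]wE v0E rcompE aK.
Qed.

Lemma almost_split_iso_end (L M N N' : rmod R) (f : rhom L M) (g : rhom M N) (a : rhom N N') (b : rhom N' N) :
  cancel a b -> cancel b a -> C N' ->
  almost_split_sequence C f g -> almost_split_sequence C f (rcomp a g).
Proof.
move=> aK bK CN' [[CL CM CN] [fI fgE gS] LI [gr gl]]; split=> //.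
- split=> // [v|y]; last by have [x xE] := gS (b y); exists x; rewrite rcompE xE bK.
  split=> [|e]; last by rewrite rcompE ((fgE v).2 e) linear0.
  by rewrite rcompE => e; apply/fgE; rewrite -[LHS]aK e linear0.
- split=> [[s sE]|V v CV vr].
    by apply: gr; exists (rcomp s a) => y; rewrite rcompE -[LHS]aK -(rcompE a g) sE aK.
  have [||w wE] := gl V (rcomp b v) => //.
    case=> s sE; apply: vr; exists (rcomp s b) => y.
    by rewrite rcompE -[LHS]bK -(rcompE b v) sE bK.
  by exists w => x; rewrite fcompE rcompE -[g _]wE rcompE bK.
Qed.

Lemma almost_split_iso_start (L L' M N : rmod R) (f : rhom L M) (g : rhom M N) (a : rhom L L') (b : rhom L' L) :
  cancel a b -> cancel b a -> C L' ->
  almost_split_sequence C f g -> almost_split_sequence C (rcomp f b) g.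
Proof.
move=> aK bK CL' [[CL CM CN] [fI fgE gS] LI gras]; split=> //.
- split=> // [x y|v].
    by rewrite !rcompE => /fI e; rewrite -[x]bK e bK.
  split=> [/fgE[u <-]|[u <-]]; first by exists (a u); rewrite rcompE aK.
  by apply/fgE; exists (b u); rewrite rcompE.
- by apply: indec_riso LI; apply/risoP; exists a, b.
Qed.

(** Almost split sequences over A stay almost split in the subcategory of restricted
    modules.  The hypotheses compare the two notions of projective and injective object,
    which is where the Ext groups over R enter. *)
Lemma restricted_almost_split : representation_directed A ->
  (forall N N0, riso N (restr phi N0) -> projective N0 -> rel_projective C N) ->
  (forall N N0, riso N (restr phi N0) -> injective_mod N0 -> rel_injective C N) ->
  has_almost_split_sequences C.
Proof.
move=> dirA Hp Hi; split=> [N|L] CX XI nX; have [X0 XX0] := CX.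
  have X0I : indecomposable X0 by apply/indec_restr; exact: indec_riso XX0 XI.
  have [|L [M [f [g fg]]]] := almost_split_ending_at dirA X0I.
    by move=> X0P; apply: nX; apply: Hp XX0 X0P.
  have /risoP[b [a [bK aK]]] := XX0.
  exists (restr phi L), (restr phi M), (restr_hom phi f), (rcomp a (restr_hom phi g)).
  by apply: (almost_split_iso_end aK bK CX); exact: restr_almost_split.
have X0I : indecomposable X0 by apply/indec_restr; exact: indec_riso XX0 XI.
have [|M [N [f [g fg]]]] := almost_split_starting_at dirA X0I.
  by move=> X0P; apply: nX; apply: Hi XX0 X0P.
have /risoP[b [a [bK aK]]] := XX0.
exists (restr phi M), (restr phi N), (rcomp (restr_hom phi f) b), (restr_hom phi g).
by apply: (almost_split_iso_start aK bK CX); exact: restr_almost_split.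
Qed.
End Surjective.

(** * Vanishing of Ext by dimension shifting *)

Section Ext.
Variables (K : fieldType) (R : algType K).
Implicit Types (X Y Z : rmod R).

Definition syzygy_closed (Q : rmod R -> Prop) : Prop :=
  forall X P (p : rhom P X), Q X -> projective P -> surj p -> Q (sub_rmod (rker p)).

Section Shift.
Variables (X : rmod R) (P : proj_resolution X).
Let Z := sub_rmod (rker (res_aug P)).
Lemma shift_aug_ex : exists q : rhom (res_obj P 1) Z,
  res_d P 0 =1 sub_incl (rker (res_aug P)) \o q.
Proof.
apply: factor_mono; first exact: sub_incl_inj.
move=> x; apply: sub_incl_ex; rewrite rkerE; apply/eqP.
by apply/(@res_exact0 _ _ _ P); exists x.
Qed.
(** Truncating a resolution of X gives one of the kernel of the augmentation; in
    positive degrees the cochains, hence the Ext groups, are the same shifted by one. *)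
Lemma shift_resolution : exists P' : proj_resolution Z,
  (forall Y i, (forall f : rhom (res_obj P' i.+1) Y, cocycle f -> coboundary f) ->
     (forall f : rhom (res_obj P i.+2) Y, cocycle f -> coboundary f)).
Proof.
have [q qE] := shift_aug_ex.
have iI := @sub_incl_inj _ _ _ (rker (res_aug P)).
have qS : surj q.
  move=> y; have /(@res_exact0 _ _ _ P)[x xE] : res_aug P (sub_incl _ y) = 0.
    by apply/eqP; rewrite -rkerE; exact: sub_incl_mem.
  by exists x; apply: iI; rewrite -[LHS]qE xE.
have q0 : exact_at (res_d P 1) q.
  move=> v; split=> [e|].
    by apply/(@res_exactS _ _ _ P _); rewrite [LHS]qE /= e linear0.
  by move/(@res_exactS _ _ _ P _) => e; apply: iI; rewrite -[LHS]qE e linear0.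
exists (@ProjResolution K R Z (fun i => res_obj P i.+1) (fun i => res_d P i.+1) q
  (fun i => @res_proj _ _ _ P i.+1) qS q0 (fun i => @res_exactS _ _ _ P i.+1)).
by [].
Qed.
End Shift.

(** Ext^1 vanishes on Q because maps from syzygies extend, and the higher Ext groups
    of X are Ext^1 groups of iterated syzygies of X. *)
Lemma Ext_vanish_shift (Q : rmod R -> Prop) Y : syzygy_closed Q ->
  (forall X P (p : rhom P X), Q X -> projective P -> surj p ->
     extends_along Y (sub_incl (rker p))) ->
  forall X i, Q X -> (0 < i)%N -> Ext_vanishes i X Y.
Proof.
move=> Qs Qe X [//|i] QX _; elim: i X QX => [|i IH] X QX P; last first.
  have QZ := Qs _ _ _ QX (@res_proj _ _ _ P 0) (@res_surj _ _ _ P).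
  by have [P' P'E] := shift_resolution P; apply: P'E; exact: IH.
move=> f fc; have [q qE] := shift_aug_ex P.
have qS : surj q.
  move=> y; have /(@res_exact0 _ _ _ P)[x xE] : res_aug P (sub_incl _ y) = 0.
    by apply/eqP; rewrite -rkerE; exact: sub_incl_mem.
  by exists x; apply: (@sub_incl_inj _ _ _ (rker (res_aug P))); rewrite -[LHS]qE xE.
have [x|f' f'E] := @factor_epi _ _ _ _ _ q f qS.
  move=> qx; have /(@res_exactS _ _ _ P _)[u <-] : res_d P 0 x = 0 by rewrite qE /= qx linear0.
  exact: fc.
have [g gE] := Qe _ _ _ QX (@res_proj _ _ _ P 0) (@res_surj _ _ _ P) f'.
by exists g => x; rewrite [f x]f'E /= gE /= [res_d P 0 x]qE.
Qed.

Lemma projective_retract X Y : rretract X Y -> projective Y -> projective X.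
Proof.
case=> i [p pi] Yp M N q u qS; have [v vE] := Yp _ _ q (rcomp u p) qS.
by exists (rcomp v i) => x; rewrite fcompE rcompE -[q _]vE rcompE pi.
Qed.

Lemma ker_projective X P (p : rhom P X) : projective X -> surj p ->
  exists r : rhom P (sub_rmod (rker p)), forall x, r (sub_incl (rker p) x) = x.
Proof.
move=> Xp pS; apply: (retraction_section (ker_exact pS)).
by have [s sE] := Xp _ _ p (rid X) pS; exists s => y; rewrite -[LHS]sE ridE.
Qed.

Lemma projective_Ext X Y i : projective X -> (0 < i)%N -> Ext_vanishes i X Y.
Proof.
move=> Xp; apply: (@Ext_vanish_shift (fun X => projective X)) => //.
  move=> Z P p Zp Pp pS; have [r rE] := ker_projective Zp pS.
  by apply: projective_retract Pp; exists (sub_incl (rker p)), r.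
move=> Z P p Zp Pp pS w; have [r rE] := ker_projective Zp pS.
by exists (rcomp w r) => x; rewrite fcompE rcompE rE.
Qed.
End Ext.

(** * Relatively projective and relatively injective modules *)

Section Relative.
Variables (K : fieldType) (R : algType K) (C : subcat R).
Definition lifting (X : rmod R) : Prop :=
  forall M N (p : rhom M N), C M -> C N -> surj p -> lifts_along X p.
Definition extending (X : rmod R) : Prop :=
  forall M N (j : rhom M N), C M -> C N -> injective j -> extends_along X j.
End Relative.

Section RestrRelative.
Variables (K : fieldType) (R : falgType K) (A : falgType K) (phi : {lrmorphism R -> A}).
Hypothesis phiS : forall a, exists r, phi r = a.
Let C := restricted_modules phi.

Lemma restr_lifting X (X0 : rmod A) : riso X (restr phi X0) -> projective X0 -> lifting C X.
Proof.
move=> /risoP[f [g [fK gK]]] Xp M N p [M0 /risoP[a [a' [aK a'K]]]] [N0 /risoP[b [b' [bK b'K]]]] pS v.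
have [p0 p0E] := unrestr_hom phiS (rcomp b (rcomp p a')).
have [v0 v0E] := unrestr_hom phiS (rcomp b (rcomp v g)).
have [y|w wE] := Xp _ _ p0 v0.
  have [x xE] := pS (b' y); exists (a x).
  by rewrite p0E !rcompE aK xE b'K.
exists (rcomp a' (rcomp (restr_hom phi w) f)) => x.
rewrite fcompE !rcompE restr_homE; apply: (can_inj bK).
transitivity (v0 (f x)); first by rewrite v0E !rcompE fK.
by rewrite wE fcompE p0E !rcompE.
Qed.

Lemma restr_extending X (X0 : rmod A) : riso X (restr phi X0) -> injective_mod X0 -> extending C X.
Proof.
move=> /risoP[f [g [fK gK]]] Xi M N j [M0 /risoP[a [a' [aK a'K]]]] [N0 /risoP[b [b' [bK b'K]]]] jI v.
have [j0 j0E] := unrestr_hom phiS (rcomp b (rcomp j a')).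
have [v0 v0E] := unrestr_hom phiS (rcomp f (rcomp v a')).
have [x y|w wE] := Xi _ _ j0 v0.
  by rewrite !j0E !rcompE => /(can_inj bK)/jI/(can_inj a'K).
exists (rcomp g (rcomp (restr_hom phi w) b)) => x.
rewrite fcompE !rcompE restr_homE; apply: (can_inj fK); rewrite gK.
transitivity (v0 (a x)); first by rewrite v0E !rcompE aK.
by rewrite wE fcompE j0E !rcompE aK.
Qed.
End RestrRelative.

Lemma ractr_lfunE (K : fieldType) (R : algType K) (M : rmod R) (E : R) (v : M) :
  linfun (@ractr K R M E) v = v <* E.
Proof. by rewrite lfunE. Qed.

(** Here E R = E R E, so that M E is a submodule and M |-> M / M E is exact, and R E
    is the kernel of phi, so that the restricted modules are those with M E = 0. *)
Section QuotientSide.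
Variables (K : fieldType) (R : falgType K) (A : falgType K) (phi : {lrmorphism R -> A}).
Hypothesis phiS : forall a, exists r, phi r = a.
Variable E : R.
Hypotheses (EE : E * E = E) (ER : forall r, E * r * E = E * r).
Hypotheses (phiE : phi E = 0) (kerE : forall r, phi r = 0 -> r * E = r).
Let C := restricted_modules phi.
Implicit Types (M N X Y P Z : rmod R).

Lemma quot_sideP M : C M <-> forall v : M, v <* E = 0.
Proof.
split=> [/(restrictedP phiS) CM v|H]; first exact: CM.
by apply/(restrictedP phiS) => v r /kerE <-; rewrite -ractA H.
Qed.

Lemma mulE_stable M (v : M) r :
  v \in limg (linfun (@ractr K R M E)) -> v <* r \in limg (linfun (@ractr K R M E)).
Proof.
case/memv_imgP=> u _ ->; rewrite ractr_lfunE ractA -ER -ractA.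
apply/memv_imgP; exists (u <* (E * r)); first exact: memvf.
by rewrite ractr_lfunE.
Qed.
Definition mulE M : submodule M := Submodule (@mulE_stable M).
Definition redq M := quo (mulE M).
Definition redp M : rhom M (redq M) := quo_proj (mulE M).
Lemma redp_eq0 M (v : M) : redp M v = 0 <-> v = v <* E.
Proof.
split=> [/quo_proj_eq0/memv_imgP[u _ ->]|e].
  by rewrite ractr_lfunE ractA EE.
apply/quo_proj_eq0; rewrite e; apply/memv_imgP; exists v; first exact: memvf.
by rewrite ractr_lfunE.
Qed.
Lemma redpE M (v : M) : redp M (v <* E) = 0.
Proof. by apply/redp_eq0; rewrite ractA EE. Qed.
Lemma redq_C M : C (redq M).
Proof.
apply/quot_sideP => x; have [v <-] := @quo_proj_surj _ _ _ (mulE M) x.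
by rewrite -rhomP; exact: redpE.
Qed.

(** Z E is the intersection of Z and P E, so Z / Z E embeds into P / P E. *)
Lemma red_factor Z P Y (i : rhom Z P) (w : rhom Z Y) : injective i -> C Y ->
  exists Zb (k : rhom Z Zb) (ib : rhom Zb (redq P)) (wb : rhom Zb Y),
    [/\ C Zb, injective ib, surj k, forall z, ib (k z) = redp P (i z) & w =1 wb \o k].
Proof.
move=> iI CY; pose U := rimg (rcomp (redp P) i).
have [z|k kE] := @factor_mono _ _ _ _ _ (sub_incl U) (rcomp (redp P) i) (@sub_incl_inj _ _ _ U).
  by apply: sub_incl_ex; apply/(rimgP (rcomp (redp P) i)); exists z.
have kE' z : sub_incl U (k z) = redp P (i z) by rewrite -[LHS]kE rcompE.
have kS : surj k.
  move=> y; have /(rimgP (rcomp (redp P) i))[z zE] := sub_incl_mem y.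
  by exists z; apply: (@sub_incl_inj _ _ _ U); rewrite kE' -zE rcompE.
have [z|wb wbE] := @factor_epi _ _ _ _ _ k w kS.
  move=> kz; have /redp_eq0 iz : redp P (i z) = 0 by rewrite -kE' kz linear0.
  have -> : z = z <* E by apply: iI; rewrite {1}iz rhomP.
  by rewrite rhomP; move/quot_sideP: CY => ->.
exists (sub_rmod U), k, (sub_incl U), wb; split=> //; last exact: sub_incl_inj.
apply/quot_sideP => y; apply: (@sub_incl_inj _ _ _ U).
by rewrite rhomP linear0; move/quot_sideP: (redq_C P) => ->.
Qed.

(** Maps Z -> X from a submodule Z of P are maps from Z / Z E, which is a submodule
    of P / P E; they extend because X is injective among restricted modules. *)
Lemma quot_side_injective X (X0 : rmod A) : riso X (restr phi X0) -> injective_mod X0 -> rel_injective C X.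
Proof.
move=> XX0 X0i; have Xe := restr_extending phiS XX0 X0i.
split=> [|i Y i0 CY]; first by exists X0.
apply: (@Ext_vanish_shift _ _ (fun=> True)) => // M P p _ Pp pS w.
have CX : C X by exists X0.
have [Zb [k [ib [wb [CZ ibI kS kE wE]]]]] := red_factor w (@sub_incl_inj _ _ _ (rker p)) CX.
have [w' w'E] := Xe _ _ ib CZ (redq_C P) ibI wb.
by exists (rcomp w' (redp P)) => z; rewrite fcompE rcompE -kE [LHS]wE fcompE [LHS]w'E.
Qed.

(** Lifting X -> X / X E to s : X -> P / P E splits the exact sequence reduced modulo E:
    the map 1 - s p retracts P / P E onto the image of Z = ker p, and a map from Z into a
    restricted module extends through this retraction. *)
Lemma quot_lift_extends X P (p : rhom P X) Y : lifting C X -> surj p -> C Y ->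
  extends_along Y (sub_incl (rker p)).
Proof.
move=> Xl pS CY w.
have [Zb [k [ib [wb [CZ ibI kS kE wE]]]]] := red_factor w (@sub_incl_inj _ _ _ (rker p)) CY.
have [x|pb pbE] := @factor_epi _ _ _ _ _ (redp P) (rcomp (redp X) p) (@quo_proj_surj _ _ _ (mulE P)).
  by move=> /redp_eq0 ->; rewrite rcompE rhomP redpE.
have pbS : surj pb.
  move=> y; have [x <-] := @quo_proj_surj _ _ _ (mulE X) y; have [z <-] := pS x.
  by exists (redp P z); rewrite -[LHS]pbE rcompE.
have [s sE] := Xl _ _ pb (redq_C P) (redq_C X) pbS (redp X).
(* t is the projection 1 - s p composed with P -> P / P E *)
pose t := radd (redp P) (ropp (rcomp s p)).
have tE x : t x = redp P x - s (p x) by rewrite raddE roppE rcompE.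
have [x|t' t'E] := @factor_mono _ _ _ _ _ ib t ibI.
  have [x' x'E] := @quo_proj_surj _ _ _ (mulE P) (t x).
  have : redp X (p x') = 0.
    transitivity (pb (t x)); first by rewrite -x'E -[RHS]pbE rcompE.
    rewrite tE linearB /= -[pb (redp P x)]pbE rcompE -[pb (s _)]sE subrr //.
  move/redp_eq0 => e; have z0 : x' - x' <* E \in (rker p : {vspace P}).
    by rewrite rkerE linearB /= rhomP -e subrr.
  have [z zE] := sub_incl_ex z0; exists (k z).
  by rewrite kE zE linearB /= redpE subr0.
exists (rcomp wb t') => z; rewrite fcompE rcompE [LHS]wE fcompE; congr (wb _).
apply: ibI; rewrite kE -[RHS]t'E tE.
have -> : p (sub_incl (rker p) z) = 0.
  by apply/eqP; rewrite -rkerE; exact: sub_incl_mem.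
by rewrite linear0 subr0.
Qed.

Lemma quot_side_projective X (X0 : rmod A) : riso X (restr phi X0) -> projective X0 -> rel_projective C X.
Proof.
move=> XX0 X0p; have Xl := restr_lifting phiS XX0 X0p.
split=> [|i Y i0 CY]; first by exists X0.
apply: (@Ext_vanish_shift _ _ (lifting C)) => // [M P p Ml Pp pS|M P p Ml Pp pS].
  move=> N N' q CN CN' qS u; have [u' u'E] := quot_lift_extends Ml pS CN' u.
  have [v vE] := Pp _ _ q u' qS.
  by exists (rcomp v (sub_incl (rker p))) => z; rewrite fcompE rcompE -[RHS]vE [LHS]u'E.
exact: quot_lift_extends.
Qed.
End QuotientSide.

(** Here R E = E R E, so that the elements of M killed by E form a submodule, depending
    exactly on M, and E R is the kernel of phi, so that the restricted modules are those
    with M E = 0. *)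
Section SubSide.
Variables (K : fieldType) (R : falgType K) (B : falgType K) (phi : {lrmorphism R -> B}).
Hypothesis phiS : forall a, exists r, phi r = a.
Variable E : R.
Hypotheses (EE : E * E = E) (RE : forall r, E * r * E = r * E).
Hypotheses (phiE : phi E = 0) (kerE : forall r, phi r = 0 -> E * r = r).
Let C := restricted_modules phi.
Implicit Types (M N X Y P Z : rmod R).

Lemma sub_sideP M : C M <-> forall v : M, v <* E = 0.
Proof.
split=> [/(restrictedP phiS) CM v|H]; first exact: CM.
by apply/(restrictedP phiS) => v r /kerE <-; rewrite -ractA H ract0l.
Qed.

Lemma annE_stable M (v : M) r :
  v \in lker (linfun (@ractr K R M E)) -> v <* r \in lker (linfun (@ractr K R M E)).
Proof.
rewrite !memv_ker !ractr_lfunE => /eqP e.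
by rewrite ractA -RE -mulrA -ractA e ract0l.
Qed.
Definition annE M : submodule M := Submodule (@annE_stable M).
Lemma annEP M (v : M) : (v \in (annE M : {vspace M})) = (v <* E == 0).
Proof. by rewrite /= memv_ker ractr_lfunE. Qed.

Lemma annE_C M : C (sub_rmod (annE M)).
Proof.
apply/sub_sideP => v; apply: (@sub_incl_inj _ _ _ (annE M)).
by rewrite rhomP linear0; apply/eqP; rewrite -annEP; exact: sub_incl_mem.
Qed.

Lemma annE_factor N M (u : rhom N M) : C N ->
  exists w : rhom N (sub_rmod (annE M)), u =1 sub_incl (annE M) \o w.
Proof.
move=> /sub_sideP CN; apply: factor_mono; first exact: sub_incl_inj.
by move=> x; apply: sub_incl_ex; rewrite annEP -rhomP CN linear0.
Qed.

(** A map from a restricted module takes values in elements killed by E, and q maps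
    such elements of M onto those of M': if y E = 0 and y = q x, then y is also the image
    of x - x E. *)
Lemma lifting_projective N : C N -> lifting C N -> projective N.
Proof.
move=> CN Nl M M' q u qS.
have [u' u'E] := annE_factor u CN.
have [q' q'E] := annE_factor (rcomp q (sub_incl (annE M))) (annE_C M).
have q'S : surj q'.
  move=> y; have [x xE] := qS (sub_incl (annE M') y).
  have yE : sub_incl (annE M') y <* E = 0 by apply/eqP; rewrite -annEP; exact: sub_incl_mem.
  have : x - x <* E \in (annE M : {vspace M}) by rewrite annEP ractBl ractA EE subrr.
  case/sub_incl_ex=> z zE; exists z; apply: (@sub_incl_inj _ _ _ (annE M')).
  by rewrite -[LHS]q'E rcompE zE linearB /= rhomP xE yE subr0.
have [v vE] := Nl _ _ q' (annE_C M) (annE_C M') q'S u'.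
exists (rcomp (sub_incl (annE M)) v) => x.
by rewrite fcompE [LHS]u'E fcompE vE fcompE rcompE -[LHS]q'E rcompE.
Qed.

Lemma sub_side_projective X (X0 : rmod B) : riso X (restr phi X0) -> projective X0 -> rel_projective C X.
Proof.
move=> XX0 X0p; have CX : C X by exists X0.
split=> // i Y i0 CY; apply: projective_Ext i0.
by apply: lifting_projective => //; exact: restr_lifting XX0 X0p.
Qed.

Lemma sub_side_cover N : C N -> exists P (p : rhom P N), [/\ C P, projective P & surj p].
Proof.
case=> N0 /risoP[a [a' [aK a'K]]].
have [I [nu [p [_ pS]]]] := free_cover N0.
have CF : C (restr phi (free_rmod B I)) by exists (free_rmod B I); exact: riso_refl.
exists (restr phi (free_rmod B I)), (rcomp a' (restr_hom phi p)); split=> //.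
  apply: lifting_projective => //.
  by apply: (restr_lifting phiS (riso_refl _)); exact: free_projective.
by move=> y; have [x xE] := pS (a y); exists x; rewrite rcompE restr_homE xE aK.
Qed.

(** Syzygies of a module from C computed with arbitrary projective modules are syzygies
    inside C only up to projective summands. *)
Definition stably_restricted Y : Prop :=
  exists N P, [/\ C N, projective P & rretract Y (dsum N P)].

(** A form of Schanuel's lemma.  Comparing P -> Y with a surjection P' + Q -> N + Q from a
    projective module, where P' is in C, the composite P -> P' + Q -> P lies over the identity of Y,
    so it differs from the identity of P by a map d to ker p.  The kernel Z' of the
    surjection is contained in P'. *)
Lemma stable_syzygy Y P (p : rhom P Y) : stably_restricted Y -> projective P -> surj p ->
  exists P' Z' (j : rhom Z' P') (a : rhom P P') (a' : rhom (sub_rmod (rker p)) Z')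
    (b' : rhom Z' (sub_rmod (rker p))) (d : rhom P (sub_rmod (rker p))),
   [/\ C P', C Z', injective j,
     forall z, a (sub_incl (rker p) z) = j (a' z) &
     forall z, z = b' (a' z) - d (sub_incl (rker p) z)].
Proof.
move=> [N [Q [CN Qp [s [r rs]]]]] Pp pS.
have [P' [q [CP' P'p qS]]] := sub_side_cover CN.
pose qq : rhom (dsum P' Q) (dsum N Q) := rpair (rcomp q (rfst P' Q)) (rsnd P' Q).
have qqE x y : qq (x, y) = (q x, y) by rewrite rpairE rcompE rfstE rsndE.
have qqS : surj qq by move=> -[x y]; have [z <-] := qS x; exists (z, y).
have [a aE] := Pp _ _ qq (rcomp s p) qqS.
have PQp : projective (dsum P' Q).
  move=> M M' t u tS.
  have [v1 v1E] := P'p _ _ t (rcomp u (rpair (rid P') (rzero P' Q))) tS.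
  have [v2 v2E] := Qp _ _ t (rcomp u (rpair (rzero Q P') (rid Q))) tS.
  exists (rcopair v1 v2) => -[x y]; rewrite fcompE rcopairE linearD /=.
  rewrite -[t (v1 x)]v1E -[t (v2 y)]v2E !rcompE !rpairE !ridE !rzeroE -linearD.
  by congr (u (_, _)); rewrite /= ?addr0 ?add0r.
have [b bE] := PQp _ _ p (rcomp r qq) pS.
have pba x : p (b (a x)) = p x.
  by rewrite -[LHS]bE rcompE -[qq _]aE rcompE rs.
have [x|d dE] := @factor_mono _ _ _ _ _ (sub_incl (rker p))
    (radd (rcomp b a) (ropp (rid P))) (@sub_incl_inj _ _ _ (rker p)).
  by apply: sub_incl_ex; rewrite rkerE raddE roppE ridE rcompE linearB /= pba subrr.
have dE' x : sub_incl (rker p) (d x) = b (a x) - x.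
  by rewrite -[LHS]dE raddE roppE ridE rcompE.
have kp z : p (sub_incl (rker p) z) = 0.
  by apply/eqP; rewrite -rkerE; exact: sub_incl_mem.
have kq z : qq (sub_incl (rker qq) z) = 0.
  by apply/eqP; rewrite -rkerE; exact: sub_incl_mem.
have [z|a' a'E] := @factor_mono _ _ _ _ _ (sub_incl (rker qq))
    (rcomp a (sub_incl (rker p))) (@sub_incl_inj _ _ _ (rker qq)).
  by apply: sub_incl_ex; rewrite rkerE rcompE -[qq _]aE rcompE kp linear0.
have [z|b' b'E] := @factor_mono _ _ _ _ _ (sub_incl (rker p))
    (rcomp b (sub_incl (rker qq))) (@sub_incl_inj _ _ _ (rker p)).
  by apply: sub_incl_ex; rewrite rkerE rcompE -[p _]bE rcompE kq linear0.
have snd0 z : (sub_incl (rker qq) z).2 = 0.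
  by have := kq z; case: (sub_incl _ z) => x y; rewrite qqE => -[].
exists P', (sub_rmod (rker qq)), (rcomp (rfst P' Q) (sub_incl (rker qq))).
exists (rcomp (rfst P' Q) a), a', b', d; split=> //.
- apply/sub_sideP => z; apply: (@sub_incl_inj _ _ _ (rker qq)).
  rewrite rhomP linear0; have := snd0 z; case: (sub_incl _ z) => x y /= ->.
  move/sub_sideP: CP' => H; have := ract0l; rewrite /= /dsum_act /= => H0.
  by rewrite H H0.
- apply: injective_of_ker0 => z; rewrite rcompE rfstE => z1; apply: (@sub_incl_inj _ _ _ (rker qq)).
  by rewrite linear0; have := snd0 z; move: z1; case: (sub_incl _ z) => x y /= -> ->.
- by move=> z; rewrite !rcompE -[sub_incl (rker qq) _]a'E rcompE.
- move=> z; apply: (@sub_incl_inj _ _ _ (rker p)).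
  rewrite linearB /= dE' -[sub_incl _ (b' _)]b'E rcompE -[sub_incl _ (a' _)]a'E rcompE.
  by rewrite opprB addrCA subrr addr0.
Qed.

Lemma sub_side_injective X (X0 : rmod B) : riso X (restr phi X0) -> injective_mod X0 -> rel_injective C X.
Proof.
move=> XX0 X0i; have Xe := restr_extending phiS XX0 X0i.
split=> [|i Y i0 CY]; first by exists X0.
apply: (@Ext_vanish_shift _ _ stably_restricted) => // [M P p Mr Pp pS|M P p Mr Pp pS w|].
- have [P' [Z' [j [a [a' [b' [d [CP' CZ' jI aj dE]]]]]]]] := stable_syzygy Mr Pp pS.
  exists Z', P; split=> //; exists (rpair a' (sub_incl (rker p))), (rcopair b' (ropp d)) => z.
  by rewrite rcopairE rpairE roppE /= -dE.
- have [P' [Z' [j [a [a' [b' [d [CP' CZ' jI aj dE]]]]]]]] := stable_syzygy Mr Pp pS.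
  have [w1 w1E] := Xe _ _ j CZ' CP' jI (rcomp w b').
  exists (radd (rcomp w1 a) (ropp (rcomp w d))) => z.
  rewrite fcompE raddE roppE !rcompE aj -[w1 _]w1E rcompE -linearB.
  by rewrite -dE.
exists Y, (rmod0 R); split=> //.
  move=> M N q u qS; exists (rzero (rmod0 R) M) => x; rewrite fcompE rzeroE linear0.
  have -> : x = 0 by apply/rowP; case.
  exact: linear0.
exact: rretract_fst.
Qed.
End SubSide.

(** * Splitting off the submodule generated by M E *)

Lemma direct_sum_iso (K : fieldType) (R : algType K) (M : rmod R) (X Y : submodule M) :
  (X :&: Y = 0)%VS -> (forall m : M, m \in (X + Y)%VS) ->
  riso M (dsum (sub_rmod X) (sub_rmod Y)).
Proof.
move=> XY0 XYf; apply: riso_sym; exists (rcopair (sub_incl X) (sub_incl Y)).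
apply: inj_surj_bij => [|m].
  apply: injective_of_ker0 => -[x y]; rewrite rcopairE /= => /eqP; rewrite addr_eq0 => /eqP e.
  have : sub_incl X x \in (X :&: Y)%VS.
    by apply/memv_capP; split; [|rewrite e memvN]; exact: sub_incl_mem.
  rewrite XY0 memv0 => /eqP x0; have y0 : sub_incl Y y = 0.
    by apply/eqP; rewrite -oppr_eq0 -e x0.
  congr (_, _); first by apply: (@sub_incl_inj _ _ _ X); rewrite x0 linear0.
  by apply: (@sub_incl_inj _ _ _ Y); rewrite y0 linear0.
have /memv_addP[u uX [v vY ->]] := XYf m.
have [x <-] := sub_incl_ex uX; have [y <-] := sub_incl_ex vY.
by exists (x, y); rewrite rcopairE.
Qed.

Section Generated.
Variables (K : fieldType) (R : falgType K) (M : rmod R) (W : {vspace M}).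
(** The submodule generated by W; the sum over a basis of R keeps it finite. *)
Definition gen_space : {vspace M} :=
  (\sum_(i < \dim {:R}) linfun (@ractr K R M (vbasis {:R})`_i) @: W)%VS.
Lemma gen_space_mem v r : v \in W -> v <* r \in gen_space.
Proof.
move=> vW; rewrite (coord_vbasis (memvf r)) ract_sumr memv_suml // => i _.
rewrite ractZr memvZ //; apply: (subvP (sumv_sup i _ (subvv _))) => //.
by apply/memv_imgP; exists v => //; rewrite ractr_lfunE.
Qed.
Lemma gen_space_sub (U : {vspace M}) :
  (forall v r, v \in W -> v <* r \in U) -> (gen_space <= U)%VS.
Proof.
move=> H; apply/subv_sumP => i _; apply/subvP => u /memv_imgP[v vW ->].
by rewrite ractr_lfunE; exact: H.
Qed.
Lemma gen_stable v r : v \in gen_space -> v <* r \in gen_space.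
Proof.
have H : (gen_space <= linfun (@ractr K R M r) @^-1: gen_space)%VS.
  apply: gen_space_sub => u s uW; rewrite -memv_preim ractr_lfunE ractA.
  exact: gen_space_mem.
by move=> /(subvP H); rewrite -memv_preim ractr_lfunE.
Qed.
Definition gen : submodule M := Submodule gen_stable.
End Generated.

Section Splitting.
Variables (K : fieldType) (R : falgType K) (n : nat).
Variables (E E' : R) (t s : nat -> R).
Hypothesis (one_sum : E + E' + \sum_(1 <= i < n.+1) t i = 1).
Hypotheses (E'E' : E' * E' = E') (E'R : forall r, E' * r * E' = E' * r).
Hypotheses (ERE' : forall r, E * r * E' = 0) (E'E : E' * E = 0).
Hypothesis (tt : forall i, (1 <= i <= n)%N -> t i * t i = t i).
Hypothesis (tt0 : forall i j, (1 <= i <= n)%N -> (1 <= j <= n)%N -> i != j -> t i * t j = 0).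
Hypothesis (E't : forall i, (1 <= i <= n)%N -> E' * t i = 0).
Hypothesis (tE : forall i, (1 <= i <= n)%N -> t i * E = 0).
Hypothesis (sn : s n = 0).
Hypothesis (ts : forall i, (1 <= i < n)%N -> t i * s i = s i).
Hypothesis (st : forall i, (1 <= i < n)%N -> s i * t i.+1 = s i).
Hypothesis (t_span : forall i r, (1 <= i <= n)%N ->
  exists c u v, t i * r = c *: t i + s i * u + v * E').
Hypothesis (E_factor : forall i r, (1 <= i < n)%N ->
  exists u, E * r * t i.+1 = E * u * s i).
Variable M : rmod R.

Let ME := limg (linfun (@ractr K R M E)).
Let X := gen ME.

Lemma ME_mem (m : M) : m <* E \in ME.
Proof. by apply/memv_imgP; exists m; rewrite ?memvf // ractr_lfunE. Qed.

Lemma gen_ME_sub (U : {vspace M}) : (forall m r, m <* (E * r) \in U) -> (X <= U)%VS.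
Proof.
move=> H; apply: gen_space_sub => v r /memv_imgP[u _ ->].
by rewrite ractr_lfunE ractA.
Qed.

Lemma gen_ME_mem (m : M) r : m <* (E * r) \in (X : {vspace M}).
Proof. by rewrite -ractA; apply: gen_space_mem; exact: ME_mem. Qed.

Lemma gen_ME_E' (x : M) : x \in (X : {vspace M}) -> x <* E' = 0.
Proof.
have H : (X <= lker (linfun (@ractr K R M E')))%VS.
  by apply: gen_ME_sub => m r; rewrite memv_ker ractr_lfunE ractA ERE' ract0r.
by move/(subvP H); rewrite memv_ker ractr_lfunE => /eqP.
Qed.

(** The submodule X is pure along the chain: E_factor says that it is generated at the
    vertex 1, so its part at i+1 is the image of its part at i. *)
Lemma gen_ME_factor i (x : M) : (1 <= i < n)%N -> x \in (X : {vspace M}) ->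
  exists2 x', x' \in (X : {vspace M}) & x <* t i.+1 = x' <* s i.
Proof.
move=> iP.
have H : (X <= linfun (@ractr K R M (t i.+1)) @^-1:
            (linfun (@ractr K R M (s i)) @: X))%VS.
  apply: gen_ME_sub => m r; rewrite -memv_preim ractr_lfunE ractA.
  have [u ->] := E_factor r iP; apply/memv_imgP; exists (m <* (E * u)).
    exact: gen_ME_mem.
  by rewrite ractr_lfunE ractA.
by move/(subvP H); rewrite -memv_preim ractr_lfunE => /memv_imgP[x' x'X ->]; exists x';
   rewrite ?ractr_lfunE.
Qed.

(** State of the descending induction: a complement of X has been found on E' and on
    the vertices i, ..., n of the chain. *)
Definition partial_complement i (Y : submodule M) : Prop :=
  [/\ (X :&: Y = 0)%VS,
      forall j m, (i <= j <= n)%N -> m <* t j \in (X + Y)%VS,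
      forall m, m <* E' \in (Y : {vspace M}),
      forall y, y \in (Y : {vspace M}) -> y <* E = 0 &
      forall y j, y \in (Y : {vspace M}) -> (1 <= j < i)%N -> y <* t j = 0].

Lemma complement_base : exists Y, partial_complement n.+1 Y.
Proof.
exists (mulE E'R M).
have YP y : y \in (mulE E'R M : {vspace M}) -> y = y <* E'.
  by case/memv_imgP=> u _ ->; rewrite ractr_lfunE ractA E'E'.
split.
- apply/eqP; rewrite -subv0; apply/subvP => y /memv_capP[/gen_ME_E' yX /YP yY].
  by rewrite yY yX mem0v.
- by move=> j m; rewrite ltnNge => /andP[/negbTE ->].
- by move=> m; apply/memv_imgP; exists m; rewrite ?memvf // ractr_lfunE.
- by move=> y /YP ->; rewrite ractA E'E ract0r.
- by move=> y j /YP -> /andP[j1 jn]; rewrite ractA E't ?ract0r // j1.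
Qed.

(** Let D be the space of elements at the vertex i that s_i maps into Y.  By purity every
    element at i is congruent to one of D modulo X; a complement of X in D is added to Y. *)
Lemma complement_step i Y : (1 <= i <= n)%N -> partial_complement i.+1 Y ->
  exists Y', partial_complement i Y'.
Proof.
move=> iP [XY0 tXY E'Y YE Yt].
pose D : {vspace M} := (fixedSpace (linfun (@ractr K R M (t i)))
   :&: linfun (@ractr K R M (s i)) @^-1: Y)%VS.
have DP d : d \in D -> d <* t i = d /\ d <* s i \in (Y : {vspace M}).
  by move=> /memv_capP[/fixedSpaceP]; rewrite -memv_preim !ractr_lfunE.
have PD d : d <* t i = d -> d <* s i \in (Y : {vspace M}) -> d \in D.
  by move=> d1 d2; apply/memv_capP; split; rewrite -?memv_preim ?ractr_lfunE //;
     apply/fixedSpaceP; rewrite ractr_lfunE.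
have tXD (m : M) : m <* t i \in (X + D)%VS.
  have [x' [x'X [y [yY e]]]] : exists x', x' \in (X : {vspace M}) /\
      exists y, y \in (Y : {vspace M}) /\ (m <* t i) <* s i = x' <* s i + y.
    have [ltin|] := ltnP i n; last first.
      move=> leni; have -> : i = n by apply/eqP; rewrite eqn_leq leni andbT; case/andP: iP.
      exists 0; split; first exact: mem0v.
      by exists 0; split; rewrite ?mem0v // sn !ract0r addr0.
    have iP' : (1 <= i < n)%N by rewrite ltin andbT; case/andP: iP.
    have : m <* s i <* t i.+1 \in (X + Y)%VS by apply: tXY; rewrite leqnn.
    case/memv_addP=> x xX [y yY e].
    have [x' x'X x'E] := gen_ME_factor iP' xX.
    exists x'; split=> //; exists (y <* t i.+1); split; first exact: sub_stable.
    have tn : (1 <= i.+1 <= n)%N by [].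
    by rewrite -x'E -ractDl -e !ractA tt // st // ts.
  have -> : m <* t i = x' <* t i + (m <* t i - x' <* t i) by rewrite addrC subrK.
  apply: memv_add; first exact: sub_stable.
  apply: PD; first by rewrite ractBl !ractA tt.
  rewrite ractBl e ractA.
  have -> : x' <* (t i * s i) = x' <* s i.
    have [ltin|leni] := ltnP i n; first by rewrite ts // ltin andbT; case/andP: iP.
    have -> : i = n by apply/eqP; rewrite eqn_leq leni andbT; case/andP: iP.
    by rewrite sn mulr0.
  by rewrite addrC addKr.
(* a complement of the intersection of D and X in D *)
pose C := (D :\: X)%VS.
have CD c : c \in C -> c \in D by apply/subvP; exact: diffvSl.
have Yst v r : v \in (Y + C)%VS -> v <* r \in (Y + C)%VS.
  case/memv_addP=> y yY [c cC ->]; rewrite ractDl.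
  have [ct cs] := DP _ (CD _ cC).
  have [k [u [w e]]] := t_span r iP.
  have -> : c <* r = k *: c + (c <* s i <* u + c <* w <* E').
    by rewrite -{1}ct ractA e !ractDr ractZr ct -!ractA addrA.
  rewrite addrCA addrC; apply: memv_add; last exact: memvZ.
  apply: memvD; first exact: sub_stable.
  by rewrite addrC; apply: memvD; [exact: E'Y | exact: (sub_stable u cs)].
exists (Submodule Yst); split=> /=.
- apply/eqP; rewrite -subv0; apply/subvP => x /memv_capP[xX /memv_addP[y yY [c cC e]]].
  have [ct cs] := DP _ (CD _ cC).
  have cX : c \in (X : {vspace M}).
    rewrite -ct -[c <* _]add0r -(Yt y i yY); last by rewrite ltnSn andbT; case/andP: iP.
    by rewrite -ractDl -e; exact: sub_stable.
  have : c \in (C :&: X)%VS by apply/memv_capP.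
  rewrite capv_diff memv0 => /eqP c0; rewrite -XY0; apply/memv_capP; split=> //.
  by rewrite e c0 addr0.
- move=> j m /andP[]; rewrite leq_eqVlt => /orP[/eqP <- _|ltij lejn].
    apply: (subvP _ _ (tXD m)); rewrite subv_add addvSl /=.
    apply: subv_trans (addvSl D X) _; rewrite -addv_diff -/C subv_add addvSl andbT.
    exact: subv_trans (addvSr _ _) (addvSr _ _).
  apply: (subvP _ _ (tXY j m _)); last by rewrite ltij.
  by apply: addvS => //; exact: addvSl.
- by move=> m; apply: (subvP (addvSl _ _)).
- move=> v /memv_addP[y yY [c cC ->]]; rewrite ractDl YE // add0r.
  by have [<- _] := DP _ (CD _ cC); rewrite ractA tE // ract0r.
- move=> v j /memv_addP[y yY [c cC ->]] /andP[j1 ji]; rewrite ractDl Yt //; last first.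
    by rewrite j1 ltnW // ltnS.
  have [<- _] := DP _ (CD _ cC); rewrite ractA tt0 ?ract0r ?addr0 //.
    by rewrite j1 (leq_trans (ltnW ji)) //; case/andP: iP.
  by rewrite neq_ltn ji orbT.
Qed.

Lemma splitting : exists X Y : submodule M,
  [/\ (X :&: Y = 0)%VS, forall m : M, m \in (X + Y)%VS,
      forall x, x \in (X : {vspace M}) -> x <* E' = 0,
      forall y, y \in (Y : {vspace M}) -> y <* E = 0 &
      forall U : {vspace M}, (forall m r, m <* (E * r) \in U) -> (X <= U)%VS].
Proof.
have [Y [XY0 tXY E'Y YE _]] : exists Y, partial_complement 1 Y.
  have H k : (k <= n)%N -> exists Y, partial_complement (n.+1 - k) Y.
    elim: k => [_|k IH lekn]; first by rewrite subn0; exact: complement_base.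
    have [Y HY] := IH (ltnW lekn); rewrite subSS.
    apply: (@complement_step (n - k) Y); last by rewrite -subSn // ltnW.
    by rewrite subn_gt0 lekn leq_subr.
  by have := H n (leqnn n); rewrite subSn // subnn.
exists X, Y; split=> // [m|x|]; [|exact: gen_ME_E'|exact: gen_ME_sub].
rewrite -[m]ractv1 -one_sum !ractDr ract_sumr memvD //; first apply: memv_add => //.
  by rewrite -[E]mulr1; exact: gen_ME_mem.
by rewrite big_nat memv_suml // => j jP; exact: tXY.
Qed.
End Splitting.

(** * Basic representation-directed algebras modulo their radical *)

Section PrincipalIdeals.
Variables (K : fieldType) (A : falgType K).
Implicit Types (e x a : A).

Lemma right_idealP u v : reflect (exists a, v = u * a) (v \in (right_ideal u : {vspace A})).
Proof.
apply: (iffP memv_imgP) => [[a _ ->]|[a ->]]; first by exists a; rewrite lfunE.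
by exists a; rewrite ?memvf // lfunE.
Qed.

Lemma idem_idealP e v : e * e = e -> (v \in (right_ideal e : {vspace A})) = (e * v == v).
Proof.
move=> ee; apply/right_idealP/eqP => [[a ->]|<-]; last by exists v.
by rewrite mulrA ee.
Qed.

Lemma eA_val e (v : eA e) : e * e = e -> e * val v = val v.
Proof. by move=> ee; apply/eqP; rewrite -idem_idealP //; exact: subvsP. Qed.

Lemma eA_elt e x : e * e = e -> e * x = x -> exists v : eA e, val v = x.
Proof. by move=> ee /eqP; rewrite -idem_idealP // => xe; exists (Subvs xe). Qed.

Lemma lmul_hom e e' x : e' * e' = e' -> e' * x = x ->
  exists f : rhom (eA e) (eA e'), forall v, val (f v) = x * val v.
Proof.
move=> ee' ex.
have xv (v : eA e) : x * val v \in (right_ideal e' : {vspace A}).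
  by rewrite idem_idealP // mulrA ex.
have [||f fE] := @rhom_ex K A (eA e) (eA e') (fun v => Subvs (xv v)).
- by move=> k u v; apply: val_inj; rewrite /= mulrDr scalerAr.
- by move=> v a; apply: val_inj; rewrite /= /reg_act mulrA.
- by exists f => v; rewrite fE.
Qed.

Lemma eA_hom e (M : rmod A) (f : rhom (eA e) M) (eps v : eA e) : e * e = e ->
  val eps = e -> f v = f eps <* val v.
Proof.
move=> ee eE; rewrite -rhomP; congr (f _); apply: val_inj.
by rewrite /= /reg_act eE eA_val.
Qed.

Lemma eA_projective e : e * e = e -> projective (eA e).
Proof.
move=> ee M N p u pS; have [eps eE] := eA_elt ee ee.
have [m mE] := pS (u eps).
have [||f fE] := @rhom_ex K A (eA e) M (fun v => m <* val v).
- by move=> k v w; rewrite /= ractDr ractZr.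
- by move=> v a; rewrite /= /reg_act ractA.
by exists f => v; rewrite fcompE fE rhomP mE -eA_hom.
Qed.

(** A decomposition of e A gives two orthogonal idempotents with sum e, the images of e
    under the projections. *)
Lemma eA_indecomposable e : primitive_idempotent e -> indecomposable (eA e).
Proof.
case=> ee e0 eprim; have [eps eE] := eA_elt ee ee; split.
  by move=> H; case/eqP: e0; rewrite -eE (H eps) /=.
move=> X Y /risoP[f [g [fK gK]]].
pose p1 := rcomp g (rcomp (rpair (rid X) (rzero X Y)) (rcomp (rfst X Y) f)).
pose p2 := rcomp g (rcomp (rpair (rzero Y X) (rid Y)) (rcomp (rsnd X Y) f)).
have p1E v : p1 v = g ((f v).1, 0) by rewrite !rcompE rfstE rpairE ridE rzeroE.
have p2E v : p2 v = g (0, (f v).2) by rewrite !rcompE rsndE rpairE ridE rzeroE.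
have pE (p : rhom (eA e) (eA e)) v : val (p v) = val (p eps) * val v.
  by rewrite (eA_hom p v ee eE).
have sum_p v : p1 v + p2 v = v.
  rewrite p1E p2E -linearD -[RHS]fK; congr (g _).
  by rewrite [RHS]surjective_pairing; congr (_, _); rewrite /= ?addr0 ?add0r.
have p11 : val (p1 eps) * val (p1 eps) = val (p1 eps).
  by rewrite -pE !p1E gK.
have p22 : val (p2 eps) * val (p2 eps) = val (p2 eps).
  by rewrite -pE !p2E gK.
have p12 : val (p1 eps) * val (p2 eps) = 0.
  by rewrite -pE p1E p2E gK /= linear0.
have p21 : val (p2 eps) * val (p1 eps) = 0.
  by rewrite -pE p1E p2E gK /= linear0.
have [|H|H] := eprim _ _ p11 p22 p12 p21.
- by rewrite -{1}eE -{1}(sum_p eps).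
- left=> x; have : p1 (g (x, 0)) = 0 by apply: val_inj; rewrite pE H mul0r.
  by rewrite p1E gK /= => /(congr1 f); rewrite gK linear0 => -[].
- right=> x; have : p2 (g (0, x)) = 0 by apply: val_inj; rewrite pE H mul0r.
  by rewrite p2E gK /= => /(congr1 f); rewrite gK linear0 => -[].
Qed.
End PrincipalIdeals.

Lemma closed_eigenvector (K : closedFieldType) (V : vectType K) (f : 'End(V)) :
  {:V}%VS != 0%VS -> exists c v, v != 0 /\ f v = c *: v.
Proof.
move=> V0; have bP := vbasisP {:V}.
pose F := passmx.mxof (vbasis {:V}) (vbasis {:V}) f.
have [|c cP] := closed_rootP (char_poly F) _.
  by rewrite size_char_poly eqSS -dimv_eq0 in V0 *.
exists c; move: cP; rewrite -eigenvalue_root_char /eigenvalue => Fc.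
have : passmx.leigenspace f c != 0%VS.
  by rewrite (passmx.leigenspaceE bP) passmx.vsof_eq0 //; exact: (basis_free bP).
rewrite -vpick0 => nz; exists (vpick (passmx.leigenspace f c)); split=> //.
have := memv_pick (passmx.leigenspace f c).
rewrite memv_ker add_lfunE opp_lfunE scale_lfunE id_lfunE subr_eq0.
by move/eqP.
Qed.

(** A modulo its radical is a product of copies of K.  The formulation through
    characters with nil common kernel has the advantage of being symmetric under
    passage to the opposite algebra. *)
Definition split_basic (K : fieldType) (A : algType K) : Prop :=
  exists (n : nat) (lam : 'I_n -> A -> K),
  [/\ forall k, linear (lam k : A -> K^o),
      forall k a b, lam k (a * b) = lam k a * lam k b &
      forall a, (forall k, lam k a = 0) -> exists m, a ^+ m = 0].

Section SplitBasic.
Variables (K : closedFieldType) (A : falgType K).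
Hypothesis dirA : representation_directed A.

(** Left multiplication by e x e on e A has an eigenvalue c, and e x e - c e is not
    invertible, hence zero. *)
Lemma corner_scalar (e x : A) : primitive_idempotent e -> exists c, e * x * e = c *: e.
Proof.
move=> ep; have [ee e0 _] := ep; have eI := eA_indecomposable ep.
have exe : e * (e * x * e) = e * x * e by rewrite !mulrA ee.
have [f fE] := lmul_hom e ee exe.
have [|c [v [v0 vE]]] := @closed_eigenvector K (eA e) f.
  by apply/negP=> /eqP H; case: eI => + _; apply=> v; have := memvf v; rewrite H memv0 => /eqP.
exists c; have exc : e * (e * x * e - c *: e) = e * x * e - c *: e.
  by rewrite mulrBr exe -scalerAr ee.
have [g gE] := lmul_hom e ee exc.
apply/eqP; rewrite -subr_eq0; apply: contraNT v0 => nz.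
have [eps epsE] := eA_elt ee ee.
have [|t tK _] := @directed_endo _ _ dirA _ g eI.
  exists eps; apply: contraNneq nz => /(congr1 val); rewrite gE epsE /=.
  by rewrite mulrBl -scalerAl ee -(mulrA (e * x)) ee => ->.
rewrite -(inj_eq (can_inj tK)) linear0; apply/eqP; apply: val_inj.
rewrite gE mulrBl -fE vE /= -scalerAl eA_val // subrr.
by [].
Qed.

(** The character of index k reads the coefficient of u_k in u_k a u_k.  It is
    multiplicative because u_k A u_l A u_k = 0 for l <> k: the composite of maps
    u_k A -> u_l A -> u_k A is zero or invertible, and in the latter case the two modules
    would be isomorphic.  If all characters vanish at a, a nonzero word
    u_k0 a u_k1 a ... a u_km has no repeated letter, so a is nilpotent. *)
Lemma basic_split : basic A -> split_basic A.
Proof.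
case=> n [u [up uo u1 unr]].
have uI k := eA_indecomposable (up k).
have uu k : u k * u k = u k by case: (up k).
have zero k l a b : k != l -> u k * a * u l * b * u k = 0.
  move=> kl; have e1 : u k * (u k * a * u l) = u k * a * u l by rewrite !mulrA uu.
  have e2 : u l * (u l * b * u k) = u l * b * u k by rewrite !mulrA uu.
  have [f fE] := lmul_hom (u l) (uu k) e1.
  have [g gE] := lmul_hom (u k) (uu l) e2.
  have fr : ~ retraction f.
    case=> s sE; have [kl' _] := indec_retract sE (uI l) (uI k).1.
    exact: unr kl kl'.
  have [eps epsE] := eA_elt (uu k) (uu k).
  have := directed_endo0_right dirA g (uI k) fr eps => /(congr1 val).
  rewrite fE gE epsE /= -(mulrA (u l * b)) uu !mulrA -(mulrA (u k * a)) uu.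
  by [].
have u0 k : u k != 0 by case: (up k).
pose c k (x : A) : K := coord [tuple u k] ord0 x.
have cE k d : c k (d *: u k) = d.
  have -> : c k (d *: u k) = d * c k (u k) by rewrite /c linearZ.
  have -> : c k (u k) = (ord0 == ord0 :> 'I_1)%:R.
    by rewrite /c -[X in coord _ _ X]/([tuple u k]`_(@ord0 0)) coord_free ?seq1_free ?u0.
  by rewrite eqxx mulr1.
pose lam k a := c k (u k * a * u k).
have lamE k a : u k * a * u k = lam k a *: u k.
  by have [d dE] := corner_scalar a (up k); rewrite /lam dE cE.
exists n, lam; split.
- move=> k d a b; rewrite /lam /c.
  by rewrite mulrDr mulrDl -scalerAr -scalerAl linearP.
- move=> k a b; rewrite -[LHS](cE k) -lamE -[in LHS](mul1r b) -u1.
  rewrite mulr_suml !mulr_sumr mulr_suml (bigD1 k) //= big1 => [|l lk]; last first.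
    by rewrite !mulrA zero // eq_sym.
  rewrite addr0; have -> : u k * (a * (u k * b)) * u k = (u k * a * u k) * (u k * b * u k).
    by rewrite -!mulrA (mulrA (u k) (u k)) uu.
  by rewrite !lamE -scalerAl -scalerAr uu scalerA cE.
move=> a a0; exists n.
have aa k : u k * a * u k = 0 by rewrite lamE a0 scale0r.
(* W k [:: k1; ...; km] is the word u_k a u_k1 a ... a u_km *)
pose fix W (k : 'I_n) (s : seq 'I_n) : A :=
  if s is l :: s' then u k * a * W l s' else u k.
have uW k s : u k * W k s = W k s by case: s => [|l s] /=; rewrite ?mulrA uu.
have Win k s : forall l, k \in s -> exists y z, W l s = y * u k * z.
  elim: s => [//|j s IH] l; rewrite inE => /orP[/eqP <-|ks].
    by exists (u l * a), (W k s); rewrite /= -[in LHS]uW mulrA.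
  by have [y [z yz]] := IH j ks; exists (u l * a * y), z; rewrite /= yz !mulrA.
have W0 k s : k \in s -> W k s = 0.
  case: s => [//|l s]; rewrite inE => /orP[/eqP <-|ks] /=.
    by rewrite -uW mulrA aa mul0r.
  have [<-|kl] := eqVneq k l; first by rewrite -uW mulrA aa mul0r.
  have [y [z yz]] := Win k s l ks; rewrite -uW yz.
  by rewrite !mulrA zero // mul0r.
have Wu s : forall k, ~~ uniq (k :: s) -> W k s = 0.
  elim: s => [//|l s IH] k; rewrite cons_uniq negb_and negbK => /orP[/W0 //|us] /=.
  by rewrite IH // mulr0.
have exp m : forall z l, (forall s, size s = m -> z * W l s = 0) -> z * u l * a ^+ m = 0.
  elim: m => [|m IH] z l H; first by rewrite mulr1 (H [::]).
  rewrite exprS mulrA -[a ^+ m]mul1r -u1 mulr_suml mulr_sumr big1 // => j _.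
  rewrite mulrA; apply: IH => s sm; have := H (j :: s).
  by rewrite /= !mulrA; apply; rewrite sm.
rewrite -[LHS]mul1r -u1 mulr_suml big1 // => k _; rewrite -[u k]mul1r.
apply: exp => s sn; rewrite Wu ?mulr0 //; apply/negP => /card_uniqP /= H.
by have := max_card (mem (k :: s)); rewrite H sn card_ord ltnn.
Qed.
End SplitBasic.

Lemma split_basic_opp (K : fieldType) (A : falgType K) : split_basic A -> split_basic A^c.
Proof.
case=> n [lam [ll lm ln]]; exists n, lam; split.
- exact: ll.
- by move=> k a b; rewrite [LHS]lm mulrC.
- move=> a /ln[m am]; exists m; rewrite -[RHS]am.
  elim: m {am} => [//|m IH]; rewrite exprS IH.
  by rewrite exprSr.
Qed.

Section OneDim.
Variables (K : fieldType) (A : falgType K).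

(** For a character lam with lam e = 1, the submodule f A + e (ker lam) is f A or e A.
    If it were e A for all characters that are nonzero at e, then e would lie in
    f A + e x with x in the kernel of all characters; as x is nilpotent, e would lie
    in f A. *)
Lemma simple_top (e f : A) : split_basic A -> e * e = e ->
  simple_factor (right_ideal f) (right_ideal e) ->
  forall a, exists c b, e * a = c *: e + f * b.
Proof.
move=> [n [lam [ll lm ln]]] ee [fe nef simp].
have ef : ~ exists b, e = f * b.
  case=> b eb; case/negP: nef; apply/subvP => v /right_idealP[a ->].
  by apply/right_idealP; exists (b * a); rewrite eb mulrA.
have [k kP] : exists k, forall x, lam k x = 0 -> ~ exists b, e = e * x + f * b.
  apply: NNPP => H.
  have Hk k : exists x b, lam k x = 0 /\ e = e * x + f * b.
    apply: NNPP => H'; apply: H; exists k => x x0 [b e1]; apply: H'.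
    by exists x, b.
  have [x [b [x0 xE]]] : exists x b, (forall k, lam k x = 0) /\ e = e * x + f * b.
    have [x [b [x0 xE]]] : exists x b, (forall k, k \in enum 'I_n -> lam k x = 0) /\ e = e * x + f * b.
      elim: (enum 'I_n) => [|k s [x [b [x0 xE]]]].
        by exists 1, 0; rewrite mulr1 mulr0 addr0.
      have [y [b' [y0 yE]]] := Hk k; exists (y * x), (b + b' * x); split.
        move=> j; rewrite inE lm => /orP[/eqP ->|js]; first by rewrite y0 mul0r.
        by rewrite x0 // mulr0.
      by rewrite {1}xE {1}yE mulrDl !mulrDr !mulrA -addrA (addrC (f * b)).
    by exists x, b; split=> // k; apply: x0; rewrite mem_enum.
  have [m xm] := ln x x0; apply: ef.
  have [b' ->] : exists b', e = e * x ^+ m + f * b'.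
    elim: m {xm} => [|m [b' IH]]; first by exists 0; rewrite mulr1 mulr0 addr0.
    exists (b' + b * x ^+ m); rewrite {1}IH {1}xE exprS mulrDl mulrDr !mulrA.
    by rewrite -addrA (addrC (f * b')).
  by exists b'; rewrite xm mulr0 add0r.
have lk0 : lam k 0 = 0 by have := ll k (-1) 0 0; rewrite scaler0 addr0 => ->; rewrite scaleN1r addNr.
have lkE a c : lam k (a - c *: e) = lam k a - c * lam k e.
  by rewrite addrC -scaleNr ll /GRing.scale /= mulNr addrC.
(* the submodule f A + e (ker lam) of e A *)
pose ker := lker (linfun (linear_map_of (ll k))).
have kerE x : (x \in ker) = (lam k x == 0).
  by rewrite memv_ker (lfunE (linear_map_of (ll k))).
pose W : {vspace A} := (right_ideal f + amull e @: ker)%VS.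
have Wst (v : regular_rmod A) a : v \in (W : {vspace regular_rmod A}) -> v <* a \in (W : {vspace regular_rmod A}).
  case/memv_addP=> x /right_idealP[b ->] [y /memv_imgP[z zk ->] ->].
  rewrite /= /reg_act mulrDl; apply: memv_add.
    by apply/right_idealP; exists (b * a); rewrite mulrA.
  apply/memv_imgP; exists (z * a); rewrite ?lfunE /= ?mulrA //.
  by move: zk; rewrite !kerE lm => /eqP ->; rewrite mul0r.
have feb : exists b, f = e * b.
  by apply/right_idealP; apply: (subvP fe); apply/right_idealP; exists 1; rewrite mulr1.
(* lam e is 0 or 1, and kP with x = e excludes 0 *)
have lke : lam k e = 1.
  have ne : lam k e != 0.
    by apply/negP=> /eqP e0; apply: (kP e e0); exists 0; rewrite ee mulr0 addr0.
  by apply: (mulfI ne); rewrite -lm ee mulr1.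
have [||Wf|eW] := simp (Submodule Wst).
- exact: addvSl.
- rewrite /= subv_add fe /=; apply/subvP => v /memv_imgP[z _ ->].
  by apply/right_idealP; exists z; rewrite lfunE.
- move=> a; exists (lam k a).
  have : e * (a - lam k a *: e) \in W.
    apply: (subvP (addvSr _ _)); apply/memv_imgP; exists (a - lam k a *: e).
      by rewrite kerE lkE lke mulr1 subrr.
    by rewrite lfunE.
  move/(subvP Wf)/right_idealP => [b bE]; exists b; rewrite -bE.
  by rewrite mulrBr -scalerAr ee addrC subrK.
- have : e \in W by apply: (subvP eW); apply/right_idealP; exists 1; rewrite mulr1.
  case/memv_addP=> x /right_idealP[b ->] [y /memv_imgP[z zk ->] e1].
  have [] := kP z; first by apply/eqP; rewrite -kerE.
  by exists b; rewrite {1}e1 lfunE addrC.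
Qed.
End OneDim.

(** * Path algebras, realizations and abutments *)

Section PathAlgebraFacts.
Variables (K : fieldType) (h : nat).

(** The vertices are numbered from 0 in the type of paths and from 1 in [kpath]. *)
Definition kapath_of i j (ij : (i <= j)%N) (jh : (j <= h)%N) : kapath h.+1 :=
  exist (fun p : 'I_h.+1 * 'I_h.+1 => (p.1 <= p.2)%N)
    (Ordinal (leq_ltn_trans ij (jh : (j < h.+1)%N)), Ordinal (jh : (j < h.+1)%N)) ij.

Lemma kapath_eq (p q : kapath h.+1) :
  psrc p = psrc q :> nat -> ptgt p = ptgt q :> nat -> p = q.
Proof.
case: p q => [[i j] ij] [[i' j'] ij']; rewrite /psrc /ptgt /= => ei ej.
by apply: val_inj; congr (_, _); exact: val_inj.
Qed.

Lemma kpathE i j (q : kapath h.+1) :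
  kpath K h.+1 i j q = (((psrc q).+1 == i) && ((ptgt q).+1 == j))%:R.
Proof. by rewrite ffunE. Qed.

Lemma kpath_mul i j k : (1 <= i <= j)%N -> (j <= k <= h.+1)%N ->
  kpath K h.+1 i j * kpath K h.+1 j k = kpath K h.+1 i k.
Proof.
case: i => // i; case: j => // j; case: k => [|k]; first by rewrite ltn0.
move=> ij /andP[jk kh]; have jh := leq_trans jk kh.
pose q0 := @kapath_of i j ij jh; pose r0 := @kapath_of j k jk kh.
have q0P q : ((psrc q).+1 == i.+1) && ((ptgt q).+1 == j.+1) = (q == q0).
  apply/idP/eqP => [/andP[/eqP[e1] /eqP[e2]]|->]; last by rewrite /= !eqxx.
  exact: kapath_eq.
have r0P q : ((psrc q).+1 == j.+1) && ((ptgt q).+1 == k.+1) = (q == r0).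
  apply/idP/eqP => [/andP[/eqP[e1] /eqP[e2]]|->]; last by rewrite /= !eqxx.
  exact: kapath_eq.
have xE q : kpath K h.+1 i.+1 j.+1 q = (q == q0)%:R by rewrite kpathE q0P.
have yE r : kpath K h.+1 j.+1 k.+1 r = (r == r0)%:R by rewrite kpathE r0P.
apply/ffunP => p; rewrite [LHS]ffunE (bigD1 q0) //= [X in _ + X]big1 => [|q /negPf qq]; last first.
  by rewrite big1 // => r _; rewrite xE qq mul0r.
rewrite addr0 xE eqxx big_mkcond (bigD1 r0) //= big1 => [|r /negPf rr]; last first.
  by case: ifP => // _; rewrite yE rr mulr0.
rewrite yE eqxx mul1r addr0 kpathE.
have -> : is_concat q0 r0 p = ((psrc p).+1 == i.+1) && ((ptgt p).+1 == k.+1).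
  by rewrite /is_concat -!(inj_eq val_inj) /= eqxx.
by case: (_ && _).
Qed.

Lemma kpath_sum (z : KA K h.+1) :
  z = \sum_p z p *: kpath K h.+1 (psrc p).+1 (ptgt p).+1.
Proof.
apply/ffunP => p; rewrite sum_ffunE (bigD1 p) //= big1 => [|q qp].
  by rewrite addr0 ffunE kpathE !eqxx /GRing.scale /= mulr1.
rewrite ffunE kpathE; have [/andP[/eqP[e1] /eqP[e2]]|_] := boolP (_ && _).
  by case/eqP: qp; apply: kapath_eq.
exact: scaler0.
Qed.

Lemma footing_surj (A : falgType K) (e f : nat -> A) (F : {lrmorphism A -> KA K h.+1}) :
  is_footing e f F -> forall z, exists a, F a = z.
Proof.
move=> [_ Fe Ff] z.
have H i d : (1 <= i)%N -> (i + d <= h.+1)%N -> exists a, F a = kpath K h.+1 i (i + d).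
  move=> i1; elim: d => [|d IH] dh.
    by exists (e i); rewrite addn0 Fe // i1 -[i]addn0.
  have [|a aE] := IH; first by apply: leq_trans dh; rewrite leq_add2l.
  exists (a * f (i + d)%N); rewrite rmorphM /= aE Ff; last first.
    by rewrite -addnS dh andbT (leq_trans i1) // leq_addr.
  by rewrite addnS kpath_mul // ?i1 ?leq_addr // leqnSn -addnS.
have H' (p : kapath h.+1) : exists a, F a = kpath K h.+1 (psrc p).+1 (ptgt p).+1.
  have [||a aE] := H (psrc p).+1 (ptgt p - psrc p)%N => //.
    by rewrite addSn subnKC; [exact: ltn_ord | exact: (valP p)].
  by exists a; rewrite aE addSn subnKC //; exact: (valP p).
pose b (p : kapath h.+1) := ((linfun F)^-1)%VF (kpath K h.+1 (psrc p).+1 (ptgt p).+1).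
have bE p : F (b p) = kpath K h.+1 (psrc p).+1 (ptgt p).+1.
  have [a aE] := H' p; rewrite /b -aE.
  have Fl x : linfun F x = F x by rewrite lfunE.
  have /lfunP/(_ a) := inv_lfun_def (linfun F); rewrite !comp_lfunE => H1.
  by apply: etrans (etrans H1 (Fl a)); rewrite !Fl.
exists (\sum_p z p *: b p); rewrite [RHS]kpath_sum linear_sum.
by apply: eq_bigr => p _; rewrite linearZ /= bE.
Qed.
End PathAlgebraFacts.

Section Realization.
Variables (K : fieldType) (A : falgType K) (P : rmod A) (N : nat) (e f : nat -> A).
Hypotheses (sbA : split_basic A) (real : left_realization P N e f).

Lemma realization_idem i : (1 <= i <= N)%N -> e i * e i = e i.
Proof. by case/(lr_prim real). Qed.

Lemma realization_ef i : (1 <= i < N)%N -> e i * f i = f i.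
Proof.
move=> iP; have := lr_arrow real iP; rewrite -{2}(lr_arrow real iP) => _.
rewrite -[in LHS](lr_arrow real iP) !mulrA realization_idem ?(lr_arrow real) //.
by case/andP: iP => -> /ltnW.
Qed.
Lemma realization_fe i : (1 <= i < N)%N -> f i * e i.+1 = f i.
Proof.
move=> iP; rewrite -[in LHS](lr_arrow real iP) -mulrA realization_idem ?(lr_arrow real) //.
by case/andP: iP.
Qed.

Lemma realization_top i a : (1 <= i <= N)%N -> exists c b, e i * a = c *: e i + f i * b.
Proof.
by move=> iP; apply: simple_top => //; [exact: realization_idem | exact: (lr_simple real)].
Qed.

(** The path of length m along the chain, starting at the vertex i. *)
Fixpoint chain_path i m : A := if m is m'.+1 then chain_path i m' * f (i + m')%N else e i.

Lemma chain_pathS i m : (1 <= i < N)%N -> f i * chain_path i.+1 m = chain_path i m.+1.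
Proof.
move=> iP; elim: m => [|m IH] /=.
  by rewrite realization_fe // addn0 realization_ef.
by rewrite mulrA IH /= addSnnS.
Qed.

Lemma e_chain_path i m : (1 <= i <= N)%N -> e i * chain_path i m = chain_path i m.
Proof. by move=> iP; elim: m => [|m IH] /=; rewrite ?realization_idem // mulrA IH. Qed.

Lemma chain_path_e i m : (1 <= i)%N -> (i + m <= N)%N -> chain_path i m * e (i + m)%N = chain_path i m.
Proof.
move=> i1; case: m => [|m] /= im; first by rewrite addn0 realization_idem // i1 -[i]addn0.
by rewrite -mulrA addnS realization_fe // -addnS im andbT (leq_trans i1) // leq_addr.
Qed.

Lemma chain_path_span d i a : (1 <= i)%N -> (i + d)%N = N ->
  exists c : nat -> K, e i * a = \sum_(m < d.+1) c m *: chain_path i m.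
Proof.
elim: d i a => [|d IH] i a i1 id.
  have iP : (1 <= i <= N)%N by rewrite i1 -id addn0 leqnn.
  have [c [b ->]] := realization_top a iP; exists (fun=> c).
  have -> : i = N by rewrite -id addn0.
  by rewrite big_ord1 (lr_last real) mul0r addr0.
have iN : (1 <= i < N)%N by rewrite i1 -id addnS ltnS leq_addr.
have iP : (1 <= i <= N)%N by rewrite i1 ltnW //; case/andP: iN.
have [c0 [b ->]] := realization_top a iP.
have [c cE] := IH i.+1 b isT (etrans (addSnnS i d) id).
exists (fun m => if m is m'.+1 then c m' else c0).
rewrite big_ord_recl /=; congr (_ + _).
rewrite -(realization_fe iN) -mulrA cE mulr_sumr; apply: eq_bigr => m _ /=.
by rewrite -scalerAr chain_pathS //= /bump /=.
Qed.

(** By [chain_path_span] e_i A is spanned by the paths starting at i, and the images of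
    these paths under F have distinct unit coordinates.  The map F is not
    supposed multiplicative, for it is antimultiplicative on the opposite algebra. *)
Lemma separated_inj (n : nat) (F : {linear A -> KA K n}) i a : (1 <= i <= N)%N ->
  (forall m, (i + m <= N)%N -> exists q, forall m', (i + m' <= N)%N ->
     F (chain_path i m') q = (m' == m)%:R) ->
  F (e i * a) = 0 -> e i * a = 0.
Proof.
case/andP=> i1 iN sep.
have [c cE] := @chain_path_span (N - i) i a i1 (subnKC iN); rewrite cE => F0.
have le (m : 'I_(N - i).+1) : (i + m <= N)%N.
  by apply: (@leq_trans (i + (N - i))); [rewrite leq_add2l -ltnS | rewrite subnKC].
apply: big1 => m _; have [q qE] := sep m (le m).
have : F (\sum_(m < (N - i).+1) c m *: chain_path i m) q = 0 by rewrite F0 ffunE.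
rewrite linear_sum sum_ffunE (bigD1 m) //= big1 => [|m' mm']; last first.
  by rewrite linearZ ffunE qE // -[m' == m :> nat]/(m' == m) (negPf mm') scaler0.
rewrite addr0 linearZ ffunE qE // eqxx /GRing.scale /= mulr1 => ->.
exact: scale0r.
Qed.

Variable E : A.
Hypotheses (EE : E * E = E) (e1E : forall a, e 1%N * a * E = 0).

Lemma abutment_killed (v : P) : v <* E = 0.
Proof.
have [f0 [g0 [fK gK]]] := (risoP _ _).1 (lr_iso real).
rewrite -[LHS]gK rhomP; have -> : g0 v <* E = 0; last exact: linear0.
apply: val_inj; rewrite /= /reg_act.
by have /right_idealP[a ->] := subvsP (g0 v); exact: e1E.
Qed.

(** View E a e_{i+1} as a map from e_{i+1} A, a submodule of P, to E A.  No nonzero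
    summand of E A embeds into P, because P E = 0; so the map extends to P, which means
    that it is left multiplication by a multiple of the path f_1 ... f_i. *)
Lemma abutment_factor i a : left_abutment P -> (1 <= i < N)%N ->
  exists b, E * a * e i.+1 = E * b * f i.
Proof.
move=> [_ Pp _ Pext] iP; have [i1 iN] := andP iP.
have [f0 [g0 [fK gK]]] := (risoP _ _).1 (lr_iso real).
have N1 : (1 <= 1 <= N)%N by rewrite (leq_trans _ iN).
have e11 := realization_idem N1.
have iS : (1 <= i.+1 <= N)%N by [].
have eii := realization_idem iS.
have [L LE] := lmul_hom (e i.+1) e11 (e_chain_path i N1).
have pinj m : (1 + m <= N)%N -> forall v, e (1 + m)%N * v = v -> chain_path 1 m * v = 0 -> v = 0.
  elim: m => [|m IH] mN v ev pv; first by rewrite -ev.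
  have mP : (1 <= 1 + m < N)%N by [].
  apply: (lr_inj real mP); first by rewrite idem_idealP ?realization_idem // ev.
  apply: IH; first exact: ltnW.
    by rewrite mulrA realization_ef.
  by rewrite mulrA.
have LI : injective L.
  apply: injective_of_ker0 => v /(congr1 val); rewrite LE /= => pv; apply: val_inj => /=.
  by apply: (pinj i) => //; exact: eA_val.
pose J := rcomp f0 L.
have JI : injective J by move=> x y; rewrite !rcompE => /(can_inj fK)/LI.
pose U := rimg J.
have [k kE] := @factor_mono _ _ _ _ _ J (sub_incl U) JI (fun x => elimT (rimgP J _) (sub_incl_mem x)).
have ex : E * (E * a * e i.+1) = E * a * e i.+1 by rewrite !mulrA EE.
have [g gE] := lmul_hom (e i.+1) EE ex.
have ext : extends_along (eA E) (sub_incl U).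
  apply: extends_indec => X XE XI.
  have Xp : projective X by apply: projective_retract XE (eA_projective EE).
  apply: (Pext X XI Xp) => -[V /risoP[a1 [a2 [a1K _]]]].
  have XE0 (x : X) : x <* E = 0.
    rewrite -[LHS]a1K rhomP; have -> : a1 x <* E = 0; last exact: linear0.
    by apply: (@sub_incl_inj _ _ _ V); rewrite rhomP linear0 abutment_killed.
  case: XI => X0 _; apply: X0 => x; case: XE => j [p pj].
  have [eps epsE] := eA_elt EE EE.
  rewrite -[x]pj (eA_hom p _ EE epsE) -[eps](_ : eps <* E = eps); last first.
    by apply: val_inj; rewrite /= /reg_act epsE.
  by rewrite rhomP XE0 ract0l.
have [g' g'E] := ext (rcomp g k).
have [eps epsE] := eA_elt eii eii; have [eps1 eps1E] := eA_elt e11 e11.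
have [w wE] : exists w : sub_rmod U, sub_incl U w = J eps.
  by apply: sub_incl_ex; apply/(rimgP J); exists eps.
have kw : k w = eps by apply: JI; rewrite -wE [RHS]kE.
have pP : chain_path 1 i * e i.+1 = chain_path 1 i by apply: chain_path_e.
have Le : L eps = eps1 <* chain_path 1 i.
  by apply: val_inj; rewrite LE epsE /= /reg_act eps1E e_chain_path.
have E1 : E * a * e i.+1 = val (g eps) by rewrite gE epsE -(mulrA (E * a)) eii.
have E2 : g eps = g' (f0 eps1) <* chain_path 1 i.
  by rewrite -rhomP -rhomP -Le -(rcompE f0 L) -/J -wE -kw -(rcompE g k) [LHS]g'E.
have pS : chain_path 1 i = chain_path 1 i.-1 * f i by rewrite -[in LHS](prednK i1) /= add1n prednK.
exists (val (g' (f0 eps1)) * chain_path 1 i.-1).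
by rewrite E1 E2 /= /reg_act pS -{1}(eA_val (g' (f0 eps1)) EE) !mulrA.
Qed.
End Realization.

(** * Injectivity of the footings on the chain *)

Section Complement.
Variables (K : fieldType) (A : falgType K) (N : nat) (e : nat -> A).
Hypothesis (ee : forall i, (1 <= i <= N)%N -> e i * e i = e i).
Hypothesis (eo : forall i j, (1 <= i <= N)%N -> (1 <= j <= N)%N -> i != j -> e i * e j = 0).
Let E := 1 - \sum_(1 <= i < N.+1) e i.

Lemma sum_idem_l i : (1 <= i <= N)%N -> e i * (\sum_(1 <= j < N.+1) e j) = e i.
Proof.
move=> iP; rewrite mulr_sumr (bigD1_seq i) ?iota_uniq ?mem_index_iota //=.
rewrite ee // big_seq_cond big1 ?addr0 // => j /andP[].
by rewrite mem_index_iota ltnS => jP ji; rewrite eo // eq_sym.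
Qed.
Lemma sum_idem_r i : (1 <= i <= N)%N -> (\sum_(1 <= j < N.+1) e j) * e i = e i.
Proof.
move=> iP; rewrite mulr_suml (bigD1_seq i) ?iota_uniq ?mem_index_iota //=.
rewrite ee // big_seq_cond big1 ?addr0 // => j /andP[].
by rewrite mem_index_iota ltnS => jP ji; rewrite eo.
Qed.
Lemma compl_l i : (1 <= i <= N)%N -> e i * E = 0.
Proof. by move=> iP; rewrite mulrBr mulr1 sum_idem_l // subrr. Qed.
Lemma compl_r i : (1 <= i <= N)%N -> E * e i = 0.
Proof. by move=> iP; rewrite mulrBl mul1r sum_idem_r // subrr. Qed.
Lemma compl_idem : E * E = E.
Proof.
rewrite {2}/E mulrBr mulr1 mulr_sumr big_nat big1 ?subr0 // => i iP; exact: compl_r.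
Qed.
Lemma compl_absorb_l a : (forall i, (1 <= i <= N)%N -> e i * a = 0) -> E * a = a.
Proof.
move=> H; rewrite mulrBl mul1r mulr_suml big_nat big1 ?subr0 // => i iP; exact: H.
Qed.
Lemma compl_absorb_r a : (forall i, (1 <= i <= N)%N -> a * e i = 0) -> a * E = a.
Proof.
move=> H; rewrite mulrBr mulr1 mulr_sumr big_nat big1 ?subr0 // => i iP; exact: H.
Qed.
End Complement.

Section LeftSide.
Variables (K : fieldType) (A : falgType K) (h : nat) (P : rmod A) (e f : nat -> A).
Hypotheses (sbA : split_basic A) (real : left_realization P h.+1 e f).
Variable (F : {lrmorphism A -> KA K h.+1}).
Hypothesis foot : is_footing e f F.

Lemma footing_path i m : (1 <= i)%N -> (i + m <= h.+1)%N ->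
  F (chain_path e f i m) = kpath K h.+1 i (i + m).
Proof.
have [_ Fe Ff] := foot; move=> i1; elim: m => [|m IH] im /=.
  by rewrite Fe ?addn0 // i1 -[i]addn0.
by rewrite addnS rmorphM /= IH ?Ff ?kpath_mul //; lia.
Qed.

Lemma footing_inj_left i a : (1 <= i <= h.+1)%N -> F (e i * a) = 0 -> e i * a = 0.
Proof.
move=> iP; apply: (separated_inj sbA real (F := F) iP) => m im.
have i0 : (i.-1 <= (i + m).-1)%N by lia.
have ih : ((i + m).-1 <= h)%N by lia.
exists (kapath_of i0 ih) => m' im'; rewrite /= footing_path ?kpathE /=; try lia.
by congr (nat_of_bool _)%:R; lia.
Qed.
End LeftSide.

Section RightSide.
Variables (K : fieldType) (B : falgType K) (h : nat) (I : rmod B) (eps g : nat -> B).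
Hypotheses (sbB : split_basic B) (real : right_realization I h.+1 eps g).
Variable (G : {lrmorphism B -> KA K h.+1}).
Hypothesis foot : is_footing eps g G.

Lemma right_idem i : (1 <= i <= h.+1)%N -> eps i * eps i = eps i.
Proof.
move=> iP; have jP : (1 <= h.+2 - i <= h.+1)%N by lia.
have := realization_idem real jP; rewrite (_ : h.+2 - (h.+2 - i) = i)%N //; lia.
Qed.
Lemma right_orth i j : (1 <= i <= h.+1)%N -> (1 <= j <= h.+1)%N -> i != j -> eps i * eps j = 0.
Proof.
move=> iP jP ij; have i'P : (1 <= h.+2 - i <= h.+1)%N by lia.
have j'P : (1 <= h.+2 - j <= h.+1)%N by lia.
have ij' : (h.+2 - j != h.+2 - i)%N by lia.
have := lr_orth real j'P i'P ij'.
rewrite (_ : h.+2 - (h.+2 - i) = i)%N; last by lia.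
by rewrite (_ : h.+2 - (h.+2 - j) = j)%N; last by lia.
Qed.
Lemma right_arrow_l i : (1 <= i < h.+1)%N -> eps i * g i = g i.
Proof.
move=> iP; have jP : (1 <= h.+1 - i < h.+1)%N by lia.
have := realization_fe real jP.
rewrite (_ : h.+2 - (h.+1 - i).+1 = i)%N; last by lia.
by rewrite (_ : h.+1 - (h.+1 - i) = i)%N; last by lia.
Qed.
Lemma right_arrow_r i : (1 <= i < h.+1)%N -> g i * eps i.+1 = g i.
Proof.
move=> iP; have jP : (1 <= h.+1 - i < h.+1)%N by lia.
have := realization_ef real jP.
rewrite (_ : h.+2 - (h.+1 - i) = i.+1)%N; last by lia.
by rewrite (_ : h.+1 - (h.+1 - i) = i)%N; last by lia.
Qed.

Let e' i : B^c := eps (h.+2 - i)%N.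
Let f' i : B^c := g (h.+1 - i)%N.

(** In the opposite algebra the chain of eps and g is traversed backwards, so that paths
    starting at i become paths ending at h + 2 - i. *)
Lemma footing_opp_path i m : (1 <= i)%N -> (i + m <= h.+1)%N ->
  G (chain_path e' f' i m) = kpath K h.+1 (h.+2 - (i + m)) (h.+2 - i).
Proof.
have [_ Ge Gf] := foot; move=> i1; elim: m => [|m IH] im /=.
  by rewrite addn0 Ge //; lia.
have -> : G (chain_path e' f' i m * f' (i + m)%N) = G (g (h.+1 - (i + m))) * G (chain_path e' f' i m).
  exact: (rmorphM G (g (h.+1 - (i + m))) (chain_path e' f' i m)).
rewrite IH ?Gf; try lia.
rewrite (_ : (h.+1 - (i + m)).+1 = (h.+2 - (i + m)))%N; last by lia.
by rewrite kpath_mul ?addnS ?subSS //; lia.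
Qed.

Lemma footing_inj_right i b : (1 <= i <= h.+1)%N -> G (b * eps i) = 0 -> b * eps i = 0.
Proof.
move=> iP.
have lG : linear (fun b : B^c => G b) by move=> k x y; exact: linearP.
have jP : (1 <= h.+2 - i <= h.+1)%N by lia.
have iE : (h.+2 - (h.+2 - i) = i)%N by lia.
have := @separated_inj K (B^c) _ _ _ _ (split_basic_opp sbB) real h.+1 (linear_map_of lG) _ (b : B^c) jP.
rewrite /= iE; apply=> m im.
have i0 : (h.+1 - (h.+2 - i + m) <= h.+1 - (h.+2 - i))%N by lia.
have ih : (h.+1 - (h.+2 - i) <= h)%N by lia.
exists (kapath_of i0 ih) => m' im'; rewrite footing_opp_path ?kpathE /=; try lia.
by congr (nat_of_bool _)%:R; lia.
Qed.
End RightSide.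

(** * The gluing *)

Theorem proposition2p35 (K : closedFieldType) (A B : falgType K)
    (basicA : basic A) (basicB : basic B)
    (directedA : representation_directed A)
    (directedB : representation_directed B)
    (h : nat) (P : rmod A) (I : rmod B)
    (abutP : left_abutment P) (abutI : right_abutment I)
    (e f : nat -> A) (realP : left_realization P h.+1 e f)
    (eps g : nat -> B) (realI : right_realization I h.+1 eps g)
    (fP : {lrmorphism A -> KA K h.+1}) (footP : is_footing e f fP)
    (gI : {lrmorphism B -> KA K h.+1}) (footI : is_footing eps g gI) :
  is_gluing (fun _ : rmod (glue fP gI) => True)
    (restricted_modules (glue_snd fP gI))
    (restricted_modules (glue_fst fP gI)).
Proof.
have sbA := basic_split directedA basicA.
have sbB := basic_split directedB basicB.
have [fPE fPe fPf] := footP; have [gIE gIe gIf] := footI.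
pose R : falgType K := glue fP gI.
pose pa : {lrmorphism R -> A} := glue_fst fP gI.
pose pb : {lrmorphism R -> B} := glue_snd fP gI.
have glueP (r : R) : fP (pa r) = gI (pb r) by apply/eqP; exact: (valP r).
have glue_ext (r r' : R) : pa r = pa r' -> pb r = pb r' -> r = r'.
  by move=> ra rb; apply: val_inj; apply: injective_projections.
pose mk (a : A) (b : B) : R := insubd (0 : R) (a, b).
have mkP a b : fP a = gI b -> pa (mk a b) = a /\ pb (mk a b) = b.
  move=> ab; have ab' : (a, b) \in glue_pred fP gI by apply/eqP.
  by split; rewrite /pa /pb /= /glue_fst /glue_snd /mk insubdK.
have paS a : exists r : R, pa r = a.
  have [b bE] := footing_surj footI (fP a); exists (mk a b).
  by case: (mkP a b (esym bE)).
have pbS b : exists r : R, pb r = b.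
  have [a aE] := footing_surj footP (gI b); exists (mk a b).
  by case: (mkP a b aE).
pose EA := 1 - \sum_(1 <= i < h.+2) e i.
pose EB := 1 - \sum_(1 <= i < h.+2) eps i.
have ee := realization_idem realP; have eo := lr_orth realP.
have ff := right_idem realI; have fo := right_orth realI.
have eEA := compl_l ee eo; have EAe := compl_r ee eo.
have fEB := compl_l ff fo; have EBf := compl_r ff fo.
have EAA := compl_idem ee eo; have EBB := compl_idem ff fo.
rewrite -/EA in eEA EAe EAA; rewrite -/EB in fEB EBf EBB.
have injA := footing_inj_left sbA realP footP.
have injB := footing_inj_right sbB realI footI.
have fPEA : fP EA = 0 by exact: fPE.
have gIEB : gI EB = 0 by exact: gIE.
have eAE i a : (1 <= i <= h.+1)%N -> e i * a * EA = 0.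
  by move=> iP; rewrite -mulrA injA // !rmorphM /= fPEA !mulr0.
have EBe i b : (1 <= i <= h.+1)%N -> EB * b * eps i = 0.
  by move=> iP; rewrite injB // !rmorphM /= gIEB !mul0r.
have kerA a : fP a = 0 -> EA * a = a.
  move=> a0; apply: compl_absorb_l => i iP.
  by apply: injA => //; rewrite rmorphM /= a0 mulr0.
have kerB b : gI b = 0 -> b * EB = b.
  move=> b0; apply: compl_absorb_r => i iP.
  by apply: injB => //; rewrite rmorphM /= b0 mul0r.
have EAR a : EA * a * EA = a * EA.
  rewrite -mulrA; apply: compl_absorb_l => i iP; rewrite mulrA; exact: eAE.
have EBR b : EB * b * EB = EB * b.
  apply: compl_absorb_r => i iP; exact: EBe.
have [Ea Eb] := mkP EA 0 (etrans fPEA (esym (rmorph0 gI))).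
have [E'a E'b] := mkP 0 EB (etrans (rmorph0 fP) (esym gIEB)).
set E := mk EA 0 in Ea Eb; set E' := mk 0 EB in E'a E'b.
have paM x y : pa (x * y) = pa x * pa y by exact: rmorphM.
have pbM x y : pb (x * y) = pb x * pb y by exact: rmorphM.
have paD x y : pa (x + y) = pa x + pa y by exact: raddfD.
have paN x : pa (- x) = - pa x by exact: raddfN.
have pbD x y : pb (x + y) = pb x + pb y by exact: raddfD.
have paZ k x : pa (k *: x) = k *: pa x by exact: linearZ.
have pa0 : pa 0 = 0 by exact: rmorph0.
have pb0 : pb 0 = 0 by exact: rmorph0.
have E'E' : E' * E' = E' by apply: glue_ext; rewrite ?paM ?pbM ?E'a ?E'b ?mul0r.
have EE : E * E = E by apply: glue_ext; rewrite ?paM ?pbM ?Ea ?Eb ?mul0r.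
have E'R r : E' * r * E' = E' * r.
  by apply: glue_ext; rewrite ?paM ?pbM ?E'a ?E'b ?mul0r.
have RE r : E * r * E = r * E.
  by apply: glue_ext; rewrite ?paM ?pbM ?Ea ?Eb ?mulr0.
(* ker phi = R E' and ker psi = E R *)
have kpa r : pa r = 0 -> r * E' = r.
  move=> r0; apply: glue_ext; rewrite ?paM ?pbM ?E'a ?E'b ?mulr0 ?r0 //.
  by apply: kerB; rewrite -glueP r0 rmorph0.
have kpb r : pb r = 0 -> E * r = r.
  move=> r0; apply: glue_ext; rewrite ?paM ?pbM ?Ea ?Eb ?mul0r ?r0 //.
  by apply: kerA; rewrite glueP r0 rmorph0.
have CAP := quot_sideP paS E'a kpa.
have CBP := sub_sideP pbS Eb kpb.
pose t i : R := mk (e i) (eps i).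
(* the arrows, extended by zero at the end of the chain *)
pose s i : R := if (i < h.+1)%N then mk (f i) (g i) else 0.
have tP i : (1 <= i <= h.+1)%N -> pa (t i) = e i /\ pb (t i) = eps i.
  by move=> iP; apply: mkP; rewrite fPe // gIe.
have sP i : (1 <= i < h.+1)%N -> pa (s i) = f i /\ pb (s i) = g i.
  by move=> iP; rewrite /s; case/andP: (iP) => _ ->; apply: mkP; rewrite fPf // gIf.
have split_mod (M : rmod R) : exists X Y : submodule M,
  [/\ (X :&: Y = 0)%VS, forall m : M, m \in (X + Y)%VS,
      forall x, x \in (X : {vspace M}) -> x <* E' = 0,
      forall y, y \in (Y : {vspace M}) -> y <* E = 0 &
      forall U : {vspace M}, (forall m r, m <* (E * r) \in U) -> (X <= U)%VS].
  apply: (@splitting _ _ h.+1 E E' t s) => //.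
  - apply: glue_ext; rewrite !(paD, pbD) ?(Ea, Eb, E'a, E'b).
      rewrite addr0 [pa (\sum_(_ <= _ < _) _)]raddf_sum (eq_big_nat _ _ (F2 := e)).
        by rewrite subrK; symmetry; exact: rmorph1.
      by move=> i iP; case: (tP i iP).
    rewrite add0r [pb (\sum_(_ <= _ < _) _)]raddf_sum (eq_big_nat _ _ (F2 := eps)).
      by rewrite subrK; symmetry; exact: rmorph1.
    by move=> i iP; case: (tP i iP).
  - by move=> r; apply: glue_ext; rewrite !(paM, pbM) ?(Ea, Eb, E'a, E'b) ?pa0 ?pb0 ?mulr0 ?mul0r.
  - by apply: glue_ext; rewrite !(paM, pbM) ?(Ea, Eb, E'a, E'b) ?pa0 ?pb0 ?mulr0 ?mul0r.
  - by move=> i iP; have [ta tb] := tP i iP; apply: glue_ext; rewrite !(paM, pbM) ?(ta, tb) ?ee ?ff.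
  - move=> i j iP jP ij; have [ta tb] := tP i iP; have [ta' tb'] := tP j jP.
    by apply: glue_ext; rewrite !(paM, pbM) ?(ta, tb, ta', tb') ?pa0 ?pb0 ?eo ?fo.
  - move=> i iP; have [ta tb] := tP i iP.
    by apply: glue_ext; rewrite !(paM, pbM) ?(ta, tb, E'a, E'b) ?pa0 ?pb0 ?mul0r ?EBf.
  - move=> i iP; have [ta tb] := tP i iP.
    by apply: glue_ext; rewrite !(paM, pbM) ?(ta, tb, Ea, Eb) ?pa0 ?pb0 ?mulr0 ?eEA.
  - by rewrite /s ltnn.
  - move=> i iP; have [sa sb] := sP i iP; have [|ta tb] := tP i; first by lia.
    by apply: glue_ext; rewrite !(paM, pbM) ?(ta, tb, sa, sb) ?(realization_ef realP) ?(right_arrow_l realI).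
  - move=> i iP; have [sa sb] := sP i iP; have [|ta tb] := tP i.+1; first by lia.
    by apply: glue_ext; rewrite !(paM, pbM) ?(ta, tb, sa, sb) ?(realization_fe realP) ?(right_arrow_r realI).
  - move=> i r iP; have [ta tb] := tP i iP.
    have [c [b eb]] := realization_top sbA realP (pa r) iP.
    (* v has image 0 in A, so v = v E' *)
    have [u uE] := paS b; pose v := t i * r - c *: t i - s i * u.
    have sa : pa (s i) = f i.
      have [ilt|ige] := ltnP i h.+1; first by case: (sP i) => //; rewrite ilt andbT; case/andP: iP.
      have -> : i = h.+1 by lia.
      by rewrite /s ltnn pa0 (lr_last realP).
    exists c, u, v; rewrite kpa; first by rewrite /v -[_ - _ - _]addrA -opprD [RHS]addrCA subrr addr0.
    rewrite /v !paD !paN paZ !paM ta sa uE eb.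
    by rewrite (addrC (c *: _)) addrK subrr.
  - move=> i r iP; have [|ta tb] := tP i.+1; first by lia.
    have [sa sb] := sP i iP.
    have e1E a : e 1%N * a * EA = 0 by exact: eAE.
    have [b bE] := abutment_factor realP EAA e1E (pa r) abutP iP.
    have [u uE] := paS b; exists u.
    by apply: glue_ext; rewrite !(paM, pbM) ?(Ea, Eb) ?ta ?sa ?uE ?bE ?mul0r.
split.
- by split; [split | exact: restricted_subcategory | exact: restricted_subcategory].
- by [].
- move=> M; split=> // _; have [X [Y [XY0 XYf XE' YE _]]] := split_mod M.
  have MXY := direct_sum_iso XY0 XYf.
  exists [:: sub_rmod X; sub_rmod Y]; split.
    case=> [_|[_|//]]; [left; apply/CAP => x|right; apply/CBP => y].
      by apply: (@sub_incl_inj _ _ _ X); rewrite rhomP linear0 XE' //; exact: sub_incl_mem.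
    by apply: (@sub_incl_inj _ _ _ Y); rewrite rhomP linear0 YE //; exact: sub_incl_mem.
  apply: riso_trans MXY _; rewrite /dsums /=; apply: riso_dsum (riso_refl _) _.
  apply/risoP; exists (rpair (rid (sub_rmod Y)) (rzero _ (rmod0 R))).
  exists (rfst (sub_rmod Y) (rmod0 R)); split=> [y|[y z]]; first by rewrite rpairE rfstE ridE.
  rewrite rfstE rpairE ridE; congr (_, _).
  by apply/rowP; case.
- split.
    apply: (restricted_almost_split paS directedA) => N N0.
      exact: (quot_side_projective paS E'E' E'R E'a kpa).
    exact: (quot_side_injective paS E'E' E'R E'a kpa).
  apply: (restricted_almost_split pbS directedB) => N N0.
    exact: (sub_side_projective pbS EE RE Eb kpb).
  exact: (sub_side_injective pbS EE RE Eb kpb).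
- move=> M N F CM nCM [M0 MI] /CBP NE x.
  have [X [Y [XY0 XYf XE' YE Xmin]]] := split_mod M.
  have [X0|Y0] := MI _ _ (direct_sum_iso XY0 XYf).
    case: nCM; apply/CBP => m; have /memv_addP[x' xX [y yY ->]] := XYf m.
    have [z <-] := sub_incl_ex xX; rewrite (X0 z) linear0 add0r; exact: YE.
  (* now M is its summand X, which is generated by M E *)
  have XF : (X <= rker F)%VS.
    by apply: Xmin => m r; rewrite rkerE -ractA !rhomP NE ract0l.
  have /memv_addP[x' xX [y yY ->]] := XYf x; have [z <-] := sub_incl_ex yY.
  rewrite (Y0 z) linear0 addr0; apply/eqP; rewrite -rkerE; exact: (subvP XF).
- move=> N M F /CBP NE /CAP ME.
  have [y|k kE] := @factor_mono _ _ _ _ _ (sub_incl (rimg F)) F (@sub_incl_inj _ _ _ _).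
    by apply: sub_incl_ex; apply/(rimgP F); exists y.
  exists (sub_rmod (rimg F)), k, (sub_incl (rimg F)); split=> //.
    apply/CAP => y; apply: (@sub_incl_inj _ _ _ (rimg F)).
    by rewrite rhomP ME linear0.
  apply/CBP => y; apply: (@sub_incl_inj _ _ _ (rimg F)).
  have /(rimgP F)[x xE] := sub_incl_mem y.
  by rewrite rhomP -xE -rhomP NE !linear0.
Qed.
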